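(* Let $L\subset M\times\mathbb{H}^2$ be a Willmore surface in $\mathbb{H}P^1$ with Hopf fields $A,Q$. Choose non-zero $\beta\in(\mathbb{H}^2)^*$ and $a\in\mathbb{H}^2$ such that $\langle\beta,a\rangle=0$. Then $$d\langle\beta,*Aa\rangle=0=d\langle\beta,*Qa\rangle .$$ If $g,h:M\to\mathbb{H}\subset\mathbb{H}P^1$ are immersions that satisfy $$dg=2\langle\beta,*Aa\rangle,\qquad dh=2\langle\beta,*Qa\rangle,$$ then they are again Willmore surfaces (called forward, respectively backward, Bäcklund transforms of $L$). The free choice of $\beta$ (that is, of its line in $(\mathbb{H}^2)^*$) gives a whole $S^4$ of such pairs of Bäcklund transforms; for given $\beta$, different choices of $a$ result in Moebius transforms $g\mapsto g\lambda$, $h\mapsto h\lambda$ with a constant $\lambda\in\mathbb{H}\setminus\{0\}$.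
   Context: $\mathbb{H}$ denotes the quaternions; quaternionic vector spaces are right vector spaces, and $\langle\beta,x\rangle$ is the evaluation of a quaternionic linear form $\beta$ on $x$. $M$ is a Riemann surface with complex structure $J$ on $TM$, and $*\omega(X)=\omega(JX)$ for 1-forms $\omega$. Constant vectors $a\in\mathbb{H}^2$ are regarded as constant sections of $H:=M\times\mathbb{H}^2$. A map $M\to\mathbb{H}P^1$ is identified with the quaternionic line subbundle $L\subset H$ whose fibre at $p$ is the value at $p$. A map $g:M\to\mathbb{H}$ is regarded as a map into $\mathbb{H}P^1$ via $x\mapsto\begin{pmatrix}x\\1\end{pmatrix}\mathbb{H}$. Let $\pi:H\to H/L$ be the projection and $\delta\in\Omega^1(\mathrm{Hom}(L,H/L))$, $\delta(X)\psi=\pi(d\psi(X))$ for $\psi\in\Gamma(L)$, the derivative of $L$. $L$ is immersed if $\delta_p$ is injective on $T_pM$ for all $p$; $L$ is a holomorphic curve if there is $J_L\in\Gamma(\mathrm{End}(L))$ with $J_L^2=-I$ and $*\delta=\delta J_L$. Mean curvature sphere: for an immersed holomorphic curve $L$ there is a unique $S\in\Gamma(\mathrm{End}(H))$ with $S^2=-I$, $SL=L$, $(dS)L\subset L$, $*\delta=\delta\circ S=S\circ\delta$ (with $S$ also denoting the induced endomorphism of $H/L$) and $Q|_L=0$, where $Q:=\frac14(SdS-*dS)$. The Hopf fields are $Q$ and $A:=\frac14(SdS+*dS)$. Willmore surface: an immersed holomorphic curve $L$ with $d*A=0$ (equivalently $d*Q=0$, i.e. its mean curvature sphere $S$ is harmonic).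 For compact $M$ this is equivalent to $L$ being a critical point of $W(L)=\frac1\pi\int_M\langle A\wedge *A\rangle$ under variations of the immersion, where $\langle B\rangle=\frac18\mathrm{trace}_{\mathbb{R}}B$. *)

(* Defs.v *)
From HB Require Import structures.
From mathcomp Require Import all_boot all_order all_algebra.
From mathcomp Require Import all_classical all_reals all_analysis.
From mathcomp Require Import ring.

Set Implicit Arguments.
Unset Strict Implicit.
Unset Printing Implicit Defensive.

Import Order.TTheory GRing.Theory Num.Theory.
Import numFieldNormedType.Exports.

Local Open Scope classical_set_scope.
Local Open Scope ring_scope.

(* The quaternion x0 + x1 i + x2 j + x3 k is the row (x0, x1, x2, x3); the
   alias carries the normed R-vector space structure of R^4 together with the
   (noncommutative) quaternion product. *)
Definition quat (R : realType) := 'rV[R]_4.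

HB.instance Definition _ (R : realType) := NormedModule.on (quat R).

Section QuaternionRing.
Variable R : realType.
Implicit Types x y z : quat R.

Definition qmk (a b c d : R) : quat R := \row_(i < 4) [:: a; b; c; d]`_i.

Definition qmul x y : quat R :=
  let x0 := x 0 0 in let x1 := x 0 1 in let x2 := x 0 2 in let x3 := x 0 3 in
  let y0 := y 0 0 in let y1 := y 0 1 in let y2 := y 0 2 in let y3 := y 0 3 in
  qmk (x0 * y0 - x1 * y1 - x2 * y2 - x3 * y3)
      (x0 * y1 + x1 * y0 + x2 * y3 - x3 * y2)
      (x0 * y2 - x1 * y3 + x2 * y0 + x3 * y1)
      (x0 * y3 + x1 * y2 - x2 * y1 + x3 * y0).

Lemma quatP x y :
  x 0 0 = y 0 0 -> x 0 1 = y 0 1 -> x 0 2 = y 0 2 -> x 0 3 = y 0 3 -> x = y.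
Proof.
move=> h0 h1 h2 h3; apply/rowP => i.
case: i => -[|[|[|[|//]]]] hi;
  [move: h0 | move: h1 | move: h2 | move: h3];
  by congr (_ = _); congr (_ _ _); apply: val_inj.
Qed.

Lemma qmkE a b c d : ((qmk a b c d 0 0 = a) * (qmk a b c d 0 1 = b)
  * (qmk a b c d 0 2 = c) * (qmk a b c d 0 3 = d))%type.
Proof. by rewrite !mxE. Qed.

Lemma qmulA : associative qmul.
Proof. by move=> x y z; apply: quatP; rewrite /qmul !qmkE; ring. Qed.

Lemma qmul1l : left_id (qmk 1 0 0 0) qmul.
Proof. by move=> x; apply: quatP; rewrite /qmul !qmkE; ring. Qed.

Lemma qmul1r : right_id (qmk 1 0 0 0) qmul.
Proof. by move=> x; apply: quatP; rewrite /qmul !qmkE; ring. Qed.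

Lemma qmulDl : left_distributive qmul +%R.
Proof.
move=> x y z; apply: quatP; rewrite [RHS]mxE /qmul !qmkE;
  rewrite !(mxE _ (fun i j => x i j + y i j)); ring.
Qed.

Lemma qmulDr : right_distributive qmul +%R.
Proof.
move=> x y z; apply: quatP; rewrite [RHS]mxE /qmul !qmkE;
  rewrite !(mxE _ (fun i j => y i j + z i j)); ring.
Qed.

Lemma qone_neq0 : qmk 1 0 0 0 != 0.
Proof.
by apply/eqP => /rowP/(_ 0); rewrite qmkE mxE => /eqP; rewrite oner_eq0.
Qed.

HB.instance Definition _ := GRing.Zmodule_isNzRing.Build (quat R)
  qmulA qmul1l qmul1r qmulDl qmulDr qone_neq0.

End QuaternionRing.

(* H^2 is the space of columns, a right vector space by entrywise right
   multiplication; (H^2)^* is the space of rows, a left vector space for [*:].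
   [rscale] is the right scalar multiplication (it is not [*:]). *)
Notation Hvec R := 'cV[quat R]_2.
Notation Hform R := 'rV[quat R]_2.

Definition rscale (R : realType) (v : Hvec R) (l : quat R) : Hvec R :=
  \col_i (v i 0 * l).

Definition pairing (R : realType) (b : Hform R) (x : Hvec R) : quat R :=
  (b *m x) 0 0.

Section Plane.
Variable R : realType.

(* R * R is C = {x + i y}; [Jplane] is the multiplication by i. *)
Definition Jplane (X : R * R) : R * R := (- X.2, X.1).

(* For open D: F is of class C^n, resp. C^oo, on D. *)
Fixpoint Cn (V : normedModType R) (n : nat) (D : set (R * R))
    (F : R * R -> V) : Prop :=
  if n is n'.+1 then
    (forall z, D z -> differentiable F z) /\
    (forall X, Cn n' D (fun z => 'D_X F z))
  else forall z, D z -> {for z, continuous F}.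

Definition Cinfty (V : normedModType R) (D : set (R * R)) (F : R * R -> V) :=
  forall n, Cn n D F.

Definition holomorphic_at (F : R * R -> R * R) (z : R * R) : Prop :=
  differentiable F z /\
  forall X, ('d F z : R * R -> R * R) (Jplane X) = Jplane ('d F z X).

Record chart (M : Type) := Chart {
  cdom : set M;
  cmap : M -> R * R;
  cinv : R * R -> M }.

Definition is_chart (M : topologicalType) (c : chart M) : Prop :=
  [/\ open (cdom c), open (cmap c @` cdom c),
      {within cdom c, continuous (cmap c)},
      {within cmap c @` cdom c, continuous (cinv c)} &
      forall p, cdom c p -> cinv c (cmap c p) = p].

End Plane.

(* Second countability is not required: by Rado's theorem it is automatic. *)
Record riemannSurface (R : realType) := RiemannSurface {
  surface :> topologicalType;
  surface_hausdorff : hausdorff_space surface;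
  surface_connected : connected [set: surface];
  atlas : set (chart R surface);
  atlas_is_chart : forall c, atlas c -> is_chart c;
  atlas_cover : forall p : surface, exists2 c, atlas c & cdom c p;
  atlas_holomorphic : forall c1 c2, atlas c1 -> atlas c2 ->
    forall p, cdom c1 p -> cdom c2 p ->
      holomorphic_at (cmap c2 \o cinv c1) (cmap c1 p) }.

Arguments atlas {R} r _.

Section Forms.
Variables (R : realType) (M : riemannSurface R).

(* A chart c of the atlas around p identifies T_pM with R * R, and the complex
   structure J of T_pM with [Jplane].  [w c p X] is the value of the 1-form w on
   the tangent vector at p whose coordinates in the chart c are X; it is
   meaningful for c in the atlas and p in [cdom c] only. *)
Definition form (V : Type) := chart R M -> M -> R * R -> V.

Definition form_eq (V : Type) (w1 w2 : form V) : Prop :=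
  forall c p, atlas M c -> cdom c p -> forall X, w1 c p X = w2 c p X.

Definition star (V : Type) (w : form V) : form V :=
  fun c p X => w c p (Jplane X).

Definition smooth_on (V : normedModType R) (U : set M) (f : M -> V) : Prop :=
  forall c, atlas M c -> Cinfty (cmap c @` (U `&` cdom c)) (f \o cinv c).

Definition d (V : normedModType R) (f : M -> V) : form V :=
  fun c p X => 'D_X (f \o cinv c) (cmap c p).

(* d w = 0.  In a chart, (d w)(X, Y) = X (w Y) - Y (w X) for constant X, Y. *)
Definition closed_form (V : normedModType R) (w : form V) : Prop :=
  forall c p, atlas M c -> cdom c p -> forall X Y,
    d (fun q => w c q Y) c p X - d (fun q => w c q X) c p Y = 0.

Section MatrixValued.
Variables m n : nat.

Definition smooth_mx_on (U : set M) (f : M -> 'M[quat R]_(m, n)) : Prop :=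
  forall i j, smooth_on U (fun p => f p i j).

Definition dmx (f : M -> 'M[quat R]_(m, n)) : form 'M[quat R]_(m, n) :=
  fun c p X => \matrix_(i, j) d (fun q => f q i j) c p X.

Definition closed_mx_form (w : form 'M[quat R]_(m, n)) : Prop :=
  forall i j, closed_form (fun c p X => w c p X i j).

End MatrixValued.

End Forms.

Section Curves.
Variables (R : realType) (M : riemannSurface R).

(* [L p] is the fibre at p, as a subset of H^2. *)
Implicit Types (L : M -> set (Hvec R)) (S : M -> 'M[quat R]_2).

Definition Hline (v : Hvec R) : set (Hvec R) := range (rscale v).

Definition line_subbundle L : Prop :=
  forall p, exists (U : set M) (psi : M -> Hvec R),
    [/\ open U, U p, smooth_mx_on U psi &
        forall q, U q -> psi q != 0 /\ L q = Hline (psi q)].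

Definition section L (U : set M) (psi : M -> Hvec R) : Prop :=
  smooth_mx_on U psi /\ forall q, U q -> L q (psi q).

(* Points of the quotient H/L at p are the cosets w + L_p. *)
Definition proj L (p : M) (w : Hvec R) : set (Hvec R) := [set w + l | l in L p].

Definition delta L (psi : M -> Hvec R) : form M (set (Hvec R)) :=
  fun c p X => proj L p (dmx psi c p X).

(* delta_p is injective as a map from T_pM to Hom(L_p, (H/L)_p). *)
Definition immersed L : Prop :=
  forall c p, atlas M c -> cdom c p -> forall X Y,
    (forall (U : set M) psi, open U -> U p -> section L U psi ->
       delta L psi c p X = delta L psi c p Y) ->
    X = Y.

Definition End_section L (J : M -> Hvec R -> Hvec R) : Prop :=
  [/\ forall p v, L p v -> L p (J p v),
      forall p v w, L p v -> L p w -> J p (v + w) = J p v + J p w,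
      forall p v l, L p v -> J p (rscale v l) = rscale (J p v) l &
      forall U psi, open U -> section L U psi ->
        smooth_mx_on U (fun p => J p (psi p))].

Definition holomorphic_curve L : Prop :=
  exists J : M -> Hvec R -> Hvec R,
    [/\ End_section L J,
        forall p v, L p v -> J p (J p v) = - v &
        forall U psi, open U -> section L U psi ->
        forall c p, atlas M c -> cdom c p -> U p -> forall X,
          star (delta L psi) c p X = delta L (fun q => J q (psi q)) c p X].

Definition quarter : quat R := qmk 4^-1 0 0 0.

Definition hopfQ S : form M 'M[quat R]_2 := fun c p X =>
  quarter *: (S p *m dmx S c p X - star (dmx S) c p X).

Definition hopfA S : form M 'M[quat R]_2 := fun c p X =>
  quarter *: (S p *m dmx S c p X + star (dmx S) c p X).

(* The endomorphism of (H/L)_p induced by S_p maps the class of w to that of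
   S_p w, i.e. a coset to its image under S_p (as S_p L_p = L_p). *)
Definition mean_curvature_sphere L S : Prop :=
  [/\ smooth_mx_on setT S,
      forall p, S p *m S p = - 1%:M,
      forall p, [set S p *m v | v in L p] = L p &
      forall c p, atlas M c -> cdom c p -> forall X,
        [/\ forall v, L p v -> L p (dmx S c p X *m v),
            forall v, L p v -> hopfQ S c p X *m v = 0 &
            forall U psi, open U -> U p -> section L U psi ->
              star (delta L psi) c p X
                = delta L (fun q => S q *m psi q) c p X /\
              star (delta L psi) c p X
                = [set S p *m w | w in delta L psi c p X]]].

(* L is a Willmore surface with mean curvature sphere S. *)
Definition willmore_with L S : Prop :=
  [/\ line_subbundle L, immersed L, holomorphic_curve L,
      mean_curvature_sphere L S & closed_mx_form (star (hopfA S))].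

Definition willmore L : Prop := exists S, willmore_with L S.

(* The map g : M -> H as a map into HP^1. *)
Definition graph_line (g : M -> quat R) : M -> set (Hvec R) :=
  fun p => Hline (\col_(i < 2) [:: g p; 1]`_i).

Definition immersion (g : M -> quat R) : Prop :=
  smooth_on setT g /\
  forall c p, atlas M c -> cdom c p -> injective (d g c p).

(* The 1-form <b, w a>. *)
Definition form_pairing (b : Hform R) (w : form M 'M[quat R]_2) (a : Hvec R) :
    form M (quat R) :=
  fun c p X => pairing b (w c p X *m a).

Definition forward_baecklund S (b : Hform R) (a : Hvec R) (g : M -> quat R) :=
  immersion g /\
  form_eq (d g) (fun c p X => 2 * form_pairing b (star (hopfA S)) a c p X).

Definition backward_baecklund S (b : Hform R) (a : Hvec R) (h : M -> quat R) :=
  immersion h /\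
  form_eq (d h) (fun c p X => 2 * form_pairing b (star (hopfQ S)) a c p X).

End Curves.

(* sigma identifies the space of lines {mu b} in (H^2)^*, with its quotient
   topology, with the unit sphere S^4 of R^5. *)
Definition lines_homeo_S4 (R : realType) (sigma : Hform R -> 'rV[R]_5) : Prop :=
  let nz := [set b : Hform R | b != 0] in
  let S4 := [set s : 'rV[R]_5 | \sum_i s 0 i ^+ 2 = 1] in
  [/\ sigma @` nz = S4,
      forall b b', nz b -> nz b' ->
        (sigma b = sigma b' <-> exists mu : quat R, b' = mu *: b),
      {within nz, continuous sigma} &
      forall O : set 'rV[R]_5, O `<=` S4 -> open (nz `&` sigma @^-1` O) ->
        exists2 O', open O' & O = S4 `&` O'].

(* Main.v *)
Require Import Defs.
From HB Require Import structures.
From mathcomp Require Import all_boot all_order all_algebra.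
From mathcomp Require Import all_classical all_reals all_analysis.
From mathcomp Require Import ring lra.
From Stdlib Require Ncring Ncring_tac.

Set Implicit Arguments.
Unset Strict Implicit.
Unset Printing Implicit Defensive.

Import Order.TTheory GRing.Theory Num.Theory.
Import numFieldNormedType.Exports.

Local Open Scope classical_set_scope.
Local Open Scope ring_scope.

(** Write star w for w o J.  A conformal immersion f into the quaternions has a
    left normal N and a right normal V, with N^2 = V^2 = -1 and
    star df = N df = - df V, and a mean curvature H, characterised by
      2 df H = dN - N star dN,   2 H df = dV - V star dV,   H N = V H
    ([conformal_data]).  Up to a factor 4, the lower left entries of star A and
    star Q for the graph of f are the form [hopfA21],
      w = dH + V star dH - H (star dN - star df H),
    and w - 2 dH.

    A graph is Willmore as soon as w is closed ([graph_willmore]).  The mean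
    curvature sphere is written down in terms of f, N, V and H
    ([graph_sphere]).  Since star A takes values in L, its entries are, up to
    the factor 4, w, a second form e ([hopfA22]), f w and f e.  The differential
    of e reduces to (w - 2 dH) wedge df, and the products df wedge w,
    df wedge e and (w - 2 dH) wedge df vanish by type, because J acts on
    the first factor from the right as on the second from the left
    ([wedge_eq0]).

    Conversely let L be a Willmore surface and take a as the point at infinity
    of an affine coordinate.  If b has no zero on the fibres of L, then L is the
    graph of a function f with conformal data such that 4 <b, star A a> = w and
    4 <b, star Q a> = w - 2 dH ([affine_hopf_forms]).  Such a zero is excluded
    by the assumption that one of the transforms is immersed: if b vanishes on
    L_p, then a spans L_p, so that Q a = 0 and dS a lies in L_p, and both forms
    <b, star A a> and <b, star Q a> vanish at p ([nonvanishing_on_fibres]).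

    The equation for the forward transform g now reads 2 dg = w.  The type of w
    gives star dg = - V dg, so - V is the left normal of g, and
    2 dg m = dV + V star dV determines a function m.  One finds that g has
    right normal N - m H and mean curvature - m ([forward_data]).  The
    differential of the equation dg m = dV - H df shows that
    star d(f - m) = - (N - m H) d(f - m) ([dual_anticonformal]), and with this
    the form w of g becomes 2 d(f - m) ([forward_hopfA21]).  It is exact, hence
    closed, and g is Willmore.

    For the backward transform replace f, N, V, H by - conj f, - conj V,
    - conj N, conj H ([mirror]).  Conjugation reverses products, so the two
    normals change places and w becomes - conj (w - 2 dH): a backward transform
    of f is the mirror image of a forward transform of the mirror image of f
    ([backward_exists]).

    Closedness of the two forms is immediate from d star A = 0, as
    star Q - star A = dS / 2.  The lines in the dual plane are identified with
    S^4 by the quaternionic Hopf map ([hopf_map_homeo]); changing b within its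
    line or a within the kernel of b multiplies the two forms by constants on
    one side, and a primitive on a connected surface is unique up to a constant
    ([immersed_primitive_transform]). *)

(** * Noncommutative ring identities and quaternions *)

Definition subr_op (A : pzRingType) (x y : A) : A := x - y.

Global Instance pzRing_ncring_ops (A : pzRingType) :
  @Ncring.Ring_ops A 0 1 (@GRing.add A) (@GRing.mul A) (@subr_op A)
    (@GRing.opp A) (@eq A) := {}.

(** Polynomial identities that hold in every ring, commutative or not, become
    provable by normalisation. *)
Global Instance pzRing_ncring (A : pzRingType) :
  Ncring.Ring (Ro := pzRing_ncring_ops A).
Proof.
split=> //.
- exact: RelationClasses.eq_equivalence.
- by move=> x y -> u v ->.
- by move=> x y -> u v ->.
- by move=> x y -> u v ->.
- by move=> x y ->.
- exact: add0r.
- exact: addrC.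
- exact: addrA.
- exact: mul1r.
- exact: mulr1.
- exact: mulrA.
- by move=> x y z; exact: mulrDl.
- by move=> x y z; exact: mulrDr.
- exact: subrr.
Qed.

Ltac ncring := Ncring_tac.non_commutative_ring.

Section Quaternions.
Variable R : realType.
Implicit Types (x y z : quat R) (k : R).

Lemma qmulE x y : x * y = qmul x y. Proof. by []. Qed.

Definition qconj x : quat R := qmk (x 0 0) (- x 0 1) (- x 0 2) (- x 0 3).

Definition qnorm2 x : R := x 0 0 ^+ 2 + x 0 1 ^+ 2 + x 0 2 ^+ 2 + x 0 3 ^+ 2.

Definition qinv x : quat R := (qnorm2 x)^-1 *: qconj x.

Lemma qaddE x y i : (x + y) 0 i = x 0 i + y 0 i. Proof. by rewrite mxE. Qed.
Lemma qoppE x i : (- x) 0 i = - x 0 i. Proof. by rewrite mxE. Qed.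
Lemma qzeroE i : (0 : quat R) 0 i = 0. Proof. by rewrite mxE. Qed.
Lemma qscaleE k x i : (k *: x) 0 i = k * x 0 i. Proof. by rewrite mxE. Qed.

Lemma qconjD x y : qconj (x + y) = qconj x + qconj y.
Proof. by apply: quatP; rewrite /qconj ?(qmkE, qaddE, qoppE); ring. Qed.

Lemma qconjN x : qconj (- x) = - qconj x.
Proof. by apply: quatP; rewrite /qconj ?(qmkE, qaddE, qoppE); ring. Qed.

Lemma qconjM x y : qconj (x * y) = qconj y * qconj x.
Proof. by apply: quatP; rewrite !qmulE /qconj /qmul !qmkE; ring. Qed.

Lemma qconjK x : qconj (qconj x) = x.
Proof. by apply: quatP; rewrite /qconj !qmkE ?opprK. Qed.

Lemma qconj_inj : injective qconj.
Proof. exact: can_inj qconjK. Qed.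

Lemma qone : 1 = qmk 1 0 0 0 :> quat R. Proof. by []. Qed.

Lemma qconj1 : qconj 1 = 1.
Proof. by apply: quatP; rewrite /qconj !qone !qmkE ?oppr0. Qed.

Lemma qscalel k x y : (k *: x) * y = k *: (x * y).
Proof. by apply: quatP; rewrite !qmulE /qmul !qscaleE !qmkE ?qscaleE; ring. Qed.

Lemma qscaler k x y : x * (k *: y) = k *: (x * y).
Proof. by apply: quatP; rewrite !qmulE /qmul !qscaleE !qmkE ?qscaleE; ring. Qed.

Lemma qmul_comb k l x (a b a' b' : quat R) :
  k *: a + l *: b + x * (k *: a' + l *: b')
  = k *: (a + x * a') + l *: (b + x * b').
Proof. by rewrite mulrDr (qscaler k) (qscaler l) addrACA -!scalerDr. Qed.

Lemma qmul_conj x : x * qconj x = qnorm2 x *: (1 : quat R).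
Proof.
by apply: quatP; rewrite qscaleE !qmulE /qconj /qmul /qnorm2 !qone !qmkE; ring.
Qed.

Lemma qconj_mul x : qconj x * x = qnorm2 x *: (1 : quat R).
Proof.
by apply: quatP; rewrite qscaleE !qmulE /qconj /qmul /qnorm2 !qone !qmkE; ring.
Qed.

Lemma qnorm2_ge0 x : 0 <= qnorm2 x.
Proof. by rewrite !addr_ge0 ?sqr_ge0. Qed.

Lemma qnorm2_eq0 x : (qnorm2 x == 0) = (x == 0).
Proof.
apply/idP/eqP => [|->]; last by rewrite /qnorm2 !mxE expr0n /= !addr0.
rewrite /qnorm2 !paddr_eq0 ?addr_ge0 ?sqr_ge0 // !sqrf_eq0.
by move=> /andP[/andP[/andP[/eqP h0 /eqP h1] /eqP h2] /eqP h3];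
   apply: quatP; rewrite ?h0 ?h1 ?h2 ?h3 mxE.
Qed.

Lemma qmulV x : x != 0 -> x * qinv x = 1.
Proof.
by move=> x0; rewrite /qinv qscaler qmul_conj scalerA mulVf ?scale1r// qnorm2_eq0.
Qed.

Lemma qVmul x : x != 0 -> qinv x * x = 1.
Proof.
by move=> x0; rewrite /qinv qscalel qconj_mul scalerA mulVf ?scale1r// qnorm2_eq0.
Qed.

Lemma qmulI x y z : x != 0 -> x * y = x * z -> y = z.
Proof.
move=> x0 /(congr1 (fun t => qinv x * t)).
by rewrite !mulrA qVmul// !mul1r.
Qed.

Lemma qImul x y z : x != 0 -> y * x = z * x -> y = z.
Proof.
move=> x0 /(congr1 (fun t => t * qinv x)).
by rewrite -!mulrA qmulV// !mulr1.
Qed.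

Lemma qdbl x : x + x = 2%:R *: x.
Proof. by rewrite -[2%:R]/(1 + 1) scalerDl scale1r. Qed.

Lemma qdblI x y : x + x = y + y -> x = y.
Proof. by rewrite !qdbl => /(scalerI _); apply; rewrite pnatr_eq0. Qed.

Lemma qtwoE x : 2 * x = x + x.
Proof. by rewrite mulr_natl mulr2n. Qed.

Lemma quarterE x : quarter R * x = 4^-1 *: x.
Proof.
have -> : quarter R = 4^-1 *: (1 : quat R).
  by apply: quatP; rewrite qscaleE qone !qmkE ?mulr1 ?mulr0.
by rewrite qscalel mul1r.
Qed.

End Quaternions.

(** * Derivatives of quaternion-valued functions *)

Section PlaneCalculus.
Variable R : realType.
Local Notation P := (R * R)%type.

(** The difference G - F vanishes near z, so its differential at z is zero. *)
Lemma near_eq_differentiable (V W : normedModType R) (F G : V -> W) (z : V) :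
  (\forall y \near z, F y = G y) -> differentiable F z -> differentiable G z.
Proof.
move=> FG dF.
pose E := G - F.
suff dE : differentiable E z.
  have -> : G = F + E by rewrite /E addrC subrK.
  exact: differentiableD.
have h : E \o shift z = cst (E z) + (0 : V -> W) +o_ 0 id.
  have Ez : E z = 0 by rewrite /E !fctE (nbhs_singleton FG) subrr.
  apply/eqaddoP => _/posnumP[e]; near=> x => /=.
  rewrite !fctE /= Ez !addr0 subr0 /E !fctE (_ : G (x + z) = F (x + z)).
    by rewrite subrr normr0 mulr_ge0.
  apply/esym; near: x.
  by move: FG; rewrite (near_shift 0) subr0.
have cst0 : continuous (0 : V -> W) by move=> ?; exact: cst_continuous.
have dE0 : 'd E z = 0 :> (V -> W) by exact: diff_unique.
by apply/diff_locallyP; rewrite dE0.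
Unshelve. all: by end_near. Qed.

Lemma differentiable_fst (U V : normedModType R) (z : U * V) :
  differentiable (fun y : U * V => y.1) z.
Proof. by apply: linear_differentiable => y; exact: cvg_fst. Qed.

Lemma differentiable_snd (U V : normedModType R) (z : U * V) :
  differentiable (fun y : U * V => y.2) z.
Proof. by apply: linear_differentiable => y; exact: cvg_snd. Qed.

Lemma differentiable_rowP (V : normedModType R) n (F : V -> 'rV[R]_n) (z : V) :
  (forall i, differentiable (fun y : V => F y 0 i) z) -> differentiable F z.
Proof.
move=> dF.
have -> : F = \sum_(i < n) (fun y : V => F y 0 i *: (delta_mx 0 i : 'rV[R]_n)).
  by apply/funext => y; rewrite fct_sumE; exact: row_sum_delta.
by apply: differentiable_sum => i; exact: differentiableZl.
Qed.

Section QuatValued.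
Variable V : normedModType R.
Implicit Types F G : V -> quat R.

Lemma differentiable_quatP F z :
  differentiable F z <-> forall i, differentiable (fun y => F y 0 i) z.
Proof.
split=> [dF i|dF].
  apply: (@differentiable_comp _ _ _ _ F (fun x : 'rV[R]_4 => x 0 i)) => //.
  exact: differentiable_coord.
exact: (differentiable_rowP dF).
Qed.

Lemma derive_quatE F z X i : differentiable F z ->
  ('D_X F z) 0 i = 'D_X (fun y => F y 0 i) z.
Proof.
move=> dF; rewrite (@derive_mx _ _ 1 4 F z X) ?mxE//.
by apply: diff_derivable; exact: dF.
Qed.

Lemma differentiable_qmul F G z : differentiable F z -> differentiable G z ->
  differentiable (fun y => F y * G y) z.
Proof.
move=> /differentiable_quatP dF /differentiable_quatP dG.
have dm i j : differentiable (fun y => F y 0 i * G y 0 j) z.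
  exact: differentiableM.
apply/differentiable_quatP => -[[|[|[|[|//]]]] hi].
- rewrite (_ : (fun y => _) = (fun y => F y 0 0 * G y 0 0)
    - (fun y => F y 0 1 * G y 0 1) - (fun y => F y 0 2 * G y 0 2)
    - (fun y => F y 0 3 * G y 0 3)); last by apply/funext => y; rewrite qmulE mxE.
  exact: differentiableB (differentiableB (differentiableB (dm 0 0) (dm 1 1))
    (dm 2 2)) (dm 3 3).
- rewrite (_ : (fun y => _) = (fun y => F y 0 0 * G y 0 1)
    + (fun y => F y 0 1 * G y 0 0) + (fun y => F y 0 2 * G y 0 3)
    - (fun y => F y 0 3 * G y 0 2)); last by apply/funext => y; rewrite qmulE mxE.
  exact: differentiableB (differentiableD (differentiableD (dm 0 1) (dm 1 0))
    (dm 2 3)) (dm 3 2).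
- rewrite (_ : (fun y => _) = (fun y => F y 0 0 * G y 0 2)
    - (fun y => F y 0 1 * G y 0 3) + (fun y => F y 0 2 * G y 0 0)
    + (fun y => F y 0 3 * G y 0 1)); last by apply/funext => y; rewrite qmulE mxE.
  exact: differentiableD (differentiableD (differentiableB (dm 0 2) (dm 1 3))
    (dm 2 0)) (dm 3 1).
- rewrite (_ : (fun y => _) = (fun y => F y 0 0 * G y 0 3)
    + (fun y => F y 0 1 * G y 0 2) - (fun y => F y 0 2 * G y 0 1)
    + (fun y => F y 0 3 * G y 0 0)); last by apply/funext => y; rewrite qmulE mxE.
  exact: differentiableD (differentiableB (differentiableD (dm 0 3) (dm 1 2))
    (dm 2 1)) (dm 3 0).
Qed.

Lemma derive_qmul F G z X : differentiable F z -> differentiable G z ->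
  'D_X (fun y => F y * G y) z = 'D_X F z * G z + F z * 'D_X G z.
Proof.
move=> dF dG; have /differentiable_quatP cF := dF.
have /differentiable_quatP cG := dG.
have dm i j : is_derive z X (fun y => F y 0 i * G y 0 j)
    (('D_X F z) 0 i * G z 0 j + F z 0 i * ('D_X G z) 0 j).
  rewrite !derive_quatE//.
  have dFi := derivableP (diff_derivable (v := X) (cF i)).
  have dGj := derivableP (diff_derivable (v := X) (cG j)).
  by apply: is_derive_eq (is_deriveM dFi dGj) _; rewrite addrC -!/(_ * _) mulrC.
have dFG := differentiable_qmul dF dG.
apply: quatP; rewrite derive_quatE// qaddE !qmulE !qmkE.
- rewrite (_ : (fun y => _) = (fun y => F y 0 0 * G y 0 0)
    - (fun y => F y 0 1 * G y 0 1) - (fun y => F y 0 2 * G y 0 2)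
    - (fun y => F y 0 3 * G y 0 3)); last by apply/funext => y; rewrite qmulE mxE.
  have /@derive_val -> := is_deriveB (is_deriveB (is_deriveB (dm 0 0) (dm 1 1))
    (dm 2 2)) (dm 3 3).
  by move: ('D_X F z) ('D_X G z) (F z) (G z) => a b u v; ring.
- rewrite (_ : (fun y => _) = (fun y => F y 0 0 * G y 0 1)
    + (fun y => F y 0 1 * G y 0 0) + (fun y => F y 0 2 * G y 0 3)
    - (fun y => F y 0 3 * G y 0 2)); last by apply/funext => y; rewrite qmulE mxE.
  have /@derive_val -> := is_deriveB (is_deriveD (is_deriveD (dm 0 1) (dm 1 0))
    (dm 2 3)) (dm 3 2).
  by move: ('D_X F z) ('D_X G z) (F z) (G z) => a b u v; ring.
- rewrite (_ : (fun y => _) = (fun y => F y 0 0 * G y 0 2)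
    - (fun y => F y 0 1 * G y 0 3) + (fun y => F y 0 2 * G y 0 0)
    + (fun y => F y 0 3 * G y 0 1)); last by apply/funext => y; rewrite qmulE mxE.
  have /@derive_val -> := is_deriveD (is_deriveD (is_deriveB (dm 0 2) (dm 1 3))
    (dm 2 0)) (dm 3 1).
  by move: ('D_X F z) ('D_X G z) (F z) (G z) => a b u v; ring.
- rewrite (_ : (fun y => _) = (fun y => F y 0 0 * G y 0 3)
    + (fun y => F y 0 1 * G y 0 2) - (fun y => F y 0 2 * G y 0 1)
    + (fun y => F y 0 3 * G y 0 0)); last by apply/funext => y; rewrite qmulE mxE.
  have /@derive_val -> := is_deriveD (is_deriveB (is_deriveD (dm 0 3) (dm 1 2))
    (dm 2 1)) (dm 3 0).
  by move: ('D_X F z) ('D_X G z) (F z) (G z) => a b u v; ring.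
Qed.

Lemma differentiable_qconj F z : differentiable F z ->
  differentiable (fun y => qconj (F y)) z.
Proof.
move=> /differentiable_quatP dF; apply/differentiable_quatP.
move=> -[[|[|[|[|//]]]] hi].
- rewrite (_ : (fun y => _) = (fun y => F y 0 0)) => //.
  by apply/funext => y; rewrite mxE.
- rewrite (_ : (fun y => _) = - (fun y => F y 0 1)); first exact: differentiableN.
  by apply/funext => y; rewrite mxE.
- rewrite (_ : (fun y => _) = - (fun y => F y 0 2)); first exact: differentiableN.
  by apply/funext => y; rewrite mxE.
- rewrite (_ : (fun y => _) = - (fun y => F y 0 3)); first exact: differentiableN.
  by apply/funext => y; rewrite mxE.
Qed.

Lemma derive_qconj F z X : differentiable F z ->
  'D_X (fun y => qconj (F y)) z = qconj ('D_X F z).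
Proof.
move=> dF; have /differentiable_quatP cF := dF.
have dFi i := derivableP (diff_derivable (v := X) (cF i)).
apply: quatP; rewrite derive_quatE ?qmkE ?derive_quatE//;
  try exact: differentiable_qconj.
- by congr ('D_X _ z); apply/funext => y; rewrite qmkE.
- rewrite (_ : (fun y => _) = - (fun y => F y 0 1)).
    by have /@derive_val := is_deriveN (dFi 1).
  by apply/funext => y; rewrite qmkE.
- rewrite (_ : (fun y => _) = - (fun y => F y 0 2)).
    by have /@derive_val := is_deriveN (dFi 2).
  by apply/funext => y; rewrite qmkE.
- rewrite (_ : (fun y => _) = - (fun y => F y 0 3)).
    by have /@derive_val := is_deriveN (dFi 3).
  by apply/funext => y; rewrite qmkE.
Qed.

Lemma differentiable_qnorm2 F z :
  differentiable F z -> differentiable (fun y : V => qnorm2 (F y)) z.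
Proof.
move=> /differentiable_quatP cF.
have c2 i : differentiable ((fun y : V => F y 0 i) ^+ 2) z by exact: differentiableX.
rewrite (_ : (fun y => _) = (fun y : V => F y 0 0) ^+ 2 + (fun y : V => F y 0 1) ^+ 2
  + (fun y : V => F y 0 2) ^+ 2 + (fun y : V => F y 0 3) ^+ 2); last first.
  by apply/funext => y; rewrite /qnorm2 !expr2.
exact: differentiableD (differentiableD (differentiableD (c2 0) (c2 1)) (c2 2))
  (c2 3).
Qed.

Lemma differentiable_qinv F z : F z != 0 -> differentiable F z ->
  differentiable (fun y => qinv (F y)) z.
Proof.
move=> Fz dF.
have dn : differentiable (fun y => (qnorm2 (F y))^-1) z.
  by apply: differentiableV; [exact: differentiable_qnorm2|rewrite qnorm2_eq0].
apply/differentiable_quatP => i.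
rewrite (_ : (fun y => _)
   = (fun y => (qnorm2 (F y))^-1) * (fun y => qconj (F y) 0 i)).
  apply: differentiableM => //.
  by move: (differentiable_qconj dF) => /differentiable_quatP.
by apply/funext => y; rewrite qscaleE.
Qed.

End QuatValued.
End PlaneCalculus.

(** * Classes of differentiability *)

Section SmoothClasses.
Variable R : realType.
Local Notation P := (R * R)%type.
Implicit Types (D : set P) (z X Y : P).

Section AnyTarget.
Variable W : normedModType R.
Implicit Types F G : P -> W.

Lemma open_eq_near D F G z : open D -> D z -> (forall y, D y -> F y = G y) ->
  \forall y \near z, F y = G y.
Proof.
move=> oD Dz FG; have : nbhs z D by exact: open_nbhs_nbhs.
by apply: filterS => y /FG.
Qed.

Lemma derive_eq_on D F G z X : open D -> D z -> (forall y, D y -> F y = G y) ->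
  'D_X F z = 'D_X G z.
Proof. by move=> oD Dz FG; apply/near_eq_derive/(open_eq_near oD). Qed.

Lemma Cn_eq n D F G : open D -> (forall y, D y -> F y = G y) ->
  Cn n D F -> Cn n D G.
Proof.
move=> oD; elim: n F G => [|n IH] F G FG /= => [cF z Dz|[dF cF]].
  have FGz := open_eq_near oD Dz FG.
  suff : G @ z --> G z by [].
  rewrite -(FG z Dz); apply: cvg_trans (cF z Dz).
  exact: near_eq_cvg.
split=> [z Dz|X].
  exact: near_eq_differentiable (open_eq_near oD Dz FG) (dF z Dz).
by apply: IH (cF X) => y Dy; exact: derive_eq_on oD Dy FG.
Qed.

Lemma Cn_subset n D D' F : D' `<=` D -> Cn n D F -> Cn n D' F.
Proof.
move=> sD; elim: n F => [|n IH] F /= => [cF z /sD|[dF cF]]; first exact: cF.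
by split=> [z /sD|X]; [exact: dF|exact: IH].
Qed.

Lemma Cn_local n D F :
  (forall z, D z -> exists2 D' : set P, D' z & Cn n D' F) -> Cn n D F.
Proof.
elim: n F => [|n IH] F /= loc.
  by move=> z /loc[D' D'z]; exact.
split=> [z /loc[D' D'z [dF _]]|X]; first exact: dF.
by apply: IH => z /loc[D' D'z [_ cF]]; exists D'.
Qed.

Lemma CnW n D F : Cn n.+1 D F -> Cn n D F.
Proof.
elim: n F => [|n IH] F.
  by move=> [dF _] z Dz; apply: differentiable_continuous; exact: dF.
by move=> [dF cF]; split=> // X; exact: IH (cF X).
Qed.

Lemma Cn_cst n D (w : W) : Cn n D (fun=> w).
Proof.
elim: n w => [|n IH] w /= => [z _|]; first exact: cst_continuous.
split=> [z _|X]; first exact: differentiable_cst.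
have -> : (fun z => 'D_X (fun=> w) z) = (fun=> 0).
  by apply/funext => z; rewrite derive_cst.
exact: IH.
Qed.

Lemma CnD n D F G : open D -> Cn n D F -> Cn n D G ->
  Cn n D (fun z => F z + G z).
Proof.
move=> oD; elim: n F G => [|n IH] F G /=.
  by move=> cF cG z Dz; apply: (@continuousD _ _ _ F G); [exact: cF|exact: cG].
move=> [dF cF] [dG cG]; split=> [z Dz|X].
  by apply: (@differentiableD _ _ _ F G); [exact: dF|exact: dG].
apply: Cn_eq (IH _ _ (cF X) (cG X)) => // z Dz.
rewrite -[in RHS]/(F + G) deriveD//; apply: diff_derivable;
  [exact: dF|exact: dG].
Qed.

Lemma CnN n D F : open D -> Cn n D F -> Cn n D (fun z => - F z).
Proof.
move=> oD; elim: n F => [|n IH] F /=.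
  by move=> cF z Dz; apply: (@continuousN _ _ _ F); exact: cF.
move=> [dF cF]; split=> [z Dz|X]; first by apply: (@differentiableN _ _ _ F); exact: dF.
apply: Cn_eq (IH _ (cF X)) => // z Dz.
by rewrite -[in RHS]/(- F) deriveN//; apply: diff_derivable; exact: dF.
Qed.

Lemma Cn_derive n D F X : Cn n.+1 D F -> Cn n D (fun z => 'D_X F z).
Proof. by move=> [_ cF]; exact: cF. Qed.

End AnyTarget.

Section QuatTarget.
Implicit Types F G : P -> quat R.

Lemma continuous_qmul : continuous (fun p : quat R * quat R => p.1 * p.2).
Proof.
move=> p; apply: differentiable_continuous; apply: differentiable_qmul.
  exact: differentiable_fst.
exact: differentiable_snd.
Qed.

Lemma CnM n D F G : open D -> Cn n D F -> Cn n D G ->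
  Cn n D (fun z => F z * G z).
Proof.
move=> oD; elim: n F G => [|n IH] F G.
  move=> cF cG z Dz.
  apply: (@continuous_comp _ _ _ (fun z => (F z, G z))
    (fun p : quat R * quat R => p.1 * p.2)); last exact: continuous_qmul.
  exact: cvg_pair (cF z Dz) (cG z Dz).
move=> CF CG; have [dF cF] := CF; have [dG cG] := CG.
split=> [z Dz|X].
  by apply: differentiable_qmul; [exact: dF|exact: dG].
have := CnD oD (IH _ _ (cF X) (CnW CG)) (IH _ _ (CnW CF) (cG X)).
apply: Cn_eq => // z Dz.
by rewrite derive_qmul//; [exact: dF|exact: dG].
Qed.

Lemma Cn_qconj n D F : open D -> Cn n D F -> Cn n D (fun z => qconj (F z)).
Proof.
move=> oD; elim: n F => [|n IH] F.
  move=> cF z Dz.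
  apply: (@continuous_comp _ _ _ F (@qconj R)); first exact: cF.
  apply: differentiable_continuous.
  by apply: (@differentiable_qconj R (quat R) id); exact: ex_diff.
move=> [dF cF]; split=> [z Dz|X]; first by apply: differentiable_qconj; exact: dF.
apply: Cn_eq (IH _ (cF X)) => // z Dz.
by rewrite derive_qconj//; exact: dF.
Qed.

(** Differentiate the identity F * qinv F = 1. *)
Lemma derive_qinv F z X : (\forall y \near z, F y != 0) -> differentiable F z ->
  'D_X (fun y => qinv (F y)) z = - (qinv (F z) * 'D_X F z * qinv (F z)).
Proof.
move=> nF dF; have Fz := nbhs_singleton nF.
have dI := differentiable_qinv Fz dF.
have : 'D_X (fun y => F y * qinv (F y)) z = 0.
  rewrite (near_eq_derive (g := fun=> (1 : quat R))) ?derive_cst//.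
  by apply: filterS nF => y /qmulV.
rewrite derive_qmul// => h; apply: (qmulI Fz).
by rewrite mulrN !mulrA qmulV// mul1r; apply/eqP; rewrite -addr_eq0 addrC h.
Qed.

Lemma Cn_qinv n D F : open D -> (forall z, D z -> F z != 0) -> Cn n D F ->
  Cn n D (fun z => qinv (F z)).
Proof.
move=> oD nF; elim: n => [|n IH].
  move=> cF z Dz.
  apply: (@continuous_comp _ _ _ F (@qinv R)); first exact: cF.
  apply: differentiable_continuous.
  by apply: (@differentiable_qinv R (quat R) id); [exact: nF|exact: ex_diff].
move=> CF; have [dF cF] := CF; have CI := IH (CnW CF).
split=> [z Dz|X]; first by apply: differentiable_qinv; [exact: nF|exact: dF].
apply: Cn_eq (CnN oD (CnM oD (CnM oD CI (cF X)) CI)) => // z Dz.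
rewrite derive_qinv//; last exact: dF.
have : nbhs z D by exact: open_nbhs_nbhs.
by apply: filterS => y; exact: nF.
Qed.

Lemma Cn_coord n D F i : open D -> Cn n D F ->
  Cn n D (fun z => F z 0 i : R^o).
Proof.
move=> oD; elim: n F => [|n IH] F.
  move=> cF z Dz.
  apply: (@continuous_comp _ _ _ F (fun x : 'rV[R]_4 => x 0 i)).
    exact: cF.
  exact: coord_continuous.
move=> [dF cF]; split=> [z Dz|X].
  by move: (dF z Dz) => /differentiable_quatP.
apply: Cn_eq (IH _ (cF X)) => // z Dz.
by rewrite derive_quatE//; exact: dF.
Qed.

End QuatTarget.

End SmoothClasses.

(** * Mean value theorem and symmetry of second derivatives *)

Section MeanValue.
Variable R : realType.
Local Notation P := (R * R)%type.
Implicit Types (D : set P) (z X Y : P).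

Lemma is_derive_line (W : normedModType R) (F : P -> W) y X (a : R) :
  derivable F (y + a *: X) X ->
  is_derive a 1 (fun t => F (y + t *: X)) ('D_X F (y + a *: X)).
Proof.
have E : (fun h : R => h^-1 *: (F (y + (h *: (1 : R^o) + a) *: X) - F (y + a *: X)))
    = (fun h : R => h^-1 *: (F (h *: X + (y + a *: X)) - F (y + a *: X))).
  apply/funext => h; congr (_ *: (F _ - _)).
  by rewrite scalerDl -[h *: (1 : R^o)]/(h * 1) mulr1 addrCA.
move=> dF; apply: DeriveDef.
  by rewrite /derivable /= E.
by rewrite /derive /= E.
Qed.

Lemma derive_translate (W : normedModType R) (F : P -> W) y c X :
  derivable F (y + c) X ->
  is_derive y X (fun t => F (t + c)) ('D_X F (y + c)).
Proof.
have E : (fun h : R => h^-1 *: (F (h *: X + y + c) - F (y + c)))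
    = (fun h : R => h^-1 *: (F (h *: X + (y + c)) - F (y + c))).
  by apply/funext => h; rewrite addrA.
move=> dF; apply: DeriveDef.
  by rewrite /derivable /= E.
by rewrite /derive /= E.
Qed.

Lemma directional_MVT (F : P -> R^o) y X (s : R) : 0 < s ->
  (forall a, 0 <= a <= s -> derivable F (y + a *: X) X) ->
  exists2 a, 0 <= a <= s & F (y + s *: X) - F y = s * 'D_X F (y + a *: X).
Proof.
move=> s0 dF.
have dg a : 0 <= a <= s -> is_derive a 1 (fun t => F (y + t *: X) : R^o)
    ('D_X F (y + a *: X)).
  by move=> /dF; exact: is_derive_line.
have [|//|a] := @MVT _ (fun t => F (y + t *: X))
    (fun a => 'D_X F (y + a *: X)) 0 s s0.
- move=> a; rewrite in_itv /= => /andP[a0 as_].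
  by apply: dg; rewrite !ltW.
- apply: derivable_within_continuous => a; rewrite in_itv /= => /dg da.
  exact: ex_derive.
rewrite in_itv /= => /andP[a0 as_]; rewrite scale0r addr0 subr0 => E.
by exists a; rewrite ?E ?(ltW a0) ?(ltW as_)// mulrC.
Qed.

(** The mean value theorem is used twice: in direction X for the increment of F
    along Y, then in direction Y for the X-derivative of F.  The left-hand side
    is symmetric in X and Y, and this is the source of the symmetry of second
    derivatives. *)
Lemma second_difference (F : P -> R^o) z X Y (s : R) : 0 < s ->
  (forall a b, 0 <= a <= s -> 0 <= b <= s ->
     derivable F (z + a *: X + b *: Y) X /\
     derivable (fun y => 'D_X F y : R^o) (z + a *: X + b *: Y) Y) ->
  exists a b, [/\ 0 <= a <= s, 0 <= b <= s &
    F (z + s *: X + s *: Y) - F (z + s *: X) - (F (z + s *: Y) - F z)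
    = s * (s * 'D_Y (fun y => 'D_X F y : R^o) (z + a *: X + b *: Y))].
Proof.
move=> s0 dF.
pose G y := F (y + s *: Y) - F y : R^o.
have s1 : 0 <= s <= s by rewrite lexx ltW.
have s2 : 0 <= (0 : R) <= s by rewrite lexx ltW.
have dG a : 0 <= a <= s -> is_derive (z + a *: X) X G
    ('D_X F (z + a *: X + s *: Y) - 'D_X F (z + a *: X)).
  move=> ha; apply: is_deriveB.
    exact: derive_translate (dF a s ha s1).1.
  by apply: derivableP; have [] := dF a 0 ha s2; rewrite scale0r addr0.
have [a ha] := directional_MVT (F := G) (y := z) (X := X) s0
  (fun a ha => @ex_derive _ _ _ _ _ _ _ (dG a ha)).
rewrite (@derive_val _ _ _ _ _ _ _ (dG a ha)) => E.
have [b hb Eb] := directional_MVT (F := fun y => 'D_X F y : R^o)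
  (y := z + a *: X) (X := Y) s0 (fun b hb => (dF a b ha hb).2).
exists a, b; split => //.
by rewrite -Eb -E /G addrAC.
Qed.

Lemma near_parallelogram z X Y (U : set P) : nbhs z U ->
  exists2 s : R, 0 < s & forall a b, 0 <= a <= s -> 0 <= b <= s ->
    U (z + a *: X + b *: Y).
Proof.
move=> Uz.
have h : (fun p : P => z + p.1 *: X + p.2 *: Y) @ (0 : P) -->
    z + 0 *: X + 0 *: Y.
  apply: cvgD; first apply: cvgD.
  - exact: cvg_cst.
  - by apply: cvgZr_tmp; exact: cvg_fst.
  - by apply: cvgZr_tmp; exact: cvg_snd.
rewrite !scale0r !addr0 in h.
have /nbhs_ballP[e /= e0 He] := h _ Uz.
exists (e / 2); first by rewrite divr_gt0.
move=> a b /andP[a0 ae] /andP[b0 be].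
have e2 : e / 2 < e by rewrite ltr_pdivrMr// ltr_pMr// ltr1n.
by apply: (He (a, b)); split; rewrite /= -ball_normE /= sub0r normrN ger0_norm//;
  [apply: le_lt_trans ae e2|apply: le_lt_trans be e2].
Qed.

(** In a small parallelogram both mixed derivatives take, at some point, the value
    of the same second difference divided by s^2; continuity at z does the
    rest. *)
Lemma schwarz_real D (F : P -> R^o) z X Y : open D -> D z -> Cn 2 D F ->
  'D_X (fun y => 'D_Y F y : R^o) z = 'D_Y (fun y => 'D_X F y : R^o) z.
Proof.
move=> oD Dz [dF cF].
have [dX cXY] := cF X; have [dY cYX] := cF Y.
pose p y := 'D_X (fun y => 'D_Y F y : R^o) y.
pose q y := 'D_Y (fun y => 'D_X F y : R^o) y.
have cp : {for z, continuous p} by exact: cYX X z Dz.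
have cq : {for z, continuous q} by exact: cXY Y z Dz.
have Eq (s : R) : 0 < s ->
    (forall a b, 0 <= a <= s -> 0 <= b <= s -> D (z + a *: X + b *: Y)) ->
    exists a b a' b', [/\ 0 <= a <= s, 0 <= b <= s, 0 <= a' <= s, 0 <= b' <= s &
      q (z + a *: X + b *: Y) = p (z + a' *: X + b' *: Y)].
  move=> s0 Hs.
  have [a [b [ha hb E1]]] := second_difference (F := F) (z := z) (X := X)
    (Y := Y) s0 (fun a b ha hb => conj
      (diff_derivable (v := X) (dF _ (Hs a b ha hb)))
      (diff_derivable (v := Y) (dX _ (Hs a b ha hb)))).
  have Hs' b' a' : 0 <= b' <= s -> 0 <= a' <= s -> D (z + b' *: Y + a' *: X).
    by move=> hb' ha'; rewrite addrAC; exact: Hs.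
  have [b' [a' [hb' ha' E2]]] := second_difference (F := F) (z := z) (X := Y)
    (Y := X) s0 (fun a b ha hb => conj
      (diff_derivable (v := Y) (dF _ (Hs' a b ha hb)))
      (diff_derivable (v := X) (dY _ (Hs' a b ha hb)))).
  exists a, b, a', b'; split; [exact: ha|exact: hb|exact: ha'|exact: hb'|].
  rewrite -/(q _) in E1; rewrite -/(p _) in E2.
  clearbody p q; clear -E1 E2 s0.
  have sn0 : s != 0 by rewrite gt_eqF.
  apply: (mulfI sn0); apply: (mulfI sn0); rewrite -E1 [z + a' *: X + _]addrAC -E2.
  rewrite [z + s *: Y + s *: X]addrAC.
  move: (F (z + s *: X + s *: Y)) (F (z + s *: X)) (F (z + s *: Y)) (F z).
  by move=> ? ? ? ?; ring.
suff : p z = q z by [].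
clearbody p q; clear -Dz oD cp cq Eq.
apply/eqP; rewrite -subr_eq0 -normr_le0; apply/ler_addgt0Pr => e e0.
rewrite add0r.
have e2 : 0 < e / 2 by rewrite divr_gt0.
have nD : nbhs z D by exact: open_nbhs_nbhs.
have near_lt (f : P -> R^o) : {for z, continuous f} ->
    \forall y \near z, `|f z - f y| < e / 2.
  by move/cvgrPdist_lt; exact.
have [s s0 Hs] := near_parallelogram X Y
  (filterI nD (filterI (near_lt p cp) (near_lt q cq))).
have [a [b [a' [b' [ha hb ha' hb' E]]]]] := Eq s s0
  (fun a b ha hb => (Hs a b ha hb).1).
have [_ [_ h1]] := Hs a b ha hb; have [_ [h2 _]] := Hs a' b' ha' hb'.
rewrite E in h1.
have -> : p z - q z = (p z - p (z + a' *: X + b' *: Y))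
  - (q z - p (z + a' *: X + b' *: Y)) by rewrite opprB addrA subrK.
by rewrite (le_trans (ler_normB _ _))// (splitr e) lerD// ltW.
Qed.

Lemma schwarz_quat D (F : P -> quat R) z X Y : open D -> D z -> Cn 2 D F ->
  'D_X (fun y => 'D_Y F y) z = 'D_Y (fun y => 'D_X F y) z.
Proof.
move=> oD Dz CF; have [dF cF] := CF.
have [dX _] := cF X; have [dY _] := cF Y.
apply/rowP => i.
pose Fi : P -> R^o := fun y => F y 0 i.
have E U V : (forall y, D y -> differentiable (fun y => 'D_V F y) y) ->
    ('D_U (fun y => 'D_V F y) z) 0 i = 'D_U (fun y => 'D_V Fi y : R^o) z.
  move=> dV; apply: etrans (derive_quatE _ _ (dV z Dz)) _.
  apply: (derive_eq_on _ oD Dz) => y Dy.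
  exact: derive_quatE (dF y Dy).
apply: etrans (E X Y dY) _; apply: etrans _ (esym (E Y X dX)).
exact: schwarz_real oD Dz (Cn_coord i oD CF).
Qed.

(** On a ball around z, the mean value theorem along the segment from z is applied
    to each of the four real coordinates. *)
Lemma locally_constant D (F : P -> quat R) z : open D -> D z ->
  (forall y, D y -> differentiable F y) ->
  (forall y X, D y -> 'D_X F y = 0) ->
  \forall y \near z, F y = F z.
Proof.
move=> oD Dz dF F0.
have : nbhs z D by exact: open_nbhs_nbhs.
move=> /nbhs_ballP[e /= e0 He].
apply/nbhs_ballP; exists e => //= y yz.
apply/rowP => i.
have Dseg a : 0 <= a <= 1 -> D (z + a *: (y - z)).
  move=> /andP[a0 a1]; apply: He; rewrite -ball_normE /= opprD addrA subrr sub0r.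
  rewrite normrN normrZ ger0_norm//; move: yz; rewrite -ball_normE /= distrC.
  by apply: le_lt_trans; rewrite ler_piMl.
have dFi a : 0 <= a <= 1 ->
    derivable (fun y => F y 0 i : R^o) (z + a *: (y - z)) (y - z).
  move=> /Dseg/dF /differentiable_quatP dFi.
  exact: diff_derivable.
have [a ha] := directional_MVT (F := fun y => F y 0 i : R^o) ltr01 dFi.
have Da := Dseg a ha.
rewrite scale1r subrKC -derive_quatE; last exact: dF.
by rewrite F0// mul1r mxE => /eqP; rewrite subr_eq0 => /eqP.
Qed.

End MeanValue.

(** * Differential calculus on a Riemann surface *)

Lemma open_quat_neq0 (R : realType) : open [set x : quat R | x != 0].
Proof.
have -> : [set x : quat R | x != 0] = ~` [set 0].
  by apply/seteqP; split=> x /=; [move/eqP|move=> xn0; apply/eqP].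
rewrite openC; apply: accessible_closed_set1.
exact/hausdorff_accessible/norm_hausdorff.
Qed.

Section SurfaceCalculus.
Variables (R : realType) (M : riemannSurface R).
Local Notation H := (quat R).
Implicit Types (c : chart R M) (p q : M) (U : set M) (F G : M -> H).
Implicit Types (X Y : R * R).

(** A condition on the germ of F at p: sections of L and their coefficients exist
    only locally. *)
Definition smooth_at c p F := exists U, [/\ open U, U p &
  Cinfty (cmap c @` (U `&` cdom c)) (F \o cinv c)].

Section OneChart.
Variable c : chart R M.
Hypothesis hc : atlas M c.

Lemma open_chart_image U : open U -> open (cmap c @` (U `&` cdom c)).
Proof.
have [_ oI _ cI cK] := atlas_is_chart hc.
move=> oU.
have -> : cmap c @` (U `&` cdom c)
    = (cmap c @` cdom c) `&` cinv c @^-1` U.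
  apply/seteqP; split=> [_ [q [Uq cq] <-]|_ [[q cq <-]] /=].
    by split; [exists q|rewrite /preimage /= cK].
  by rewrite cK// => Uq; exists q.
rewrite continuous_open_subspace// in cI.
by move/(continuous_inP _ oI) : cI; exact.
Qed.

Lemma open_chart_preimage (O : set (R * R)) :
  open O -> open (cdom c `&` cmap c @^-1` O).
Proof.
have [oD _ cM _ _] := atlas_is_chart hc.
rewrite continuous_open_subspace// in cM.
by move: O; apply/(continuous_inP _ oD).
Qed.

Lemma chart_imageP U z : (cmap c @` (U `&` cdom c)) z ->
  [/\ U (cinv c z), cdom c (cinv c z) & cmap c (cinv c z) = z].
Proof.
have [_ _ _ _ cK] := atlas_is_chart hc.
by move=> [q [Uq cq] <-]; rewrite cK.
Qed.

Variable p : M.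
Hypothesis cp : cdom c p.

Lemma mem_chart_image U : U p -> (cmap c @` (U `&` cdom c)) (cmap c p).
Proof. by move=> Up; exists p. Qed.

Lemma chart_invK : cinv c (cmap c p) = p.
Proof. by have [_ _ _ _ cK] := atlas_is_chart hc; rewrite cK. Qed.

Lemma smooth_atE F : smooth_at c p F ->
  exists2 D, open D /\ D (cmap c p) & Cinfty D (F \o cinv c).
Proof.
move=> [U [oU Up cF]]; exists (cmap c @` (U `&` cdom c)) => //.
by split; [exact: open_chart_image|exact: mem_chart_image].
Qed.

Lemma smooth_at_differentiable F : smooth_at c p F ->
  differentiable (F \o cinv c) (cmap c p).
Proof.
by move=> /smooth_atE[D [oD Dp] cF]; have [dF _] := cF 1%N; exact: dF.
Qed.

Lemma smooth_at_eq U F G : open U -> U p ->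
  (forall q, U q -> cdom c q -> F q = G q) -> smooth_at c p F -> smooth_at c p G.
Proof.
move=> oU Up FG [U' [oU' U'p cF]]; exists (U `&` U'); split=> //.
  exact: openI.
have sU : cmap c @` (U `&` U' `&` cdom c) `<=` cmap c @` (U' `&` cdom c).
  by move=> _ [q [[Uq U'q] cq] <-]; exists q.
move=> n; apply: (Cn_eq _ _ (Cn_subset sU (cF n))).
  by apply: open_chart_image; exact: openI.
by move=> z /chart_imageP[[Uz _] cz _]; exact: FG.
Qed.

Lemma d_eq U F G X : open U -> U p ->
  (forall q, U q -> cdom c q -> F q = G q) -> d F c p X = d G c p X.
Proof.
move=> oU Up FG; apply: (derive_eq_on _ (open_chart_image oU)).
  exact: mem_chart_image.
by move=> z /chart_imageP[Uz cz _]; exact: FG.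
Qed.

Lemma smooth_at_cst (k : H) : smooth_at c p (fun=> k).
Proof. by exists setT; split=> //; [exact: openT|move=> n; exact: Cn_cst]. Qed.

Lemma smooth_atD F G : smooth_at c p F -> smooth_at c p G ->
  smooth_at c p (fun q => F q + G q).
Proof.
move=> [U [oU Up cF]] [V [oV Vp cG]]; exists (U `&` V).
split=> //; first exact: openI.
have sU : cmap c @` (U `&` V `&` cdom c) `<=` cmap c @` (U `&` cdom c).
  by move=> _ [q [[Uq Vq] cq] <-]; exists q.
have sV : cmap c @` (U `&` V `&` cdom c) `<=` cmap c @` (V `&` cdom c).
  by move=> _ [q [[Uq Vq] cq] <-]; exists q.
move=> n; apply: CnD (Cn_subset sU (cF n)) (Cn_subset sV (cG n)).
by apply: open_chart_image; exact: openI.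
Qed.

Lemma smooth_atM F G : smooth_at c p F -> smooth_at c p G ->
  smooth_at c p (fun q => F q * G q).
Proof.
move=> [U [oU Up cF]] [V [oV Vp cG]]; exists (U `&` V).
split=> //; first exact: openI.
have sU : cmap c @` (U `&` V `&` cdom c) `<=` cmap c @` (U `&` cdom c).
  by move=> _ [q [[Uq Vq] cq] <-]; exists q.
have sV : cmap c @` (U `&` V `&` cdom c) `<=` cmap c @` (V `&` cdom c).
  by move=> _ [q [[Uq Vq] cq] <-]; exists q.
move=> n; apply: CnM (Cn_subset sU (cF n)) (Cn_subset sV (cG n)).
by apply: open_chart_image; exact: openI.
Qed.

Lemma smooth_atN F : smooth_at c p F -> smooth_at c p (fun q => - F q).
Proof.
move=> [U [oU Up cF]]; exists U; split=> // n.
by apply: CnN => //; exact: open_chart_image.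
Qed.

Lemma smooth_at_qconj F : smooth_at c p F -> smooth_at c p (fun q => qconj (F q)).
Proof.
move=> [U [oU Up cF]]; exists U; split=> // n.
by apply: Cn_qconj => //; exact: open_chart_image.
Qed.

(** The neighbourhood of p has to be cut down to the open set where F does not
    vanish. *)
Lemma smooth_at_qinv F : F p != 0 -> smooth_at c p F ->
  smooth_at c p (fun q => qinv (F q)).
Proof.
move=> Fp [U [oU Up cF]].
have oI := open_chart_image oU.
pose D := cmap c @` (U `&` cdom c) `&` (F \o cinv c) @^-1` [set x | x != 0].
have oD : open D.
  have [dF _] := cF 1%N.
  have /(continuous_inP _ oI) : {in cmap c @` (U `&` cdom c),
      continuous (F \o cinv c)}.
    by move=> z; rewrite inE => /dF /differentiable_continuous.
  by apply; exact: open_quat_neq0.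
exists (U `&` (cdom c `&` cmap c @^-1` D)); split.
- by apply: openI => //; exact: open_chart_preimage.
- by split=> //; split=> //; split; [exists p|rewrite /preimage /= chart_invK].
have sU : cmap c @` (U `&` (cdom c `&` cmap c @^-1` D) `&` cdom c) `<=` D.
  by move=> _ [q [[_ [_ Dq]] _] <-].
move=> n; apply: Cn_qinv => //.
- apply: open_chart_image; apply: openI => //; exact: open_chart_preimage.
- by move=> z /sU[_].
- by apply: Cn_subset (cF n) => z /sU[].
Qed.

Lemma smooth_at_d F Y : smooth_at c p F -> smooth_at c p (fun q => d F c q Y).
Proof.
move=> [U [oU Up cF]]; exists U; split=> // n.
apply: (Cn_eq (open_chart_image oU) _ (Cn_derive Y (cF n.+1))) => z.
by move=> /chart_imageP[_ _ zK]; rewrite /= /d zK.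
Qed.

Lemma dD F G X : smooth_at c p F -> smooth_at c p G ->
  d (fun q => F q + G q) c p X = d F c p X + d G c p X.
Proof.
move=> /smooth_at_differentiable dF /smooth_at_differentiable dG.
apply: (@deriveD _ _ _ (F \o cinv c) (G \o cinv c)); exact: diff_derivable.
Qed.

Lemma dN F X : smooth_at c p F -> d (fun q => - F q) c p X = - d F c p X.
Proof.
move=> /smooth_at_differentiable dF.
by apply: (@deriveN _ _ _ (F \o cinv c)); exact: diff_derivable.
Qed.

Lemma dM F G X : smooth_at c p F -> smooth_at c p G ->
  d (fun q => F q * G q) c p X = d F c p X * G p + F p * d G c p X.
Proof.
move=> /smooth_at_differentiable dF /smooth_at_differentiable dG.
by have := derive_qmul X dF dG; rewrite /= chart_invK.
Qed.

Lemma d_cst (k : H) X : d (fun=> k) c p X = 0.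
Proof. exact: derive_cst. Qed.

Lemma d_qconj F X : smooth_at c p F ->
  d (fun q => qconj (F q)) c p X = qconj (d F c p X).
Proof. by move=> /smooth_at_differentiable dF; exact: (derive_qconj X dF). Qed.

Lemma d_zero F : d F c p 0 = 0.
Proof. exact: derive0. Qed.

Lemma d_linear F k X Y : smooth_at c p F ->
  d F c p (k *: X + Y) = k *: d F c p X + d F c p Y.
Proof.
by move=> /smooth_at_differentiable dF; rewrite /d !deriveE// linearP.
Qed.

Lemma d_comb F k l X Y : smooth_at c p F ->
  d F c p (k *: X + l *: Y) = k *: d F c p X + l *: d F c p Y.
Proof.
by move=> /smooth_at_differentiable dF; rewrite /d !deriveE// linearD !linearZ.
Qed.

(** This is d (d F) = 0, evaluated on constant coordinate fields. *)
Lemma d_symmetric F X Y : smooth_at c p F ->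
  d (fun q => d F c q Y) c p X = d (fun q => d F c q X) c p Y.
Proof.
move=> [U [oU Up cF]]; have oI := open_chart_image oU.
have Ip := mem_chart_image Up.
have := schwarz_quat X Y oI Ip (cF 2%N).
have E (V W : R * R) : 'D_V (fun y => 'D_W (F \o cinv c) y) (cmap c p)
    = d (fun q => d F c q W) c p V.
  apply: (derive_eq_on V oI Ip) => z.
  by move=> /chart_imageP[_ _ zK]; rewrite /= /d zK.
by rewrite !E.
Qed.

End OneChart.

(** Transition maps are holomorphic, so T commutes with J.  Hence an equation
    between the values of dF and star dF holds in every chart around p if it
    holds in one of them. *)
Lemma d_change_chart c1 c2 p : atlas M c1 -> atlas M c2 ->
  cdom c1 p -> cdom c2 p ->
  exists T : R * R -> R * R, (forall X, T (Jplane X) = Jplane (T X)) /\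
    forall F X, smooth_at c2 p F -> d F c1 p X = d F c2 p (T X).
Proof.
move=> h1 h2 p1 p2; have [dT JT] := atlas_holomorphic h1 h2 p1 p2.
exists ('d (cmap c2 \o cinv c1) (cmap c1 p)); split=> // F X smF.
have dF := smooth_at_differentiable h2 p2 smF.
have oI := open_chart_image h1 (let: And5 h _ _ _ _ := atlas_is_chart h2 in h).
rewrite /d (derive_eq_on (G := (F \o cinv c2) \o (cmap c2 \o cinv c1)) X oI).
- have e : (cmap c2 \o cinv c1) (cmap c1 p) = cmap c2 p.
    by rewrite /= chart_invK.
  rewrite deriveE; last by apply: differentiable_comp => //; rewrite e.
  rewrite diff_comp ?e //=.
  by rewrite deriveE.
- exact: mem_chart_image.
- by move=> z /(chart_imageP h1)[z2 z1 zK] /=; rewrite chart_invK.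
Qed.

(** The set where F takes the value F p0 is open and so is its complement. *)
Lemma constant_of_d_eq0 F :
  (forall c p, atlas M c -> cdom c p -> smooth_at c p F) ->
  (forall c p X, atlas M c -> cdom c p -> d F c p X = 0) ->
  exists k, forall p, F p = k.
Proof.
move=> smF dF0.
have loc p : exists V, [/\ open V, V p & forall q, V q -> F q = F p].
  have [c hc cp] := atlas_cover p.
  have oI := open_chart_image hc openT.
  have Ip := mem_chart_image cp (I : [set: M] p).
  have dF z : (cmap c @` ([set: M] `&` cdom c)) z -> differentiable (F \o cinv c) z.
    move=> /(chart_imageP hc)[_ cz zK].
    by have := smooth_at_differentiable hc cz (smF _ _ hc cz); rewrite zK.
  have dF' z X : (cmap c @` ([set: M] `&` cdom c)) z -> 'D_X (F \o cinv c) z = 0.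
    move=> /(chart_imageP hc)[_ cz zK].
    by have := dF0 _ _ X hc cz; rewrite /d zK.
  have : nbhs (cmap c p)
      [set y | (F \o cinv c) y = (F \o cinv c) (cmap c p)].
    exact: locally_constant oI Ip dF dF'.
  rewrite nbhsE => -[W [oW Wp] WE].
  exists (cdom c `&` cmap c @^-1` W); split=> //.
    exact: open_chart_preimage.
  by move=> q [cq /WE] /=; rewrite !chart_invK.
have [[p0 _]|noM] := pselect ([set: M] !=set0); last first.
  by exists 0 => p; case: noM; exists p.
exists (F p0).
pose B := [set p | F p = F p0].
have oB : open B.
  rewrite openE => p Bp; have [V [oV Vp VE]] := loc p.
  by rewrite /interior nbhsE; exists V => // q /VE; rewrite /B /= => ->.
have oCB : open (~` B).
  rewrite openE => p Bp; have [V [oV Vp VE]] := loc p.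
  by rewrite /interior nbhsE; exists V => // q /VE; rewrite /B /setC /= => ->.
have BT : B = [set: M].
  apply: surface_connected.
  - by exists p0.
  - by exists B; rewrite ?setTI.
  - by exists B; rewrite ?setTI// -openC.
by move=> p; have : B p by rewrite BT.
Qed.

End SurfaceCalculus.

(** * Algebra of first and second order jets *)

(** In this section x, n, v, h stand for the values of df, dN, dV, dH on a tangent
    vector X, and the primed letters for their values on J X; the hypotheses are
    the equations of conformal data and their derivatives.  To prove an identity,
    the difference of its two sides is written as a combination of the
    expressions e1, ..., e9, which vanish by hypothesis. *)
Section JetAlgebra.
Variable A : pzRingType.
Variables N V H x x' n n' v v' h h' : A.
Hypotheses (NN : N * N = -1) (VV : V * V = -1) (HN : H * N = V * H).
Hypotheses (xl : x' = N * x) (xr : x' = - (x * V)).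
Hypotheses (dNN' : n' * N + N * n' = 0).
Hypotheses (dVV : v * V + V * v = 0) (dVV' : v' * V + V * v' = 0).
Hypotheses (dHN : h * N + H * n = v * H + V * h).
Hypotheses (dHN' : h' * N + H * n' = v' * H + V * h').
Hypotheses (xH : x * H + x * H = n - N * n').
Hypotheses (Hx : H * x + H * x = v - V * v').

(* The values of hopfA21 on X and on J X. *)
Let W := h + V * h' - H * (n' - x' * H).
Let W' := h' - V * h - H * (- n + x * H).

Let e1 : V * V + 1 = 0. Proof. by rewrite VV addNr. Qed.
Let e2 : H * N - V * H = 0. Proof. by rewrite HN subrr. Qed.
Let e3 : x' - N * x = 0. Proof. by rewrite xl subrr. Qed.
Let e4 : N * N + 1 = 0. Proof. by rewrite NN addNr. Qed.
Let e5 : n - N * n' - (x * H + x * H) = 0. Proof. by rewrite xH subrr. Qed.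
Let e6 : v - V * v' - (H * x + H * x) = 0. Proof. by rewrite Hx subrr. Qed.
Let e7 : h * N + H * n - (v * H + V * h) = 0. Proof. by rewrite dHN subrr. Qed.
Let e8 : h' * N + H * n' - (v' * H + V * h') = 0.
Proof. by rewrite dHN' subrr. Qed.
Let e9 : x' + x * V = 0. Proof. by rewrite xr addNr. Qed.
Let zeroE := (e1, e2, e3, e4, e5, e6, e7, e8, e9, dNN', dVV, dVV', mulr0, mul0r,
  addr0, add0r, oppr0, subr0).

Lemma jet_hopfA21_left : W' = - (V * W).
Proof.
apply: subr0_eq.
have -> : W' - (- (V * W)) = (V * V + 1) * h' + (H * N - V * H) * (n' - x' * H)
    + H * (n - N * n' - (x * H + x * H)) + H * N * (x' - N * x) * H
    + H * (N * N + 1) * x * H by rewrite /W /W'; ncring.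
by rewrite !zeroE.
Qed.

Lemma jet_hopfQ21_right : W' - (h' + h') = (W - (h + h)) * N.
Proof.
apply/esym/subr0_eq.
have -> : (W - (h + h)) * N - (W' - (h' + h')) =
    - (h * N + H * n - (v * H + V * h))
    + V * (h' * N + H * n' - (v' * H + V * h'))
    - H * (n' * N + N * n') + (V * V + 1) * h' + (H * N - V * H) * n'
    - (v - V * v' - (H * x + H * x)) * H + H * x' * (H * N - V * H)
    + H * (x' + x * V) * V * H - H * x * (V * V + 1) * H.
  by rewrite /W /W'; ncring.
by rewrite !zeroE.
Qed.

Lemma jet_hopfA21_right : W' = - (W * N) + (v + V * v') * H.
Proof.
apply: subr0_eq.
have -> : W' - (- (W * N) + (v + V * v') * H) =
    (h * N + H * n - (v * H + V * h))
    + V * (h' * N + H * n' - (v' * H + V * h'))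
    - H * (n' * N + N * n') + (V * V + 1) * h' + (H * N - V * H) * n'
    + H * x' * (H * N - V * H)
    + H * (x' + x * V) * V * H - H * x * (V * V + 1) * H.
  by rewrite /W /W'; ncring.
by rewrite !zeroE.
Qed.

Lemma jet_mu_left : v' - V * v = - (V * (v + V * v')).
Proof.
apply: subr0_eq.
have -> : v' - V * v - - (V * (v + V * v')) = (V * V + 1) * v' by ncring.
by rewrite !zeroE.
Qed.

Lemma jet_mu_right : v' - V * v = (v + V * v') * V.
Proof.
apply/esym/subr0_eq.
have -> : (v + V * v') * V - (v' - V * v) = (v * V + V * v)
  + V * (v' * V + V * v') - (V * V + 1) * v' by ncring.
by rewrite !zeroE.
Qed.

(** Here m1, m2 and y' are the values dm(X), dm(J X) and dg(J X) for the forward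
    transform g with mean curvature - m, and the left-hand side is the Hopf form
    of g on X. *)
Lemma jet_forward_hopfA21 (m m1 m2 y' : A) :
  y' * m = v' - H * x' ->
  x' - m2 = - ((N - m * H) * (x - m1)) ->
  (N - m * H) * (N - m * H) = -1 ->
  - m1 + (N - m * H) * - m2 - - m * (- v' - y' * - m) = (x - m1) + (x - m1).
Proof.
move=> ym key UU; apply: subr0_eq.
have k0 : x' - m2 + (N - m * H) * (x - m1) = 0 by rewrite key addNr.
have y0 : y' * m - (v' - H * x') = 0 by rewrite ym subrr.
have u0 : (N - m * H) * (N - m * H) + 1 = 0 by rewrite UU addNr.
have -> : - m1 + (N - m * H) * - m2 - - m * (- v' - y' * - m)
    - ((x - m1) + (x - m1)) =
  (N - m * H) * (x' - m2 + (N - m * H) * (x - m1))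
  - ((N - m * H) * (N - m * H) + 1) * (x - m1)
  + m * (y' * m - (v' - H * x')) - N * (x' - N * x) - (N * N + 1) * x by ncring.
by rewrite k0 y0 u0 !zeroE.
Qed.

End JetAlgebra.

(** The second derivatives of f enter through a = d_X (df X),
    b = d_X (df JX) = d_JX (df X) and e = d_JX (df JX); the two expressions for
    each of b and e come from star df = N df and from star df = - df V. *)
Lemma jet_conformal_symmetry (A : pzRingType) (N V x n n' v v' a b e : A) :
  N * N = -1 -> V * V = -1 -> N * x = - (x * V) -> v * V + V * v = 0 ->
  b = n * x + N * a -> e = n' * x + N * b ->
  b = - (a * V + x * v) -> e = - (b * V + x * v') ->
  (n - N * n') * x = x * (v - V * v').
Proof.
move=> NN VV xN dVV b1 e1 b2 e2; apply: subr0_eq.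
have NN0 : N * N + 1 = 0 by rewrite NN addNr.
have VV0 : V * V + 1 = 0 by rewrite VV addNr.
have xN0 : N * x + x * V = 0 by rewrite xN addNr.
have b10 : b - (n * x + N * a) = 0 by rewrite -b1 subrr.
have e10 : e - (n' * x + N * b) = 0 by rewrite -e1 subrr.
have b20 : b + (a * V + x * v) = 0 by rewrite {1}b2 addNr.
have e20 : e + (b * V + x * v') = 0 by rewrite {1}e2 addNr.
have key : N * ((n - N * n') * x - x * (v - V * v')) = 0.
  have -> : N * ((n - N * n') * x - x * (v - V * v')) =
    - (N * (b - (n * x + N * a))) - (N * N + 1) * n' * x
    - (e - (n' * x + N * b)) + (e + (b * V + x * v')) - (b + (a * V + x * v)) * V
    + a * (V * V + 1) - (N * N + 1) * a + x * (v * V + V * v)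
    - (N * x + x * V) * (v - V * v') - x * (V * V + 1) * v'.
    by ncring.
  by rewrite NN0 VV0 xN0 b10 e10 b20 e20 dVV !(mulr0, mul0r, addr0, oppr0, subr0).
have /(congr1 (fun t => N * t)) := key.
by rewrite mulrA NN mulr0 mulN1r => /eqP; rewrite oppr_eq0 => /eqP.
Qed.

(** * Conformal maps with their normals *)

(* Unification must not unfold directional derivatives. *)
#[local] Opaque d.

Section AffineTheory.
Variables (R : realType) (M : riemannSurface R).
Implicit Types (c : chart R M) (p q : M) (X Y : R * R).

Definition smooth_fun (F : M -> quat R) :=
  forall c p, atlas M c -> cdom c p -> smooth_at c p F.

Lemma smooth_onT F : smooth_on setT F <-> smooth_fun F.
Proof.
split=> [sF c p hc cp|sF c hc n].
  by exists setT; split=> //; [exact: openT|exact: sF].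
apply: Cn_local => z /(chart_imageP hc)[_ cz zK].
have [D [oD Dz] cF] := smooth_atE hc cz (sF _ _ hc cz).
by rewrite zK in Dz; exists D.
Qed.

Lemma JplaneK X : Jplane (Jplane X) = - X.
Proof. by case: X. Qed.

Lemma d_opp c p F X : atlas M c -> cdom c p -> smooth_at c p F ->
  d F c p (- X) = - d F c p X.
Proof.
move=> hc cp sF; have := d_linear hc cp (-1) X 0 sF.
by rewrite d_zero !addr0 !scaleN1r.
Qed.

Lemma dJJ c p F X : atlas M c -> cdom c p -> smooth_at c p F ->
  d F c p (Jplane (Jplane X)) = - d F c p X.
Proof. by move=> hc cp sF; rewrite JplaneK d_opp. Qed.

(** N and V are the left and the right normal of the conformal immersion f, and H
    is its quaternionic mean curvature.  Doubles are written as sums, the form in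
    which ring normalisation uses the equations. *)
Record conformal_data (f N V H : M -> quat R) : Prop := ConformalData {
  cd_f : smooth_fun f; cd_N : smooth_fun N; cd_V : smooth_fun V;
  cd_H : smooth_fun H;
  cd_NN : forall p, N p * N p = -1;
  cd_VV : forall p, V p * V p = -1;
  cd_HN : forall p, H p * N p = V p * H p;
  cd_inj : forall c p, atlas M c -> cdom c p -> injective (d f c p);
  cd_left : forall c p X, atlas M c -> cdom c p ->
    d f c p (Jplane X) = N p * d f c p X;
  cd_right : forall c p X, atlas M c -> cdom c p ->
    d f c p (Jplane X) = - (d f c p X * V p);
  cd_dfH : forall c p X, atlas M c -> cdom c p ->
    d f c p X * H p + d f c p X * H p = d N c p X - N p * d N c p (Jplane X);
  cd_Hdf : forall c p X, atlas M c -> cdom c p ->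
    H p * d f c p X + H p * d f c p X = d V c p X - V p * d V c p (Jplane X) }.

(** Four times the lower left entry of star A, where A is the Hopf field of the
    graph of f; subtracting 2 dH gives the entry of star Q. *)
Definition hopfA21 (f N V H : M -> quat R) : Defs.form M (quat R) := fun c p X =>
  d H c p X + V p * d H c p (Jplane X)
  - H p * (d N c p (Jplane X) - d f c p (Jplane X) * H p).

Lemma d_sq_eqN1 (N : M -> quat R) c p X : smooth_fun N ->
  (forall p, N p * N p = -1) -> atlas M c -> cdom c p ->
  d N c p X * N p + N p * d N c p X = 0.
Proof.
move=> sN NN hc cp; have sNp := sN _ _ hc cp; rewrite -(dM hc cp X sNp sNp).
have -> := d_eq hc cp (G := fun=> -1) X openT I (fun q _ _ => NN q).
exact: d_cst.
Qed.

Lemma injective_d_neq0 (f : M -> quat R) c p X : smooth_at c p f ->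
  atlas M c -> cdom c p -> injective (d f c p) -> X != 0 -> d f c p X != 0.
Proof.
move=> sf hc cp inj; apply: contra_neq => h.
apply: inj; rewrite h.
exact/esym/d_zero.
Qed.

Section Data.
Variables (f N V H : M -> quat R).
Hypothesis cd : conformal_data f N V H.
Variables (c : chart R M) (p : M).
Hypotheses (hc : atlas M c) (cp : cdom c p).

Let sf := cd_f cd hc cp.
Let sN := cd_N cd hc cp.
Let sV := cd_V cd hc cp.
Let sH := cd_H cd hc cp.

Lemma d_HN X :
  d H c p X * N p + H p * d N c p X = d V c p X * H p + V p * d H c p X.
Proof.
rewrite -(dM hc cp X sH sN) -(dM hc cp X sV sH).
by apply: (d_eq hc cp X openT I) => q _ _; exact: cd_HN cd q.
Qed.

Lemma hopfA21_J X : hopfA21 f N V H c p (Jplane X) =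
  d H c p (Jplane X) - V p * d H c p X - H p * (- d N c p X + d f c p X * H p).
Proof. by rewrite /hopfA21 !dJJ// mulrN mulNr opprK. Qed.

(** The reason is star A = S A: the values of A lie in L, where S acts as
    multiplication by - V. *)
Lemma hopfA21_left X :
  hopfA21 f N V H c p (Jplane X) = - (V p * hopfA21 f N V H c p X).
Proof.
rewrite hopfA21_J; apply: jet_hopfA21_left (cd_NN cd p) (cd_VV cd p) (cd_HN cd p) _ _.
  exact: (cd_left cd X hc cp).
exact: (cd_dfH cd X hc cp).
Qed.

(** The reason is star Q = Q S: as Q vanishes on L it is a form on H/L, where S
    acts as multiplication by N. *)
Lemma hopfQ21_right X :
  hopfA21 f N V H c p (Jplane X) - (d H c p (Jplane X) + d H c p (Jplane X))
  = (hopfA21 f N V H c p X - (d H c p X + d H c p X)) * N p.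
Proof.
rewrite hopfA21_J; apply: (jet_hopfQ21_right (v := d V c p X) (v' := d V c p (Jplane X)))
  (cd_VV cd p) (cd_HN cd p) _ _ _ _ _.
- exact: (cd_right cd X hc cp).
- exact: d_sq_eqN1 (cd_N cd) (cd_NN cd) hc cp.
- exact: d_HN.
- exact: d_HN.
- exact: (cd_Hdf cd X hc cp).
Qed.

Lemma hopfA21_right X : hopfA21 f N V H c p (Jplane X) =
  - (hopfA21 f N V H c p X * N p)
  + (d V c p X + V p * d V c p (Jplane X)) * H p.
Proof.
rewrite hopfA21_J; apply: (jet_hopfA21_right (v := d V c p X) (v' := d V c p (Jplane X)))
  (cd_VV cd p) (cd_HN cd p) _ _ _ _.
- exact: (cd_right cd X hc cp).
- exact: d_sq_eqN1 (cd_N cd) (cd_NN cd) hc cp.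
- exact: d_HN.
- exact: d_HN.
Qed.

End Data.

(** Differentiate star df = N df = - df V and use d (d f) = 0.  As df has no
    zeros, it follows that each of the two equations that express H by the
    normals implies the other. *)
Lemma conformal_symmetry (f N V : M -> quat R) :
  smooth_fun f -> smooth_fun N -> smooth_fun V ->
  (forall p, N p * N p = -1) -> (forall p, V p * V p = -1) ->
  (forall c p X, atlas M c -> cdom c p ->
    d f c p (Jplane X) = N p * d f c p X) ->
  (forall c p X, atlas M c -> cdom c p ->
    d f c p (Jplane X) = - (d f c p X * V p)) ->
  forall c p X, atlas M c -> cdom c p ->
    (d N c p X - N p * d N c p (Jplane X)) * d f c p X
    = d f c p X * (d V c p X - V p * d V c p (Jplane X)).
Proof.
move=> sf sN sV NN VV dl dr c p X hc cp.
have [sfp sNp sVp] := And3 (sf _ _ hc cp) (sN _ _ hc cp) (sV _ _ hc cp).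
have sd Y := smooth_at_d hc Y sfp.
have El Y : d (fun q => d f c q (Jplane X)) c p Y
    = d N c p Y * d f c p X + N p * d (fun q => d f c q X) c p Y.
  rewrite -(dM hc cp Y sNp (sd X)).
  by apply: (d_eq hc cp Y openT I) => q _ cq; exact: dl.
have Er Y : d (fun q => d f c q (Jplane X)) c p Y
    = - (d (fun q => d f c q X) c p Y * V p + d f c p X * d V c p Y).
  rewrite -(dM hc cp Y (sd X) sVp) -(dN hc cp Y (smooth_atM hc (sd X) sVp)).
  by apply: (d_eq hc cp Y openT I) => q _ cq; exact: dr.
have Es := d_symmetric hc cp (Jplane X) X sfp.
apply: (jet_conformal_symmetry (NN p) (VV p) _ (d_sq_eqN1 X sV VV hc cp)
  _ (El (Jplane X)) _ (Er (Jplane X))).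
- exact: etrans (esym (dl _ _ _ hc cp)) (dr _ _ _ hc cp).
- exact: etrans Es (El X).
- exact: etrans Es (Er X).
Qed.

End AffineTheory.

(** * The forward transform *)

Section Transforms.
Variables (R : realType) (M : riemannSurface R).
Implicit Types (c : chart R M) (p q : M) (X Y : R * R).

Lemma Jplane0 : Jplane (0 : R * R) = 0.
Proof. by rewrite /Jplane /= oppr0. Qed.

Lemma Jplane_comb k l X Y :
  Jplane (k *: X + l *: Y) = k *: Jplane X + l *: Jplane Y.
Proof.
case: X Y => [x1 x2] [y1 y2]; apply: (congr2 pair) => //.
change (- (k * x2 + l * y2) = k * - x2 + l * - y2).
by rewrite !mulrN opprD.
Qed.

Let e1 : R * R := (1, 0).

Lemma plane_basis X : X = X.1 *: e1 + X.2 *: Jplane e1.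
Proof.
case: X => [x1 x2]; apply: (congr2 pair).
  change (x1 = x1 * 1 + x2 * - 0).
  by rewrite oppr0 mulr0 addr0 mulr1.
change (x2 = x1 * 0 + x2 * 1).
by rewrite mulr0 add0r mulr1.
Qed.

Lemma e1_neq0 : e1 != 0.
Proof. by apply/eqP => -[/eqP]; rewrite oner_eq0. Qed.

Lemma closed_form_double_d (w : Defs.form M (quat R)) (F : M -> quat R) :
  smooth_fun F ->
  (forall c p X, atlas M c -> cdom c p -> w c p X = d F c p X + d F c p X) ->
  closed_form w.
Proof.
move=> sF wE c p hc cp X Y; have sFp := sF _ _ hc cp.
have dE Z T : d (fun q => w c q Z) c p T
    = d (fun q => d F c q Z) c p T + d (fun q => d F c q Z) c p T.
  rewrite -(dD hc cp T (smooth_at_d hc Z sFp) (smooth_at_d hc Z sFp)).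
  by apply: (d_eq hc cp T openT I) => q _ cq; exact: wE.
by apply/eqP; rewrite subr_eq0 (dE Y X) (dE X Y) (d_symmetric hc cp X Y sFp).
Qed.

Section Forward.
Variables (f N V H g : M -> quat R).
Hypothesis cd : conformal_data f N V H.
Hypothesis sg : smooth_fun g.
Hypothesis inj_g : forall c p, atlas M c -> cdom c p -> injective (d g c p).
Hypothesis dg_hopfA21 : forall c p X, atlas M c -> cdom c p ->
  d g c p X + d g c p X = hopfA21 f N V H c p X.

Let mu c p X := d V c p X + V p * d V c p (Jplane X).

Let dg_left c p X (hc : atlas M c) (cp : cdom c p) :
  d g c p (Jplane X) = - V p * d g c p X.
Proof.
apply: qdblI; rewrite dg_hopfA21// (hopfA21_left cd hc cp) -dg_hopfA21//.
by rewrite mulrDr mulNr opprD.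
Qed.

Let mu_left c p X (hc : atlas M c) (cp : cdom c p) :
  mu c p (Jplane X) = - (V p * mu c p X).
Proof.
rewrite /mu dJJ//; last exact: cd_V cd _ _ hc cp.
by rewrite mulrN; apply: jet_mu_left; exact: cd_VV cd p.
Qed.

(** The types dg(J X) = - V dg(X) and mu(J X) = - V mu(X) agree, so an m that
    satisfies the equation for one non-zero X satisfies it for all X.  By
    [d_change_chart] the same m serves for all charts around p. *)
Lemma exists_mean_curvature p : exists m : quat R, forall c X, atlas M c ->
  cdom c p -> d g c p X * m + d g c p X * m = mu c p X.
Proof.
have [c0 h0 p0] := atlas_cover p.
have y0 := injective_d_neq0 (sg h0 p0) h0 p0 (inj_g h0 p0) e1_neq0.
have sV := cd_V cd h0 p0.
exists (2^-1 *: (qinv (d g c0 p e1) * mu c0 p e1)).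
set m := _ *: _.
have Me1 : d g c0 p e1 * m + d g c0 p e1 * m = mu c0 p e1.
  by rewrite qdbl /m qscaler scalerA mulfV ?pnatr_eq0// scale1r mulrA qmulV// mul1r.
have ME X : d g c0 p X * m + d g c0 p X * m = mu c0 p X.
  have MJe1 : d g c0 p (Jplane e1) * m + d g c0 p (Jplane e1) * m
      = mu c0 p (Jplane e1).
    by rewrite mu_left// -Me1 dg_left// mulrDr opprD !mulNr !mulrA.
  have mu_comb k l Y Z :
      mu c0 p (k *: Y + l *: Z) = k *: mu c0 p Y + l *: mu c0 p Z.
    rewrite /mu Jplane_comb (d_comb h0 p0 k l Y Z sV).
    rewrite (d_comb h0 p0 k l (Jplane Y) (Jplane Z) sV).
    exact: qmul_comb.
  rewrite (plane_basis X) (mu_comb X.1 X.2 e1 (Jplane e1)) -Me1 -MJe1.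
  rewrite (d_comb h0 p0 X.1 X.2 e1 (Jplane e1) (sg h0 p0)).
  move: (d g c0 p e1) (d g c0 p (Jplane e1)) => y y'; clear.
  by rewrite mulrDl !qscalel !scalerDr addrACA.
move=> c X hc cp.
have [T [TJ dT]] := d_change_chart hc h0 cp p0.
by rewrite /mu !dT ?TJ; [exact: ME|exact: cd_V cd _ _ h0 p0..|exact: sg].
Qed.

Variable m : M -> quat R.
Hypothesis mP : forall p c X, atlas M c -> cdom c p ->
  d g c p X * m p + d g c p X * m p = mu c p X.

Lemma smooth_mean_curvature : smooth_fun m.
Proof.
move=> c p hc cp.
have y0 q : cdom c q -> d g c q e1 != 0.
  by move=> cq; apply: injective_d_neq0 (sg hc cq) hc cq (inj_g hc cq) e1_neq0.
have sV := cd_V cd hc cp; have sgp := sg hc cp.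
pose half : quat R := 2^-1 *: (1 : quat R).
pose F q := half * (qinv (d g c q e1) *
  (d V c q e1 + V q * d V c q (Jplane e1))).
have FE q : [set: M] q -> cdom c q -> F q = m q.
  move=> _ cq; rewrite /F -[_ + _]/(mu c q e1) -mP// qdbl qscaler.
  by rewrite mulrA qVmul ?y0// mul1r /half qscalel mul1r scalerA mulVf
    ?pnatr_eq0// scale1r.
apply: (smooth_at_eq hc openT I FE).
apply: smooth_atM => //; first exact: smooth_at_cst.
apply: smooth_atM => //.
  by apply: smooth_at_qinv => //; [exact: y0|exact: smooth_at_d].
apply: smooth_atD => //; first exact: smooth_at_d.
by apply: smooth_atM => //; exact: smooth_at_d.
Qed.

Section AtPoint.
Variables (c : chart R M) (p : M).
Hypotheses (hc : atlas M c) (cp : cdom c p).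

Let sf := cd_f cd hc cp.
Let sN := cd_N cd hc cp.
Let sV := cd_V cd hc cp.
Let sH := cd_H cd hc cp.
Let sgp := sg hc cp.
Let sm := smooth_mean_curvature hc cp.

Lemma dg_right X :
  d g c p (Jplane X) = - (d g c p X * (N p - m p * H p)).
Proof.
apply: qdblI; rewrite dg_hopfA21// (hopfA21_right cd hc cp) -dg_hopfA21//.
rewrite -/(mu c p X) -mP//.
by move: (d g c p X) => y; ncring.
Qed.

(** The equation 2 H df = dV - V star dV turns the defining equation of m into one
    without star, which can be differentiated. *)
Lemma dg_mean_curvature X :
  d g c p X * m p = d V c p X - H p * d f c p X.
Proof.
apply: qdblI; rewrite mP// /mu.
have := cd_Hdf cd X hc cp.
move: (d V c p X) (d V c p (Jplane X)) (H p * d f c p X) => v v' a E.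
have -> : v - a + (v - a) = v + v - (a + a) by ncring.
by rewrite E; ncring.
Qed.

(** Apply [dg_right] twice: J^2 = -1 and dg has no zeros. *)
Lemma right_normal_sq : (N p - m p * H p) * (N p - m p * H p) = -1.
Proof.
have y0 := injective_d_neq0 sgp hc cp (inj_g hc cp) e1_neq0.
apply: (qmulI y0); rewrite mulrN1 mulrA.
have := dg_right (Jplane e1); rewrite dJJ// dg_right => ->.
by rewrite mulNr opprK.
Qed.

(** The form mu satisfies mu(J X) = mu(X) V; compare with [dg_right]. *)
Lemma right_normal_mean_curvature : m p * V p = - ((N p - m p * H p) * m p).
Proof.
have y0 := injective_d_neq0 sgp hc cp (inj_g hc cp) e1_neq0.
apply: (qmulI y0); apply: qdblI.
have muR : mu c p (Jplane e1) = mu c p e1 * V p.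
  rewrite /mu dJJ// mulrN; apply: jet_mu_right (cd_VV cd p) _ _;
    exact: d_sq_eqN1 (cd_V cd) (cd_VV cd) hc cp.
rewrite !mulrA -mulrDl mP// -muR -mP// dg_right.
by move: (d g c p e1) => y; ncring.
Qed.

End AtPoint.

(** The differential of dg m = dV - H df is dg wedge dm = dH wedge df.  By
    [hopfQ21_right] and star df = N df the product of 2 (dg - dH) with df
    vanishes, so that dg wedge d(f - m) = 0, that is, dg times star d(f - m) is
    star dg times d(f - m); insert [dg_right] and cancel dg. *)
Lemma dual_anticonformal c p X : atlas M c -> cdom c p ->
  d f c p (Jplane X) - d m c p (Jplane X)
  = - ((N p - m p * H p) * (d f c p X - d m c p X)).
Proof.
move=> hc cp.
have sf := cd_f cd hc cp; have sV := cd_V cd hc cp; have sH := cd_H cd hc cp.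
have sgp := sg hc cp; have sm := smooth_mean_curvature hc cp.
have d0 (F : M -> quat R) : d F c p 0 = 0 by exact: d_zero.
have [->|X0] := eqVneq X 0.
  by rewrite Jplane0 !d0 subrr mulr0 oppr0.
have y0 := injective_d_neq0 sgp hc cp (inj_g hc cp) X0.
have dE Y Z : d (fun q => d g c q Y) c p Z * m p + d g c p Y * d m c p Z
    = d (fun q => d V c q Y) c p Z
      - (d H c p Z * d f c p Y + H p * d (fun q => d f c q Y) c p Z).
  have sdg := smooth_at_d hc Y sgp; have sdV := smooth_at_d hc Y sV.
  have sdf := smooth_at_d hc Y sf; have sHf := smooth_atM hc sH sdf.
  rewrite -(dM hc cp Z sdg sm) -(dM hc cp Z sH sdf) -(dN hc cp Z sHf).
  rewrite -(dD hc cp Z sdV (smooth_atN hc sHf)).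
  by apply: (d_eq hc cp Z openT I) => q _ cq; exact: dg_mean_curvature.
have E1 := dE X (Jplane X); have E2 := dE (Jplane X) X.
rewrite (d_symmetric hc cp (Jplane X) X sgp) (d_symmetric hc cp (Jplane X) X sV)
  (d_symmetric hc cp (Jplane X) X sf) in E1.
have Z1 := hopfQ21_right cd hc cp X; rewrite -!dg_hopfA21// in Z1.
have fl := cd_left cd X hc cp.
have yl := dg_right hc cp X.
apply: (qmulI y0); apply: qdblI.
move: E1 E2 Z1 fl yl.
move: (d (fun q => d g c q (Jplane X)) c p X) (d (fun q => d f c q (Jplane X)) c p X)
  (d (fun q => d V c q (Jplane X)) c p X) (d m c p X) (d m c p (Jplane X))
  (d H c p X) (d H c p (Jplane X)) (d f c p X) (d f c p (Jplane X))
  (d g c p X) (d g c p (Jplane X)) (m p) (N p) (H p).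
move=> a s r m1 m2 h h' x x' y y' mp Np Hp E1 E2 Z1 fl yl.
apply: subr0_eq.
have E1' : a * mp + y * m2 - (r - (h' * x + Hp * s)) = 0 by rewrite E1 subrr.
have E2' : a * mp + y' * m1 - (r - (h * x' + Hp * s)) = 0 by rewrite E2 subrr.
have Z1' : y' + y' - (h' + h') - (y + y - (h + h)) * Np = 0 by rewrite Z1 subrr.
have fl' : x' - Np * x = 0 by rewrite fl subrr.
have yl' : y' + y * (Np - mp * Hp) = 0 by rewrite yl addNr.
have -> : y * (x' - m2) + y * (x' - m2)
   - (y * (- ((Np - mp * Hp) * (x - m1))) + y * (- ((Np - mp * Hp) * (x - m1)))) =
  - (a * mp + y * m2 - (r - (h' * x + Hp * s)))
  - (a * mp + y * m2 - (r - (h' * x + Hp * s)))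
  + (a * mp + y' * m1 - (r - (h * x' + Hp * s)))
  + (a * mp + y' * m1 - (r - (h * x' + Hp * s)))
  - (y' + y' - (h' + h') - (y + y - (h + h)) * Np) * x
  + (y + y - (h + h)) * (x' - Np * x)
  + (y' + y * (Np - mp * Hp)) * (x - m1) + (y' + y * (Np - mp * Hp)) * (x - m1).
  by ncring.
by rewrite E1' E2' Z1' fl' yl' !(mul0r, mulr0, oppr0, addr0).
Qed.

(** The equation that gives the mean curvature in terms of the left normal is the
    definition of m; the one for the right normal follows from
    [conformal_symmetry]. *)
Theorem forward_data :
  conformal_data g (fun q => - V q) (fun q => N q - m q * H q) (fun q => - m q).
Proof.
have sm := smooth_mean_curvature.
have sNg : smooth_fun (fun q => - V q).
  by move=> c p hc cp; apply: smooth_atN => //; exact: cd_V cd _ _ hc cp.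
have sVg : smooth_fun (fun q => N q - m q * H q).
  move=> c p hc cp; apply: smooth_atD => //; first exact: cd_N cd _ _ hc cp.
  apply: smooth_atN => //; apply: smooth_atM => //; first exact: sm.
  exact: cd_H cd _ _ hc cp.
have NNg p : - V p * - V p = -1 by rewrite mulrNN (cd_VV cd).
have VVg p : (N p - m p * H p) * (N p - m p * H p) = -1.
  by have [c hc cp] := atlas_cover p; exact: right_normal_sq hc cp.
have dfHg c p X : atlas M c -> cdom c p ->
    d g c p X * - m p + d g c p X * - m p
    = d (fun q => - V q) c p X - - V p * d (fun q => - V q) c p (Jplane X).
  move=> hc cp; have sV := cd_V cd hc cp.
  rewrite !(dN hc cp _ sV) mulrNN !mulrN -opprD mP//.
  by rewrite /mu opprD.
have HNg p : - m p * - V p = (N p - m p * H p) * - m p.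
  have [c hc cp] := atlas_cover p.
  by rewrite mulrNN mulrN (right_normal_mean_curvature hc cp).
split; [exact: sg|exact: sNg|exact: sVg| |exact: NNg|exact: VVg|exact: HNg
  |exact: inj_g| | |exact: dfHg|].
- by move=> c p hc cp; apply: smooth_atN => //; exact: sm.
- move=> c p X hc cp; exact: (dg_left X hc cp).
- by move=> c p X hc cp; exact: (dg_right hc cp X).
- move=> c p X hc cp.
  have d0 (F : M -> quat R) : d F c p 0 = 0 by exact: d_zero.
  have [->|X0] := eqVneq X 0; first by rewrite Jplane0 !d0 !mulr0 subrr addr0.
  have y0 := injective_d_neq0 (sg hc cp) hc cp (inj_g hc cp) X0.
  apply: (qmulI y0).
  rewrite -(conformal_symmetry sg sNg sVg NNg VVg _ _ X hc cp).
  + by rewrite -dfHg// mulrDl mulrDr !mulrA.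
  + by move=> c' p' Y hc' cp'; exact: (dg_left Y hc' cp').
  + by move=> c' p' Y hc' cp'; exact: (dg_right hc' cp' Y).
Qed.

(** The Hopf form of a forward transform is exact, so that the construction may be
    iterated: f - m solves the equation for a forward transform of g. *)
Theorem forward_hopfA21 c q Z : atlas M c -> cdom c q ->
  hopfA21 g (fun q => - V q) (fun q => N q - m q * H q) (fun q => - m q) c q Z
  = d (fun q => f q - m q) c q Z + d (fun q => f q - m q) c q Z.
Proof.
move=> hc cq.
have sfq := cd_f cd hc cq; have smq := smooth_mean_curvature hc cq.
have sVq := cd_V cd hc cq.
have -> : d (fun q => f q - m q) c q Z = d f c q Z - d m c q Z.
  by rewrite (dD hc cq _ sfq (smooth_atN hc smq)) (dN hc cq _ smq).
rewrite /hopfA21 !(dN hc cq _ smq) !(dN hc cq _ sVq).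
apply: (jet_forward_hopfA21 (N := N q) (H := H q) (x := d f c q Z)
  (x' := d f c q (Jplane Z)) (v' := d V c q (Jplane Z))).
- exact: cd_NN cd q.
- exact (cd_left cd Z hc cq).
- exact: dg_mean_curvature.
- exact: dual_anticonformal.
- exact: right_normal_sq hc cq.
Qed.

End Forward.

End Transforms.

(** * The mirror involution and the backward transform *)

Section Mirror.
Variables (R : realType) (M : riemannSurface R).
Implicit Types (c : chart R M) (p q : M) (X Y : R * R).

Definition doubly_exact (w : Defs.form M (quat R)) := exists2 F : M -> quat R,
  smooth_fun F &
  forall c p X, atlas M c -> cdom c p -> w c p X = d F c p X + d F c p X.

Lemma doubly_exact_closed w : doubly_exact w -> closed_form w.
Proof. by case=> F sF wE; exact: closed_form_double_d wE. Qed.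

Theorem forward_exists (f N V H g : M -> quat R) :
  conformal_data f N V H -> smooth_fun g ->
  (forall c p, atlas M c -> cdom c p -> injective (d g c p)) ->
  (forall c p X, atlas M c -> cdom c p ->
     d g c p X + d g c p X = hopfA21 f N V H c p X) ->
  exists N' V' H', conformal_data g N' V' H' /\ doubly_exact (hopfA21 g N' V' H').
Proof.
move=> cd sg inj_g dg_hopfA21.
have [m mP] := choice (exists_mean_curvature cd sg inj_g dg_hopfA21).
exists (fun q => - V q), (fun q => N q - m q * H q), (fun q => - m q); split.
  exact (forward_data cd sg inj_g dg_hopfA21 mP).
exists (fun q => f q - m q).
  move=> c p hc cp; apply: smooth_atD => //; first exact: cd_f cd _ _ hc cp.
  apply: smooth_atN => //.
  exact (smooth_mean_curvature cd sg inj_g mP hc cp).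
move=> c p X hc cp; exact (forward_hopfA21 cd sg inj_g dg_hopfA21 mP X hc cp).
Qed.

(** Conjugation reverses products and thereby exchanges left and right normals,
    and A with Q.  With the minus sign one formula serves for f and for both
    normals. *)
Definition mirror (F : M -> quat R) : M -> quat R := fun q => - qconj (F q).

Lemma smooth_mirror F : smooth_fun F -> smooth_fun (mirror F).
Proof.
move=> sF c p hc cp; apply: smooth_atN => //; apply: smooth_at_qconj => //.
exact: sF.
Qed.

Lemma d_mirror F c p X : atlas M c -> cdom c p -> smooth_at c p F ->
  d (mirror F) c p X = - qconj (d F c p X).
Proof.
move=> hc cp sF; rewrite /mirror (dN hc cp _ (smooth_at_qconj hc sF)).
by rewrite (d_qconj hc cp _ sF).
Qed.

Lemma mirror_sqN1 (x : quat R) : x * x = -1 -> - qconj x * - qconj x = -1.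
Proof. by move=> xx; rewrite mulrNN -qconjM xx qconjN qconj1. Qed.

Section MirrorData.
Variables (f N V H : M -> quat R).
Hypothesis cd : conformal_data f N V H.
Let H' := fun q => qconj (H q).

Lemma mirror_data : conformal_data (mirror f) (mirror V) (mirror N) H'.
Proof.
have sH' : smooth_fun H'.
  by move=> c p hc cp; apply: smooth_at_qconj => //; exact: cd_H cd _ _ hc cp.
split; [exact: smooth_mirror (cd_f cd)|exact: smooth_mirror (cd_V cd)
  |exact: smooth_mirror (cd_N cd)|exact: sH'| | | | | | | |].
- by move=> p; apply: mirror_sqN1; exact: cd_VV cd p.
- by move=> p; apply: mirror_sqN1; exact: cd_NN cd p.
- by move=> p; rewrite /mirror /H' mulrN mulNr -!qconjM (cd_HN cd).
- move=> c p hc cp X Y; have sf := cd_f cd hc cp.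
  rewrite !(d_mirror _ hc cp sf) => /oppr_inj/qconj_inj.
  exact (cd_inj cd hc cp (x1 := X) (x2 := Y)).
- move=> c p X hc cp; have sf := cd_f cd hc cp.
  rewrite !(d_mirror _ hc cp sf) /mirror mulrNN -qconjM (cd_right cd X hc cp).
  by rewrite qconjN opprK.
- move=> c p X hc cp; have sf := cd_f cd hc cp.
  by rewrite !(d_mirror _ hc cp sf) /mirror mulrNN -qconjM (cd_left cd X hc cp).
- move=> c p X hc cp; have sf := cd_f cd hc cp; have sV := cd_V cd hc cp.
  rewrite !(d_mirror _ hc cp sf) !(d_mirror _ hc cp sV) /mirror /H'.
  rewrite mulNr -qconjM -opprD -qconjD (cd_Hdf cd X hc cp) mulrNN -qconjM.
  have := d_sq_eqN1 (Jplane X) (cd_V cd) (cd_VV cd) hc cp.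
  move=> /eqP; rewrite addr_eq0 => /eqP ->.
  by rewrite qconjD qconjN opprD !opprK.
- move=> c p X hc cp; have sf := cd_f cd hc cp; have sN := cd_N cd hc cp.
  rewrite !(d_mirror _ hc cp sf) !(d_mirror _ hc cp sN) /mirror /H'.
  rewrite mulrN -qconjM -opprD -qconjD (cd_dfH cd X hc cp) mulrNN -qconjM.
  have := d_sq_eqN1 (Jplane X) (cd_N cd) (cd_NN cd) hc cp.
  move=> /eqP; rewrite addr_eq0 => /eqP ->.
  by rewrite qconjD qconjN opprD !opprK.
Qed.

Lemma hopfA21_mirror c p X : atlas M c -> cdom c p ->
  hopfA21 (mirror f) (mirror V) (mirror N) H' c p X
  = - qconj (hopfA21 f N V H c p X - (d H c p X + d H c p X)).
Proof.
move=> hc cp; have sf := cd_f cd hc cp; have sV := cd_V cd hc cp.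
have sH := cd_H cd hc cp.
rewrite /hopfA21 (d_mirror _ hc cp sf) (d_mirror _ hc cp sV) /H' /mirror.
rewrite !(d_qconj hc cp _ sH).
have := d_HN cd hc cp (Jplane X).
move: (d H c p X) (d H c p (Jplane X)) (d N c p (Jplane X)) (d V c p (Jplane X))
  (d f c p (Jplane X)) (H p) (N p) (V p) => h h' n' v' x' Hp Np Vp E.
rewrite !mulNr -!qconjM -!qconjN -!qconjD -!qconjM -!qconjN -!qconjD.
congr qconj; apply: subr0_eq.
have E0 : h' * Np + Hp * n' - (v' * Hp + Vp * h') = 0 by rewrite E subrr.
rewrite -[RHS]oppr0 -E0; ncring.
Qed.

End MirrorData.

Theorem backward_exists (f N V H h : M -> quat R) :
  conformal_data f N V H -> smooth_fun h ->
  (forall c p, atlas M c -> cdom c p -> injective (d h c p)) ->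
  (forall c p X, atlas M c -> cdom c p ->
     d h c p X + d h c p X = hopfA21 f N V H c p X - (d H c p X + d H c p X)) ->
  exists N' V' H', conformal_data h N' V' H' /\ doubly_exact (hopfA21 h N' V' H').
Proof.
move=> cd sh inj_h dh.
have smh := smooth_mirror sh.
have inj_mh c p : atlas M c -> cdom c p -> injective (d (mirror h) c p).
  move=> hc cp X Y; have shp := sh _ _ hc cp.
  rewrite !(d_mirror _ hc cp shp) => /oppr_inj/qconj_inj.
  exact (inj_h c p hc cp X Y).
have mW c p X : atlas M c -> cdom c p ->
    d (mirror h) c p X + d (mirror h) c p X
    = hopfA21 (mirror f) (mirror V) (mirror N) (fun q => qconj (H q)) c p X.
  move=> hc cp; have shp := sh _ _ hc cp.
  by rewrite (hopfA21_mirror cd X hc cp) -dh// (d_mirror _ hc cp shp) qconjD opprD.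
have [N1 [V1 [H1 [cd1 [F sF W1]]]]] := forward_exists (mirror_data cd) smh inj_mh mW.
have hE : mirror (mirror h) = h.
  by apply/funext => q; rewrite /mirror qconjN qconjK opprK.
exists (mirror V1), (mirror N1), (fun q => qconj (H1 q)); split.
  by rewrite -[X in conformal_data X]hE; exact: mirror_data cd1.
have sG : smooth_fun (fun q => F q - H1 q).
  move=> c p hc cp; apply: smooth_atD => //; first exact: sF.
  by apply: smooth_atN => //; exact: cd_H cd1 _ _ hc cp.
exists (mirror (fun q => F q - H1 q)); first exact: smooth_mirror.
move=> c p X hc cp; have sFp := sF _ _ hc cp; have sH1 := cd_H cd1 hc cp.
rewrite -[X in hopfA21 X]hE (hopfA21_mirror cd1 X hc cp) W1//.
rewrite (d_mirror _ hc cp (sG _ _ hc cp)).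
rewrite (dD hc cp X sFp (smooth_atN hc sH1)) (dN hc cp X sH1).
by rewrite -opprD -qconjD addrACA -opprD.
Qed.

End Mirror.

(** * Closed quaternionic forms *)

Section TwoByTwo.
Variable R : realType.

Lemma ord2P (P : 'I_2 -> Prop) : P 0 -> P 1 -> forall i, P i.
Proof.
move=> P0 P1 [[|[|//]] hi]; [move: P0|move: P1]; congr P; exact: val_inj.
Qed.

Lemma cV2P (v w : Hvec R) : v 0 0 = w 0 0 -> v 1 0 = w 1 0 -> v = w.
Proof. by move=> h0 h1; apply/colP; apply: ord2P. Qed.

Lemma mulmx2E n (A : 'M[quat R]_(n, 2)) m (B : 'M[quat R]_(2, m)) i j :
  (A *m B) i j = A i 0 * B 0 j + A i 1 * B 1 j.
Proof. by rewrite mxE !big_ord_recl big_ord0 addr0; congr (_ * _ + A i _ * B _ j);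
  exact: val_inj. Qed.

Definition col2 (x y : quat R) : Hvec R := \col_(i < 2) [:: x; y]`_i.

Lemma col2_0 x y : col2 x y 0 0 = x. Proof. by rewrite mxE. Qed.
Lemma col2_1 x y : col2 x y 1 0 = y. Proof. by rewrite mxE. Qed.

Lemma rscaleE (v : Hvec R) l i : rscale v l i 0 = v i 0 * l.
Proof. by rewrite mxE. Qed.

Lemma graph_lineP (M : Type) (f : M -> quat R) p (v : Hvec R) :
  Hline (\col_(i < 2) [:: f p; 1]`_i) v <-> v 0 0 = f p * v 1 0.
Proof.
split=> [[l _ <-]|E]; first by rewrite !rscaleE !mxE /= mul1r.
exists (v 1 0) => //; apply: cV2P; rewrite !rscaleE !mxE /=; last by rewrite mul1r.
by rewrite -E.
Qed.

End TwoByTwo.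

(** The differential of [hopfA22] on two vectors: x, y are the values of df, hx, hy
    of dH, wx, wy of [hopfA21]; v1, v2 and f1, f2 are second derivatives of V and
    f, and w1 - w2 is the differential of [hopfA21]. *)
Lemma jet_closed_hopfA22 (A : pzRingType)
    (w1 w2 wx wy f1 f2 v1 v2 hx hy x y H f : A) :
  (wx - (hx + hx)) * y = (wy - (hy + hy)) * x ->
  w1 - w2 = 0 -> f1 = f2 -> v1 = v2 ->
  v1 - (hx * y + H * f1) + (v1 - (hx * y + H * f1)) - (w1 * f + wy * x)
  - (v2 - (hy * x + H * f2) + (v2 - (hy * x + H * f2)) - (w2 * f + wx * y)) = 0.
Proof.
move=> Zw cl -> ->.
have Zw0 : (wx - (hx + hx)) * y - (wy - (hy + hy)) * x = 0 by rewrite Zw subrr.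
have -> : v2 - (hx * y + H * f2) + (v2 - (hx * y + H * f2)) - (w1 * f + wy * x)
  - (v2 - (hy * x + H * f2) + (v2 - (hy * x + H * f2)) - (w2 * f + wx * y))
  = ((wx - (hx + hx)) * y - (wy - (hy + hy)) * x) - (w1 - w2) * f by ncring.
by rewrite Zw0 cl mul0r subr0.
Qed.

Section ClosedForms.
Variables (R : realType) (M : riemannSurface R).
Implicit Types (c : chart R M) (p q : M) (X Y : R * R).

Definition linform (phi : R * R -> quat R) := forall k l X Y,
  phi (k *: X + l *: Y) = k *: phi X + l *: phi Y.

Lemma linform_d F c p : atlas M c -> cdom c p -> smooth_at c p F ->
  linform (d F c p).
Proof. by move=> hc cp sF k l X Y; exact: d_comb. Qed.

Lemma linform_J phi : linform phi -> linform (fun X => phi (Jplane X)).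
Proof. by move=> lphi k l X Y; rewrite Jplane_comb lphi. Qed.

Lemma linformD phi psi : linform phi -> linform psi ->
  linform (fun X => phi X + psi X).
Proof.
move=> lphi lpsi k l X Y; rewrite lphi lpsi.
by rewrite (scalerDr k) (scalerDr l) addrACA.
Qed.

Lemma linformN phi : linform phi -> linform (fun X => - phi X).
Proof.
by move=> lphi k l X Y; rewrite lphi (scalerN k) (scalerN l) -opprD.
Qed.

Lemma linformMl a phi : linform phi -> linform (fun X => a * phi X).
Proof.
by move=> lphi k l X Y; rewrite lphi mulrDr (qscaler k) (qscaler l).
Qed.

Lemma linformMr a phi : linform phi -> linform (fun X => phi X * a).
Proof.
by move=> lphi k l X Y; rewrite lphi mulrDl (qscalel k) (qscalel l).
Qed.

(** The tangent plane is spanned by X and J X for a single X, so that a 2-form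
    vanishes if it vanishes on these pairs. *)
Lemma wedge_eq0 phi psi : linform phi -> linform psi ->
  (forall X, phi X * psi (Jplane X) = phi (Jplane X) * psi X) ->
  forall X Y, phi X * psi Y = phi Y * psi X.
Proof.
move=> lphi lpsi E X Y.
rewrite (plane_basis X) (plane_basis Y) !lphi !lpsi.
move: (E (1, 0)); clear.
move: (phi (1, 0)) (phi (Jplane (1, 0))) (psi (1, 0)) (psi (Jplane (1, 0))).
move: X.1 X.2 Y.1 Y.2 => k l k' l' a a' b b' E.
rewrite !mulrDl !mulrDr !qscalel !qscaler E.
move: (a * b) (a' * b) (a' * b') => u v w.
by apply/rowP => i; rewrite !(qaddE, qscaleE); ring.
Qed.

Definition smooth_form (w : Defs.form M (quat R)) := forall c p Y,
  atlas M c -> cdom c p -> smooth_at c p (fun q => w c q Y).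

Definition linear_form (w : Defs.form M (quat R)) := forall c p,
  atlas M c -> cdom c p -> linform (w c p).

Lemma smooth_form_eq (w w' : Defs.form M (quat R)) : form_eq w w' ->
  smooth_form w -> smooth_form w'.
Proof.
move=> E sw c p Y hc cp; apply: (smooth_at_eq hc openT I _ (sw c p Y hc cp)).
by move=> q _ cq; exact: E.
Qed.

Lemma closed_form_eq (w w' : Defs.form M (quat R)) : form_eq w w' ->
  closed_form w -> closed_form w'.
Proof.
move=> E clw c p hc cp X Y; rewrite -[RHS](clw c p hc cp X Y).
congr (_ - _); apply: (d_eq hc cp _ openT I) => q _ cq; exact/esym/E.
Qed.

Lemma closed_formD (w w' : Defs.form M (quat R)) : smooth_form w ->
  smooth_form w' -> closed_form w -> closed_form w' ->
  closed_form (fun c p X => w c p X + w' c p X).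
Proof.
move=> sw sw' clw clw' c p hc cp X Y.
rewrite (dD hc cp X (sw c p Y hc cp) (sw' c p Y hc cp)).
rewrite (dD hc cp Y (sw c p X hc cp) (sw' c p X hc cp)) opprD addrACA.
by rewrite (clw c p hc cp X Y) (clw' c p hc cp X Y) addr0.
Qed.

(** d (F w) = dF wedge w + F dw. *)
Lemma closed_formMl (F : M -> quat R) (w : Defs.form M (quat R)) :
  smooth_fun F -> smooth_form w -> closed_form w ->
  (forall c p X Y, atlas M c -> cdom c p ->
     d F c p X * w c p Y = d F c p Y * w c p X) ->
  closed_form (fun c p X => F p * w c p X).
Proof.
move=> sF sw clw E c p hc cp X Y; have sFp := sF _ _ hc cp.
rewrite (dM hc cp X sFp (sw c p Y hc cp)) (dM hc cp Y sFp (sw c p X hc cp)).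
rewrite E// opprD addrACA subrr add0r -mulrBr.
by rewrite (clw c p hc cp X Y) mulr0.
Qed.

Lemma closed_form_cstl k (w : Defs.form M (quat R)) : smooth_form w ->
  closed_form w -> closed_form (fun c p X => k * w c p X).
Proof.
move=> sw clw; apply: (closed_formMl (F := fun=> k)) => //.
  by move=> c p hc cp; exact: smooth_at_cst.
by move=> c p X Y hc cp; rewrite !d_cst !mul0r.
Qed.

Lemma closed_form_cstr k (w : Defs.form M (quat R)) : smooth_form w ->
  closed_form w -> closed_form (fun c p X => w c p X * k).
Proof.
move=> sw clw c p hc cp X Y; have sk := smooth_at_cst c p k.
rewrite (dM hc cp X (sw c p Y hc cp) sk) (dM hc cp Y (sw c p X hc cp) sk).
rewrite (d_cst c p k X) (d_cst c p k Y); move: (clw c p hc cp X Y).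
move: (d _ c p X) (d _ c p Y) => a b E.
by rewrite 2!mulr0 2!addr0 -mulrBl E mul0r.
Qed.

Lemma closed_form_d (F : M -> quat R) : smooth_fun F -> closed_form (d F).
Proof.
move=> sF c p hc cp X Y; rewrite (d_symmetric hc cp X Y (sF _ _ hc cp)).
exact: subrr.
Qed.

Lemma smooth_form_d (F : M -> quat R) : smooth_fun F -> smooth_form (d F).
Proof. by move=> sF c p Y hc cp; apply: smooth_at_d => //; exact: sF. Qed.

Section HopfRow.
Variables (f N V H : M -> quat R).
Hypothesis cd : conformal_data f N V H.

Lemma smooth_hopfA21 : smooth_form (hopfA21 f N V H).
Proof.
move=> c p Y hc cp; have sH := cd_H cd hc cp; have sV := cd_V cd hc cp.
have sN := cd_N cd hc cp; have sf := cd_f cd hc cp.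
apply: smooth_atD => //.
  apply: smooth_atD => //; first exact: smooth_at_d.
  by apply: smooth_atM => //; exact: smooth_at_d.
apply: smooth_atN => //; apply: smooth_atM => //.
apply: smooth_atD => //; first exact: smooth_at_d.
apply: smooth_atN => //; apply: smooth_atM => //; exact: smooth_at_d.
Qed.

Lemma linear_hopfA21 : linear_form (hopfA21 f N V H).
Proof.
move=> c p hc cp; have lH := linform_d hc cp (cd_H cd hc cp).
have lN := linform_d hc cp (cd_N cd hc cp).
have lf := linform_d hc cp (cd_f cd hc cp).
apply: linformD; first by apply: linformD => //; apply/linformMl/linform_J.
apply/linformN/linformMl; apply: linformD; first exact: linform_J.
by apply/linformN/linformMr/linform_J.
Qed.

#[local] Opaque hopfA21.

Let r c p X := d V c p X - H p * d f c p X.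

Lemma mu_double c p X : atlas M c -> cdom c p ->
  r c p X + r c p X = d V c p X + V p * d V c p (Jplane X).
Proof.
move=> hc cp; rewrite /r; have := cd_Hdf cd X hc cp.
move: (d V c p X) (d V c p (Jplane X)) (H p * d f c p X) => v v' a E.
have -> : v - a + (v - a) = v + v - (a + a) by ncring.
by rewrite E; ncring.
Qed.

(** Four times the lower right entry of star A for the graph of f. *)
Definition hopfA22 : Defs.form M (quat R) := fun c p X =>
  r c p X + r c p X - hopfA21 f N V H c p X * f p.

Lemma hopfA22_mu c p X : atlas M c -> cdom c p -> hopfA22 c p X =
  d V c p X + V p * d V c p (Jplane X) - hopfA21 f N V H c p X * f p.
Proof. by move=> hc cp; congr (_ - _); exact: mu_double. Qed.

Lemma smooth_hopfA22 : smooth_form hopfA22.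
Proof.
move=> c p Y hc cp; have sH := cd_H cd hc cp; have sV := cd_V cd hc cp.
have sf := cd_f cd hc cp; have sW := smooth_hopfA21 Y hc cp.
have sr : smooth_at c p (fun q => r c q Y).
  apply: smooth_atD => //; first exact: smooth_at_d.
  apply: smooth_atN => //; apply: smooth_atM => //; exact: smooth_at_d.
apply: smooth_atD => //; first exact: smooth_atD.
by apply: smooth_atN => //; exact: smooth_atM.
Qed.

Lemma linear_hopfA22 : linear_form hopfA22.
Proof.
move=> c p hc cp; have lV := linform_d hc cp (cd_V cd hc cp).
have lf := linform_d hc cp (cd_f cd hc cp).
have lr : linform (r c p) by apply: linformD => //; apply/linformN/linformMl.
apply: linformD; first exact: linformD.
by apply/linformN/linformMr; exact (linear_hopfA21 hc cp).
Qed.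

Lemma hopfA22_left c p X : atlas M c -> cdom c p ->
  hopfA22 c p (Jplane X) = - (V p * hopfA22 c p X).
Proof.
move=> hc cp; have sV := cd_V cd hc cp.
rewrite (hopfA22_mu (Jplane X) hc cp) (hopfA22_mu X hc cp) (hopfA21_left cd hc cp X).
rewrite (dJJ X hc cp sV).
have := jet_mu_left (d V c p X) (d V c p (Jplane X)) (cd_VV cd p).
move: (d V c p X) (d V c p (Jplane X)) (hopfA21 f N V H c p X) => v v' w E.
by rewrite mulrN E; ncring.
Qed.

Lemma df_wedge_hopfA21 c p X Y : atlas M c -> cdom c p ->
  d f c p X * hopfA21 f N V H c p Y = d f c p Y * hopfA21 f N V H c p X.
Proof.
move=> hc cp; move: X Y.
apply: (@wedge_eq0 (d f c p) (hopfA21 f N V H c p)).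
- exact: linform_d (cd_f cd hc cp).
- exact (linear_hopfA21 hc cp).
- move=> X; rewrite (hopfA21_left cd hc cp X) (cd_right cd X hc cp).
  by rewrite mulrN mulNr mulrA.
Qed.

Lemma df_wedge_hopfA22 c p X Y : atlas M c -> cdom c p ->
  d f c p X * hopfA22 c p Y = d f c p Y * hopfA22 c p X.
Proof.
move=> hc cp; move: X Y.
apply: (@wedge_eq0 (d f c p) (hopfA22 c p)).
- exact: linform_d (cd_f cd hc cp).
- exact (linear_hopfA22 hc cp).
- move=> X; rewrite (hopfA22_left X hc cp) (cd_right cd X hc cp).
  by rewrite mulrN mulNr mulrA.
Qed.

Lemma hopfQ21_wedge_df c p X Y : atlas M c -> cdom c p ->
  (hopfA21 f N V H c p X - (d H c p X + d H c p X)) * d f c p Y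
  = (hopfA21 f N V H c p Y - (d H c p Y + d H c p Y)) * d f c p X.
Proof.
move=> hc cp; move: X Y.
apply: (@wedge_eq0
  (fun X => hopfA21 f N V H c p X - (d H c p X + d H c p X)) (d f c p)).
- apply: linformD; first exact (linear_hopfA21 hc cp).
  by apply: linformN; apply: linformD; exact: linform_d (cd_H cd hc cp).
- exact: linform_d (cd_f cd hc cp).
- move=> X; apply: etrans (congr1 (fun t => _ * t) (cd_left cd X hc cp)) _.
  apply: etrans (mulrA _ _ _) _; congr (_ * _).
  exact (esym (hopfQ21_right cd hc cp X)).
Qed.

Hypothesis clW : closed_form (hopfA21 f N V H).

(** As d (d V) = d (d f) = 0 and [hopfA21] is closed, only the product of
    [hopfA21] - 2 dH with df is left. *)
Lemma closed_hopfA22 : closed_form hopfA22.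
Proof.
move=> c p hc cp X Y; have sH := cd_H cd hc cp; have sV := cd_V cd hc cp.
have sf := cd_f cd hc cp.
have dr Z T : d (fun q => r c q Z) c p T = d (fun q => d V c q Z) c p T
    - (d H c p T * d f c p Z + H p * d (fun q => d f c q Z) c p T).
  have sdf := smooth_at_d hc Z sf; have sHf := smooth_atM hc sH sdf.
  rewrite -(dM hc cp T sH sdf) -(dN hc cp T sHf).
  by rewrite -(dD hc cp T (smooth_at_d hc Z sV) (smooth_atN hc sHf)).
have dE Z T : d (fun q => hopfA22 c q Z) c p T
    = d (fun q => d V c q Z) c p T
        - (d H c p T * d f c p Z + H p * d (fun q => d f c q Z) c p T)
      + (d (fun q => d V c q Z) c p T
        - (d H c p T * d f c p Z + H p * d (fun q => d f c q Z) c p T))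
      - (d (fun q => hopfA21 f N V H c q Z) c p T * f p
         + hopfA21 f N V H c p Z * d f c p T).
  have sW := smooth_hopfA21 Z hc cp; have sWf := smooth_atM hc sW sf.
  have sr : smooth_at c p (fun q => r c q Z).
    apply: smooth_atD => //; first exact: smooth_at_d.
    apply: smooth_atN => //; apply: smooth_atM => //; exact: smooth_at_d.
  rewrite -(dr Z T) -(dM hc cp T sW sf) -(dN hc cp T sWf) -(dD hc cp T sr sr).
  by rewrite -(dD hc cp T (smooth_atD hc sr sr) (smooth_atN hc sWf)).
have Zw := hopfQ21_wedge_df X Y hc cp.
have cl := clW hc cp X Y.
have Es := d_symmetric hc cp X Y sf; have Vs := d_symmetric hc cp X Y sV.
apply: etrans (congr2 (fun a b => a - b) (dE Y X) (dE X Y)) _; cbv beta.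
exact (jet_closed_hopfA22 (H p) (f p) Zw cl Es Vs).
Qed.

End HopfRow.

End ClosedForms.

(** * The mean curvature sphere of a graph *)

#[local] Opaque hopfA21.

Section SphereAlgebra.
Variable A : pzRingType.
Variables f N V H x n v h v0 v1 : A.
Let u := v0 - f * v1.

Lemma sphere_dS_low :
  - h * v0 + (h * f + H * x - v) * v1 = - (h * u) + (H * x - v) * v1.
Proof. by rewrite /u; ncring. Qed.

Lemma sphere_dS_u : N * x = - (x * V) ->
  (n - (x * H + f * h)) * v0
  + (- ((n - (x * H + f * h)) * f + (N - f * H) * x) - (x * V + f * v)) * v1
  - f * (- h * v0 + (h * f + H * x - v) * v1) = (n - x * H) * u.
Proof.
move=> E; apply: subr0_eq; rewrite /u.
have E0 : N * x + x * V = 0 by rewrite E addNr.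
set lhs := (X in X = 0).
have -> : lhs = - (N * x + x * V) * v1 by rewrite /lhs; ncring.
by rewrite E0 oppr0 mul0r.
Qed.

Lemma sphere_S_low : - H * v0 + (H * f - V) * v1 = - (H * u) - V * v1.
Proof. by rewrite /u; ncring. Qed.

Lemma sphere_S_u :
  (N - f * H) * v0 + (- ((N - f * H) * f) - f * V) * v1
  - f * (- H * v0 + (H * f - V) * v1) = N * u.
Proof. by rewrite /u; ncring. Qed.

End SphereAlgebra.

Section Graph.
Variables (R : realType) (M : riemannSurface R).
Implicit Types (c : chart R M) (p q : M) (X Y : R * R).

Definition mx2 (a b s t : quat R) : 'M[quat R]_2 :=
  \matrix_(i, j) if i == 0 then (if j == 0 then a else b)
                 else (if j == 0 then s else t).

Lemma mx2E a b s t : [/\ mx2 a b s t 0 0 = a, mx2 a b s t 0 1 = b,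
  mx2 a b s t 1 0 = s & mx2 a b s t 1 1 = t].
Proof. by split; rewrite mxE. Qed.

(** A coordinate on (H/L)_p, whose kernel is the fibre of the graph.  Together with
    the second entry of v it determines v, and in these two coordinates the mean
    curvature sphere is triangular. *)
Definition graph_defect (f : M -> quat R) p (v : Hvec R) : quat R :=
  v 0 0 - f p * v 1 0.

Lemma graph_defectE f p v : graph_defect f p v = v 0 0 - f p * v 1 0.
Proof. by []. Qed.

Variables (f N V H : M -> quat R).
Hypothesis cd : conformal_data f N V H.

(** The matrix with rows (N, 0) and (- H, - V), conjugated by the unipotent matrix
    with rows (1, f) and (0, 1), which maps the second basis vector into L. *)
Definition graph_sphere p : 'M[quat R]_2 :=
  mx2 (N p - f p * H p) (- ((N p - f p * H p) * f p) - f p * V p)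
      (- H p) (H p * f p - V p).

Local Notation u := (graph_defect f).

Lemma sphere_low p (v : Hvec R) :
  (graph_sphere p *m v) 1 0 = - (H p * u p v) - V p * v 1 0.
Proof.
rewrite mulmx2E; have [_ _ -> ->] := mx2E (N p - f p * H p)
  (- ((N p - f p * H p) * f p) - f p * V p) (- H p) (H p * f p - V p).
exact: sphere_S_low.
Qed.

Lemma sphere_u p (v : Hvec R) : u p (graph_sphere p *m v) = N p * u p v.
Proof.
rewrite /graph_defect !mulmx2E; have [-> -> -> ->] := mx2E (N p - f p * H p)
  (- ((N p - f p * H p) * f p) - f p * V p) (- H p) (H p * f p - V p).
exact: sphere_S_u.
Qed.

Lemma vecP p (v w : Hvec R) : u p v = u p w -> v 1 0 = w 1 0 -> v = w.
Proof.
move=> E1 E2; apply: cV2P => //; move: E1; rewrite /graph_defect E2.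
by move=> /(congr1 (fun t => t + f p * w 1 0)); rewrite !subrK.
Qed.

Lemma graphE p v : graph_line f p v <-> u p v = 0.
Proof.
apply: iff_trans (graph_lineP f p v) _; rewrite graph_defectE.
by split=> [->|/eqP]; [exact: subrr|rewrite subr_eq0 => /eqP].
Qed.

Lemma cvD (v w : Hvec R) i : (v + w) i 0 = v i 0 + w i 0.
Proof. by rewrite mxE. Qed.

Lemma cvN (v : Hvec R) i : (- v) i 0 = - v i 0.
Proof. by rewrite mxE. Qed.

Lemma uD p v w : u p (v + w) = u p v + u p w.
Proof. by rewrite /graph_defect !cvD mulrDr opprD addrACA. Qed.

Lemma uN p v : u p (- v) = - u p v.
Proof. by rewrite /graph_defect !cvN mulrN opprD. Qed.

Lemma uB p v w : u p (v - w) = u p v - u p w.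
Proof. by rewrite uD uN. Qed.

Lemma cvB (v w : Hvec R) i : (v - w) i 0 = v i 0 - w i 0.
Proof. by rewrite cvD cvN. Qed.

Lemma mulmx_ext (A B : 'M[quat R]_2) :
  (forall v : Hvec R, A *m v = B *m v) -> A = B.
Proof.
move=> E; apply/matrixP => i; apply: ord2P.
  have := congr1 (fun v : Hvec R => v i 0) (E (col2 1 0)).
  by rewrite /= !mulmx2E col2_0 col2_1 !mulr1 !mulr0 !addr0.
have := congr1 (fun v : Hvec R => v i 0) (E (col2 0 1)).
by rewrite /= !mulmx2E col2_0 col2_1 !mulr1 !mulr0 !add0r.
Qed.

Lemma sphere_sphere p (v : Hvec R) : graph_sphere p *m (graph_sphere p *m v) = - v.
Proof.
apply: (@vecP p).
  by rewrite !sphere_u uN mulrA (cd_NN cd) mulN1r.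
rewrite sphere_low sphere_u sphere_low cvN.
have := cd_HN cd p; have := cd_VV cd p.
move: (u p v) (v 1 0) (H p) (N p) (V p) => a b h n w ww hn.
have -> : - (h * (n * a)) - w * (- (h * a) - w * b)
  = - ((h * n - w * h) * a) + w * w * b by ncring.
by rewrite ww hn subrr mul0r oppr0 add0r mulN1r.
Qed.

Lemma sphere_sq p : graph_sphere p *m graph_sphere p = - (1%:M : 'M[quat R]_2).
Proof.
by apply: mulmx_ext => v; rewrite -mulmxA sphere_sphere mulNmx mul1mx.
Qed.

Lemma sphere_mem p (v : Hvec R) :
  graph_line f p v -> graph_line f p (graph_sphere p *m v).
Proof. by move=> /graphE E; apply/graphE; rewrite sphere_u E mulr0. Qed.

Lemma sphere_image p :
  (fun v : Hvec R => graph_sphere p *m v) @` graph_line f p = graph_line f p.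
Proof.
apply/seteqP; split=> [_ [v Lv <-]|v Lv]; first exact: sphere_mem.
exists (- (graph_sphere p *m v)); last by rewrite mulmxN sphere_sphere opprK.
by apply/graphE; rewrite uN; move/sphere_mem/graphE : Lv => ->; rewrite oppr0.
Qed.

Lemma smooth_sphere i j : smooth_fun (fun p => graph_sphere p i j).
Proof.
move=> c p hc cp; have sH := cd_H cd hc cp; have sV := cd_V cd hc cp.
have sN := cd_N cd hc cp; have sf := cd_f cd hc cp.
have s00 : smooth_at c p (fun q => N q - f q * H q).
  by apply: smooth_atD => //; apply: smooth_atN => //; exact: smooth_atM.
have E q := mx2E (N q - f q * H q)
  (- ((N q - f q * H q) * f q) - f q * V q) (- H q) (H q * f q - V q).
have sE a b (F : M -> quat R) : (forall q, graph_sphere q a b = F q) ->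
  smooth_at c p F -> smooth_at c p (fun q => graph_sphere q a b).
  by move=> /funext ->.
move: i j; apply: ord2P; apply: ord2P.
- by apply: sE s00 => q; have [-> _ _ _] := E q.
- apply: (sE _ _ (fun q => - ((N q - f q * H q) * f q) - f q * V q)).
    by move=> q; have [_ -> _ _] := E q.
  apply: smooth_atD => //; apply: smooth_atN => //; exact: smooth_atM.
- apply: (sE _ _ (fun q => - H q)); last exact: smooth_atN.
  by move=> q; have [_ _ -> _] := E q.
- apply: (sE _ _ (fun q => H q * f q - V q)).
    by move=> q; have [_ _ _ ->] := E q.
  apply: smooth_atD => //; [exact: smooth_atM|exact: smooth_atN].
Qed.

Section AtChart.
Variables (c : chart R M) (p : M).
Hypotheses (hc : atlas M c) (cp : cdom c p).
Let sH := cd_H cd hc cp.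
Let sV := cd_V cd hc cp.
Let sN := cd_N cd hc cp.
Let sf := cd_f cd hc cp.

Lemma dsphereE X : dmx graph_sphere c p X =
  mx2 (d N c p X - (d f c p X * H p + f p * d H c p X))
    (- ((d N c p X - (d f c p X * H p + f p * d H c p X)) * f p
        + (N p - f p * H p) * d f c p X) - (d f c p X * V p + f p * d V c p X))
    (- d H c p X) (d H c p X * f p + H p * d f c p X - d V c p X).
Proof.
have E q := mx2E (N q - f q * H q)
  (- ((N q - f q * H q) * f q) - f q * V q) (- H q) (H q * f q - V q).
have dE a b (F : M -> quat R) : (forall q, graph_sphere q a b = F q) ->
  d (fun q => graph_sphere q a b) c p X = d F c p X.
  by move=> /funext ->.
have sfH := smooth_atM hc sf sH; have sfV := smooth_atM hc sf sV.
have sHf := smooth_atM hc sH sf.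
have s00 := smooth_atD hc sN (smooth_atN hc sfH).
have d00 : d (fun q => N q - f q * H q) c p X
    = d N c p X - (d f c p X * H p + f p * d H c p X).
  by rewrite (dD hc cp X sN (smooth_atN hc sfH)) (dN hc cp X sfH)
    (dM hc cp X sf sH).
have s0f := smooth_atM hc s00 sf.
apply/matrixP; apply: ord2P; apply: ord2P.
- rewrite 2!mxE /=; apply: etrans (dE 0 0 _ _) d00.
  by move=> q; have [-> _ _ _] := E q.
- rewrite 2!mxE /=; apply: etrans (dE 0 1 _ _) _.
    by move=> q; have [_ -> _ _] := E q.
  rewrite (dD hc cp X (smooth_atN hc s0f) (smooth_atN hc sfV)).
  rewrite (dN hc cp X s0f) (dN hc cp X sfV).
  apply: (congr2 (fun a b => - a - b)) (dM hc cp X sf sV).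
  exact (etrans (dM hc cp X s00 sf) (congr1 (fun t => t * f p + _) d00)).
- rewrite 2!mxE /=; apply: etrans (dE 1 0 _ _) (dN hc cp X sH).
  by move=> q; have [_ _ -> _] := E q.
- rewrite 2!mxE /=; apply: etrans (dE 1 1 _ _) _.
    by move=> q; have [_ _ _ ->] := E q.
  by rewrite (dD hc cp X sHf (smooth_atN hc sV)) (dN hc cp X sV)
    (dM hc cp X sH sf).
Qed.

Lemma dsphere_low X (v : Hvec R) : (dmx graph_sphere c p X *m v) 1 0
  = - (d H c p X * u p v) + (H p * d f c p X - d V c p X) * v 1 0.
Proof.
rewrite dsphereE mulmx2E; have [_ _ -> ->] := mx2E
  (d N c p X - (d f c p X * H p + f p * d H c p X))
  (- ((d N c p X - (d f c p X * H p + f p * d H c p X)) * f p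
        + (N p - f p * H p) * d f c p X) - (d f c p X * V p + f p * d V c p X))
  (- d H c p X) (d H c p X * f p + H p * d f c p X - d V c p X).
exact (sphere_dS_low _ _ _ _ _ _ _).
Qed.

Lemma dsphere_u X (v : Hvec R) : u p (dmx graph_sphere c p X *m v)
  = (d N c p X - d f c p X * H p) * u p v.
Proof.
rewrite /graph_defect dsphereE !mulmx2E; have [-> -> -> ->] := mx2E
  (d N c p X - (d f c p X * H p + f p * d H c p X))
  (- ((d N c p X - (d f c p X * H p + f p * d H c p X)) * f p
        + (N p - f p * H p) * d f c p X) - (d f c p X * V p + f p * d V c p X))
  (- d H c p X) (d H c p X * f p + H p * d f c p X - d V c p X).
apply: sphere_dS_u.
exact (etrans (esym (cd_left cd X hc cp)) (cd_right cd X hc cp)).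
Qed.

End AtChart.

End Graph.

#[local] Opaque graph_defect.

Lemma sphere_A_u_alg (A : pzRingType) (N H n n' x x' : A) :
  N * N = -1 -> x' = N * x -> x * H + x * H = n - N * n' ->
  N * (n' - x' * H) - (n - x * H) = 0.
Proof.
move=> NN xl xH.
have NN0 : N * N + 1 = 0 by rewrite NN addNr.
have xH0 : n - N * n' - (x * H + x * H) = 0 by rewrite xH subrr.
have -> : N * (n' - x' * H) - (n - x * H) =
  - (n - N * n' - (x * H + x * H)) - N * (x' - N * x) * H - (N * N + 1) * x * H.
  by ncring.
by rewrite NN0 xH0 xl subrr; ncring.
Qed.

Lemma sphere_A_low_alg (A : pzRingType) (N V H n' x x' v v' h h' u v1 : A) :
  H * N = V * H -> N * N = -1 -> x' = N * x ->
  H * x + H * x = v - V * v' ->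
  - (H * ((n' - x' * H) * u)) - V * (- (h' * u) + (H * x' - v') * v1)
    - (- (h * u) + (H * x - v) * v1)
  = (h + V * h' - H * (n' - x' * H)) * u + (v - H * x + (v - H * x)) * v1.
Proof.
move=> HN NN xl Hx; apply: subr0_eq.
have NN0 : N * N + 1 = 0 by rewrite NN addNr.
have HN0 : H * N - V * H = 0 by rewrite HN subrr.
have Hx0 : v - V * v' - (H * x + H * x) = 0 by rewrite Hx subrr.
have xl0 : x' - N * x = 0 by rewrite xl subrr.
set lhs := (X in X = 0).
have -> : lhs = - (v - V * v' - (H * x + H * x)) * v1
  + (H * N - V * H) * x' * v1 - H * N * (x' - N * x) * v1
  - H * (N * N + 1) * x * v1 by rewrite /lhs; ncring.
by rewrite NN0 HN0 Hx0 xl0; ncring.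
Qed.

Lemma sphere_Q_alg (A : pzRingType) (N V H x x' v v' : A) :
  H * N = V * H -> x' = N * x -> V * V = -1 ->
  H * x + H * x = v - V * v' ->
  - (V * (H * x - v)) - (H * x' - v') + (- (V * (H * x - v)) - (H * x' - v')) = 0.
Proof.
move=> HN xl VV Hx.
have VV0 : V * V + 1 = 0 by rewrite VV addNr.
have HN0 : H * N - V * H = 0 by rewrite HN subrr.
have Hx0 : v - V * v' - (H * x + H * x) = 0 by rewrite Hx subrr.
have xl0 : x' - N * x = 0 by rewrite xl subrr.
set lhs := (X in X = 0).
have -> : lhs = V * (v - V * v' - (H * x + H * x))
  + V * (v - V * v' - (H * x + H * x)) + (V * V + 1) * v' + (V * V + 1) * v'
  - H * (x' - N * x) - H * (x' - N * x)
  - (H * N - V * H) * x - (H * N - V * H) * x by rewrite /lhs; ncring.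
by rewrite VV0 HN0 Hx0 xl0; ncring.
Qed.

Section GraphWillmore.
Variables (R : realType) (M : riemannSurface R).
Implicit Types (c : chart R M) (p q : M) (X Y : R * R).

Lemma smooth_on_at (U : set M) (F : M -> quat R) c p : open U -> U p ->
  atlas M c -> smooth_on U F -> smooth_at c p F.
Proof. by move=> oU Up hc sF; exists U; split=> //; exact: sF. Qed.

Lemma smooth_onP (U : set M) (F : M -> quat R) :
  (forall c p, atlas M c -> cdom c p -> U p -> smooth_at c p F) -> smooth_on U F.
Proof.
move=> sF c hc n; apply: Cn_local => z /(chart_imageP hc)[Uz cz zK].
have [D [oD Dz] cF] := smooth_atE hc cz (sF _ _ hc cz Uz).
by rewrite zK in Dz; exists D.
Qed.

Variables (f N V H : M -> quat R).
Hypothesis cd : conformal_data f N V H.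

Local Notation S := (graph_sphere f N V H).
Local Notation L := (graph_line f).
Local Notation u := (graph_defect f).

Lemma proj_graphP p (v w : Hvec R) : Defs.proj L p v = Defs.proj L p w <-> u p v = u p w.
Proof.
split=> [E|E].
  have : Defs.proj L p v v 
    by exists 0; [apply/graphE; rewrite graph_defectE !mxE mulr0 subrr|exact: addr0].
  rewrite E => -[l /graphE Ll <-].
  by rewrite uD Ll addr0.
suff sub (a b : Hvec R) : u p a = u p b -> Defs.proj L p a `<=` Defs.proj L p b.
  by apply/seteqP; split; apply: sub.
move=> {}E _ [l /graphE Ll <-]; exists (l + (a - b)); last first.
  by rewrite addrCA subrKC addrC.
apply/graphE; rewrite !uD uN.
by rewrite E subrr addr0.
Qed.

Lemma u_dsection (U : set M) (psi : M -> Hvec R) c p X : open U -> U p ->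
  atlas M c -> cdom c p -> Defs.section L U psi ->
  u p (dmx psi c p X) = d f c p X * psi p 1 0.
Proof.
move=> oU Up hc cp [spsi Lpsi].
have s1 := smooth_on_at oU Up hc (spsi 1 0).
have sf := cd_f cd hc cp.
have E : d (fun q => psi q 0 0) c p X
    = d f c p X * psi p 1 0 + f p * d (fun q => psi q 1 0) c p X.
  rewrite -(dM hc cp X sf s1); apply: (d_eq hc cp X oU Up) => q Uq _.
  by have /graph_lineP := Lpsi q Uq.
by rewrite graph_defectE !mxE E addrK.
Qed.

Lemma section_sphere (U : set M) (psi : M -> Hvec R) : open U ->
  Defs.section L U psi -> Defs.section L U (fun q => S q *m psi q).
Proof.
move=> oU [spsi Lpsi]; split; last by move=> q Uq; apply: sphere_mem; exact: Lpsi.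
move=> i j; apply: smooth_onP => c p hc cp Up.
have s i' := smooth_on_at oU Up hc (spsi i' j).
have sS i' j' := smooth_sphere cd i' j' hc cp.
have : smooth_at c p (fun q => S q i 0 * psi q 0 j + S q i 1 * psi q 1 j).
  by apply: smooth_atD => //; apply: smooth_atM.
by apply: (smooth_at_eq hc openT I) => q _ _; rewrite mulmx2E.
Qed.

(** On H/L the endomorphism S acts by N and dS by dN - df H; on L they act by - V
    and H df - dV.  The condition that Q vanishes on L is the equation for
    2 H df, and those on star delta are star df = N df = - df V. *)
Lemma graph_mean_curvature_sphere : mean_curvature_sphere L S.
Proof.
split.
- by move=> i j; apply/smooth_onT; exact: smooth_sphere.
- by move=> p; exact: sphere_sq.
- by move=> p; exact: (sphere_image cd).
move=> c p hc cp X.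
have JJf := dJJ X hc cp (cd_f cd hc cp).
split.
- move=> v /graphE Lv; apply/graphE.
  by have := dsphere_u cd hc cp X v; rewrite Lv mulr0.
- move=> v /graphE Lv; rewrite /hopfQ -scalemxAl mulmxBl -mulmxA /star.
  suff -> : S p *m (dmx S c p X *m v) - dmx S c p (Jplane X) *m v = 0.
    by rewrite scaler0.
  have ud Y : u p (dmx S c p Y *m v) = 0.
    by have := dsphere_u cd hc cp Y v; rewrite Lv mulr0.
  have u0 : u p 0 = 0 by rewrite graph_defectE !mxE mulr0 subr0.
  apply: (@vecP _ _ f p).
    rewrite uB sphere_u u0; apply: etrans (congr2 (fun a b => N p * a - b) (ud X)
      (ud (Jplane X))) _.
    by rewrite mulr0 subr0.
  have lowd Y : (dmx S c p Y *m v) 1 0 = (H p * d f c p Y - d V c p Y) * v 1 0.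
    by have := dsphere_low cd hc cp Y v; rewrite Lv mulr0 oppr0 add0r.
  have E1 : (S p *m (dmx S c p X *m v)) 1 0
      = - (V p * ((H p * d f c p X - d V c p X) * v 1 0)).
    apply: etrans (sphere_low _ _ _ _ _ _) _.
    apply: etrans (congr2 (fun s t => - (H p * s) - V p * t) (ud X) (lowd X)) _.
    by rewrite mulr0 oppr0 add0r.
  apply: etrans (cvB _ _ _) _.
  apply: etrans (congr2 (fun s t => s - t) E1 (lowd (Jplane X))) _.
  rewrite [RHS]mxE.
  have E := sphere_Q_alg (cd_HN cd p) (cd_left cd X hc cp) (cd_VV cd p)
    (cd_Hdf cd X hc cp).
  have {}E := qdblI (etrans E (esym (addr0 0))).
  rewrite mulrA -mulNr -mulrBl; apply: etrans (congr1 (fun t => t * _) E) _.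
  by rewrite mul0r.
- move=> U psi oU Up spsi.
  have upsi := u_dsection _ oU Up hc cp spsi.
  have up0 : u p (psi p) = 0 by case: spsi => _ /(_ p Up)/graphE.
  have El : u p (dmx psi c p (Jplane X)) = u p (S p *m dmx psi c p X).
    rewrite sphere_u !upsi mulrA; congr (_ * _).
    exact (cd_left cd X hc cp).
  split.
    apply/proj_graphP.
    rewrite (u_dsection _ oU Up hc cp (section_sphere oU spsi)) upsi.
    rewrite sphere_low up0 mulr0 oppr0 add0r mulrN.
    by rewrite (cd_right cd X hc cp) mulNr mulrA.
  rewrite /star /Defs.delta (iffRL (proj_graphP _ _ _) El).
  apply/seteqP; split=> [_ [l Ll <-]|_ [_ [l Ll <-] <-]].
    move: Ll; rewrite -{1}(sphere_image cd p) => -[l' Ll' <-].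
    by exists (dmx psi c p X + l'); [exists l'|rewrite mulmxDr].
  by exists (S p *m l); [exact: sphere_mem|rewrite mulmxDr].
Qed.

End GraphWillmore.

Section GraphIsWillmore.
Variables (R : realType) (M : riemannSurface R).
Implicit Types (c : chart R M) (p q : M) (X Y : R * R).
Variables (f N V H : M -> quat R).
Hypothesis cd : conformal_data f N V H.

Local Notation S := (graph_sphere f N V H).
Local Notation L := (graph_line f).
Local Notation u := (graph_defect f).

Let psi0 p : Hvec R := \col_(i < 2) [:: f p; 1]`_i.

Let psi0_section : Defs.section L setT psi0.
Proof.
split=> [i j|q _]; last by exists 1 => //; apply: cV2P; rewrite rscaleE mulr1.
rewrite (ord1 j); apply/smooth_onT => c p hc cp; have sf := cd_f cd hc cp.
move: i; apply: ord2P.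
  by apply: (smooth_at_eq hc openT I _ sf) => q _ _; rewrite mxE.
apply: (smooth_at_eq hc openT I _ (smooth_at_cst c p (1 : quat R))) => q _ _.
by rewrite mxE.
Qed.

Lemma graph_line_subbundle : line_subbundle L.
Proof.
move=> p; exists setT, psi0; split=> //; first exact: openT.
  by case: psi0_section.
move=> q _; split=> //; apply/eqP => /colP/(_ 1); rewrite !mxE /= => /eqP.
by rewrite oner_eq0.
Qed.

Lemma graph_immersed : immersed L.
Proof.
move=> c p hc cp X Y E.
have /(proj_graphP f p) := E setT psi0 openT I psi0_section.
rewrite (u_dsection cd X openT I hc cp psi0_section).
rewrite (u_dsection cd Y openT I hc cp psi0_section).
rewrite !mxE /= !mulr1; exact: cd_inj cd _ _ hc cp X Y.
Qed.

Lemma graph_holomorphic : holomorphic_curve L.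
Proof.
have [_ _ _ mcs] := graph_mean_curvature_sphere cd.
exists (fun p v => S p *m v); split.
- split.
  + by move=> p v; exact: sphere_mem.
  + by move=> p v w _ _; exact: mulmxDr.
  + move=> p v l _; apply/colP => i.
    by rewrite mulmx2E !rscaleE mulmx2E mulrDl !mulrA.
  + by move=> U psi oU sec; have [] := section_sphere cd oU sec.
- by move=> p v _; exact: (sphere_sphere cd).
- move=> U psi oU sec c p hc cp Up X.
  by have [_ _ /(_ U psi oU Up sec)[]] := mcs c p hc cp X.
Qed.

(** The upper entry is f times the lower one, which says that star A takes values
    in L; this is the equation for 2 df H. *)
Lemma star_hopfA_mul c p X (v : Hvec R) : atlas M c -> cdom c p ->
  let w := star (hopfA S) c p X *m v in
  let y := hopfA21 f N V H c p X * u p v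
    + (d V c p X - H p * d f c p X + (d V c p X - H p * d f c p X)) * v 1 0 in
  w 1 0 = quarter R * y /\ w 0 0 = quarter R * (f p * y).
Proof.
move=> hc cp w y.
have sf := cd_f cd hc cp; have sV := cd_V cd hc cp.
have sN := cd_N cd hc cp; have sH := cd_H cd hc cp.
pose z0 := S p *m (dmx S c p (Jplane X) *m v).
pose z1 := dmx S c p X *m v.
have dsJ : dmx S c p (Jplane (Jplane X)) *m v = - (dmx S c p X *m v).
  have -> : dmx S c p (Jplane (Jplane X)) = - dmx S c p X.
    apply/matrixP => i j; rewrite /dmx !mxE.
    exact (dJJ X hc cp (smooth_sphere cd i j hc cp)).
  by rewrite mulNmx.
have wE i : w i 0 = quarter R * (z0 - z1) i 0.
  rewrite /w /star /hopfA -scalemxAl mulmxDl -mulmxA mxE.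
  exact (congr1 (fun t => quarter R * (z0 + t) i 0) dsJ).
have zu : u p (z0 - z1) = 0.
  apply: etrans (uB _ _ _ _) _.
  apply: etrans (congr2 (fun a b => a - b) (etrans (sphere_u _ _ _ _ _ _)
    (congr1 (fun t => N p * t) (dsphere_u cd hc cp (Jplane X) v)))
    (dsphere_u cd hc cp X v)) _.
  rewrite mulrA -mulrBl.
  apply: etrans (congr1 (fun t => t * _) (sphere_A_u_alg (cd_NN cd p)
    (cd_left cd X hc cp) (cd_dfH cd X hc cp))) _.
  by rewrite mul0r.
have zl : (z0 - z1) 1 0 = y.
  apply: etrans (cvB _ _ _) _.
  apply: etrans (congr2 (fun a b => a - b) (etrans (sphere_low _ _ _ _ _ _)
    (congr2 (fun s t => - (H p * s) - V p * t) (dsphere_u cd hc cp (Jplane X) v)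
      (dsphere_low cd hc cp (Jplane X) v)))
    (dsphere_low cd hc cp X v)) _.
  exact (sphere_A_low_alg _ _ _ _ _ (cd_HN cd p) (cd_NN cd p)
    (cd_left cd X hc cp) (cd_Hdf cd X hc cp)).
split; first by rewrite wE zl.
rewrite wE; congr (_ * _); move: zu; rewrite graph_defectE zl => /eqP.
by rewrite subr_eq0 => /eqP.
Qed.

Hypothesis clW : closed_form (hopfA21 f N V H).

(** Up to the factor 4 the rows of star A are f w, f e and w, e, where w is
    [hopfA21] and e is [hopfA22]. *)
Lemma graph_closed_A : closed_mx_form (star (hopfA S)).
Proof.
have sW := smooth_hopfA21 cd; have sE := smooth_hopfA22 cd.
have clE := closed_hopfA22 cd clW.
have sf := cd_f cd.
have sfW : smooth_form (fun c p X => f p * hopfA21 f N V H c p X).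
  move=> c p Y hc cp; apply: smooth_atM => //; [exact: sf|exact: sW].
have sfE : smooth_form (fun c p X => f p * hopfA22 f N V H c p X).
  move=> c p Y hc cp; apply: smooth_atM => //; [exact: sf|exact: sE].
have col0 c p X i : star (hopfA S) c p X i 0 = (star (hopfA S) c p X *m col2 1 0) i 0.
  by rewrite mulmx2E col2_0 col2_1 mulr1 mulr0 addr0.
have col1 c p X i : star (hopfA S) c p X i 1 = (star (hopfA S) c p X *m col2 0 1) i 0.
  by rewrite mulmx2E col2_0 col2_1 mulr1 mulr0 add0r.
apply: ord2P; apply: ord2P.
- apply: closed_form_eq (closed_form_cstl (quarter R) sfW
    (closed_formMl sf sW clW (df_wedge_hopfA21 cd))) => c p hc cp X.
  rewrite col0; have [_ ->] := star_hopfA_mul X (col2 1 0) hc cp.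
  by rewrite graph_defectE col2_0 col2_1 !mulr0 subr0 addr0 mulr1.
- apply: closed_form_eq (closed_form_cstl (quarter R) sfE
    (closed_formMl sf sE clE (df_wedge_hopfA22 cd))) => c p hc cp X.
  rewrite col1; have [_ ->] := star_hopfA_mul X (col2 0 1) hc cp.
  by rewrite graph_defectE col2_0 col2_1 !mulr1 add0r mulrN addrC.
- apply: closed_form_eq (closed_form_cstl (quarter R) sW clW) => c p hc cp X.
  rewrite col0; have [-> _] := star_hopfA_mul X (col2 1 0) hc cp.
  by rewrite graph_defectE col2_0 col2_1 !mulr0 subr0 addr0 mulr1.
- apply: closed_form_eq (closed_form_cstl (quarter R) sE clE) => c p hc cp X.
  rewrite col1; have [-> _] := star_hopfA_mul X (col2 0 1) hc cp.
  by rewrite graph_defectE col2_0 col2_1 !mulr1 add0r mulrN addrC.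
Qed.

Theorem graph_willmore : willmore L.
Proof.
exists S; split.
- exact: graph_line_subbundle.
- exact: graph_immersed.
- exact: graph_holomorphic.
- exact: graph_mean_curvature_sphere.
- exact: graph_closed_A.
Qed.

End GraphIsWillmore.

(** * Quaternionic linear algebra and matrix calculus *)

#[local] Transparent hopfA21 graph_defect.

Section Pairing.
Variable R : realType.
Implicit Types (b : Hform R) (v w a : Hvec R) (l : quat R).

Lemma pairingE b v : pairing b v = b 0 0 * v 0 0 + b 0 1 * v 1 0.
Proof. exact: mulmx2E. Qed.

Lemma pairingD b v w : pairing b (v + w) = pairing b v + pairing b w.
Proof. by rewrite /pairing mulmxDr mxE. Qed.

Lemma pairingN b v : pairing b (- v) = - pairing b v.
Proof. by rewrite /pairing mulmxN mxE. Qed.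

Lemma pairingB b v w : pairing b (v - w) = pairing b v - pairing b w.
Proof. by rewrite pairingD pairingN. Qed.

Lemma pairing0 b : pairing b 0 = 0.
Proof. by rewrite /pairing mulmx0 mxE. Qed.

Lemma pairing_rscale b v l : pairing b (rscale v l) = pairing b v * l.
Proof. by rewrite !pairingE !rscaleE mulrDl !mulrA. Qed.

Lemma pairing_scalel l b v : pairing (l *: b) v = l * pairing b v.
Proof. by rewrite /pairing -scalemxAl mxE. Qed.

Lemma pairingBl b b' v : pairing (b - b') v = pairing b v - pairing b' v.
Proof. by rewrite /pairing mulmxBl !mxE. Qed.

Lemma rscaleD v l m : rscale v (l + m) = rscale v l + rscale v m.
Proof. by apply: cV2P; rewrite cvD !rscaleE mulrDr. Qed.

Lemma rscaleN v l : rscale v (- l) = - rscale v l.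
Proof. by apply: cV2P; rewrite cvN !rscaleE mulrN. Qed.

Lemma rscaleDl v w l : rscale (v + w) l = rscale v l + rscale w l.
Proof. by apply: cV2P; rewrite cvD !rscaleE cvD mulrDl. Qed.

Lemma rscaleNl v l : rscale (- v) l = - rscale v l.
Proof. by apply: cV2P; rewrite cvN !rscaleE cvN mulNr. Qed.

Lemma rscaleA v l m : rscale (rscale v l) m = rscale v (l * m).
Proof. by apply: cV2P; rewrite !rscaleE mulrA. Qed.

Lemma rscale1 v : rscale v 1 = v.
Proof. by apply: cV2P; rewrite rscaleE mulr1. Qed.

Lemma rscale0 v : rscale v 0 = 0.
Proof. by apply: cV2P; rewrite rscaleE mxE mulr0. Qed.

Lemma rscale0l l : rscale (0 : Hvec R) l = 0.
Proof. by apply: cV2P; rewrite rscaleE !mxE mul0r. Qed.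

Lemma mulmx_rscale (A : 'M[quat R]_2) v l : A *m rscale v l = rscale (A *m v) l.
Proof.
by apply/colP => i; rewrite rscaleE !mulmx2E !rscaleE mulrDl !mulrA.
Qed.

Lemma quarter_scale_eq0 m n (A : 'M[quat R]_(m, n)) :
  quarter R *: A = 0 -> A = 0.
Proof.
move=> /matrixP E; apply/matrixP => i j; have := E i j.
rewrite !mxE quarterE => /eqP; rewrite scaler_eq0 invr_eq0 pnatr_eq0 /=.
by move/eqP.
Qed.

Lemma row2_neq0 b : b != 0 -> b 0 0 != 0 \/ b 0 1 != 0.
Proof.
move=> b0; have [E0|] := eqVneq (b 0 0) 0; last by left.
right; apply: contra_neq b0 => E1; apply/rowP; apply: ord2P; by rewrite mxE.
Qed.

Lemma col2_neq0 v : v != 0 -> v 0 0 != 0 \/ v 1 0 != 0.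
Proof.
move=> v0; have [E0|] := eqVneq (v 0 0) 0; last by left.
right; apply: contra_neq v0 => E1; apply: cV2P; by rewrite mxE.
Qed.

Lemma exists_kernel_vector b : b != 0 -> exists2 a, a != 0 & pairing b a = 0.
Proof.
move=> /row2_neq0 b0; have [E|n0] := eqVneq (b 0 0) 0.
  exists (col2 1 0); last by rewrite pairingE col2_0 col2_1 E mul0r mulr0 addr0.
  by apply/eqP => /colP/(_ 0); rewrite !mxE /= => /eqP; rewrite oner_eq0.
exists (col2 (- (qinv (b 0 0) * b 0 1)) 1).
  by apply/eqP => /colP/(_ 1); rewrite !mxE /= => /eqP; rewrite oner_eq0.
by rewrite pairingE col2_0 col2_1 mulrN mulrA qmulV// mul1r mulr1 addNr.
Qed.

Lemma kernel_line b a v : b != 0 -> a != 0 -> pairing b a = 0 ->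
  pairing b v = 0 -> exists l, v = rscale a l.
Proof.
move=> /row2_neq0 b0 /col2_neq0 a0; rewrite !pairingE => ba bv.
have [E|n0] := eqVneq (b 0 0) 0.
  have b1 : b 0 1 != 0 by case: b0 => //; rewrite E eqxx.
  rewrite E !mul0r !add0r in ba bv.
  have a1 : a 1 0 = 0 by apply: (qmulI b1); rewrite mulr0.
  have v1 : v 1 0 = 0 by apply: (qmulI b1); rewrite mulr0.
  have a00 : a 0 0 != 0 by case: a0 => //; rewrite a1 eqxx.
  exists (qinv (a 0 0) * v 0 0); apply: cV2P; rewrite rscaleE.
    by rewrite mulrA qmulV// mul1r.
  by rewrite a1 v1 mul0r.
have slv (x : Hvec R) : b 0 0 * x 0 0 + b 0 1 * x 1 0 = 0 ->
    x 0 0 = - (qinv (b 0 0) * b 0 1) * x 1 0.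
  move=> /eqP; rewrite addr_eq0 => /eqP h; apply: (qmulI n0).
  by rewrite h mulNr mulrN !mulrA qmulV// mul1r.
have ax := slv a ba; have vx := slv v bv.
have a1 : a 1 0 != 0.
  by case: a0 => //; apply: contra_neq => E; rewrite ax E mulr0.
exists (qinv (a 1 0) * v 1 0); apply: cV2P; rewrite rscaleE.
  by rewrite ax vx -mulrA [a 1 0 * _]mulrA qmulV// mul1r.
by rewrite mulrA qmulV// mul1r.
Qed.

Lemma exists_dual_vector b : b != 0 -> exists v, pairing b v = 1.
Proof.
move=> /row2_neq0[n0|n0].
  exists (col2 (qinv (b 0 0)) 0).
  by rewrite pairingE col2_0 col2_1 qmulV// mulr0 addr0.
exists (col2 0 (qinv (b 0 1))).
by rewrite pairingE col2_0 col2_1 qmulV// mulr0 add0r.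
Qed.

Lemma exists_dual_form a : a != 0 -> exists b, pairing b a = 1.
Proof.
move=> /col2_neq0[n0|n0].
  exists (qinv (a 0 0) *: delta_mx 0 0).
  by rewrite pairing_scalel pairingE !mxE /= mul1r mul0r addr0 qVmul.
exists (qinv (a 1 0) *: delta_mx 0 1).
by rewrite pairing_scalel pairingE !mxE /= mul1r mul0r add0r qVmul.
Qed.

Lemma exists_frame b a : b != 0 -> a != 0 -> pairing b a = 0 ->
  exists (e : Hform R) (b0 : Hvec R),
    [/\ pairing e a = 1, pairing b b0 = 1, pairing e b0 = 0 &
    forall v, v = rscale a (pairing e v) + rscale b0 (pairing b v)].
Proof.
move=> bn0 an0 ba.
have [b0 bb0] := exists_dual_vector bn0.
have [e0 e0a] := exists_dual_form an0.
(* Subtracting a multiple of b leaves the value on a unchanged, as <b, a> = 0. *)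
exists (e0 - pairing e0 b0 *: b), b0.
have ea : pairing (e0 - pairing e0 b0 *: b) a = 1.
  by rewrite pairingBl pairing_scalel ba mulr0 subr0.
have eb0 : pairing (e0 - pairing e0 b0 *: b) b0 = 0.
  by rewrite pairingBl pairing_scalel bb0 mulr1 subrr.
split=> // v; set e := (X in pairing X v).
have bw : pairing b (v - rscale b0 (pairing b v)) = 0.
  by rewrite pairingB pairing_rscale bb0 mul1r subrr.
have [l lE] := kernel_line bn0 an0 ba bw.
have -> : pairing e v = l.
  have := congr1 (pairing e) lE.
  by rewrite pairingB !pairing_rscale -/e ea eb0 mul0r subr0 mul1r.
by rewrite -lE subrK.
Qed.

End Pairing.

Section MatrixCalculus.
Variables (R : realType) (M : riemannSurface R).
Variables (c : chart R M) (p : M).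
Hypotheses (hc : atlas M c) (cp : cdom c p).

Definition smooth_mx_at m n (F : M -> 'M[quat R]_(m, n)) :=
  forall i j, smooth_at c p (fun q => F q i j).

Lemma smooth_mulmx m n (F : M -> 'M[quat R]_(m, 2)) (G : M -> 'M[quat R]_(2, n)) :
  smooth_mx_at F -> smooth_mx_at G -> smooth_mx_at (fun q => F q *m G q).
Proof.
move=> sF sG i j.
have s : smooth_at c p (fun q => F q i 0 * G q 0 j + F q i 1 * G q 1 j).
  by apply: smooth_atD => //; apply: smooth_atM.
by apply: (smooth_at_eq hc openT I _ s) => q _ _; rewrite mulmx2E.
Qed.

Lemma dmx_mulmx m n (F : M -> 'M[quat R]_(m, 2)) (G : M -> 'M[quat R]_(2, n)) X :
  smooth_mx_at F -> smooth_mx_at G ->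
  dmx (fun q => F q *m G q) c p X = dmx F c p X *m G p + F p *m dmx G c p X.
Proof.
move=> sF sG; apply/matrixP => i j; rewrite [RHS]mxE !mulmx2E [LHS]mxE.
have -> : (fun q => (F q *m G q) i j)
    = (fun q => F q i 0 * G q 0 j + F q i 1 * G q 1 j).
  by apply/funext => q; exact: mulmx2E.
have E k := dM hc cp X (sF i k) (sG k j).
apply: etrans (dD hc cp X (smooth_atM hc (sF i 0) (sG 0 j))
  (smooth_atM hc (sF i 1) (sG 1 j))) _.
apply: etrans (congr2 (fun s t => s + t) (E 0) (E 1)) _.
by rewrite addrACA !mxE.
Qed.

Lemma dmx_cst m n (A : 'M[quat R]_(m, n)) X : dmx (fun=> A) c p X = 0.
Proof. by apply/matrixP => i j; rewrite !mxE d_cst. Qed.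

Lemma smooth_mx_cst m n (A : 'M[quat R]_(m, n)) : smooth_mx_at (fun=> A).
Proof. by move=> i j; exact: smooth_at_cst. Qed.

Lemma smooth_pairing b (F : M -> Hvec R) :
  smooth_mx_at F -> smooth_at c p (fun q => pairing b (F q)).
Proof. by move=> sF; exact: (smooth_mulmx (smooth_mx_cst b) sF). Qed.

Lemma dmx_mul_cst (F : M -> 'M[quat R]_2) (a : Hvec R) X : smooth_mx_at F ->
  dmx (fun q => F q *m a) c p X = dmx F c p X *m a.
Proof.
by move=> sF; rewrite (dmx_mulmx X sF (smooth_mx_cst a)) dmx_cst mulmx0 addr0.
Qed.

Lemma dmxN m n (F : M -> 'M[quat R]_(m, n)) X : smooth_mx_at F ->
  dmx (fun q => - F q) c p X = - dmx F c p X.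
Proof.
move=> sF; apply/matrixP => i j; rewrite !mxE -(dN hc cp X (sF i j)).
by congr (d _ c p X); apply/funext => q; rewrite mxE.
Qed.

Lemma dmxB m n (F G : M -> 'M[quat R]_(m, n)) X :
  smooth_mx_at F -> smooth_mx_at G ->
  dmx (fun q => F q - G q) c p X = dmx F c p X - dmx G c p X.
Proof.
move=> sF sG; apply/matrixP => i j; rewrite !mxE -(dN hc cp X (sG i j)).
rewrite -(dD hc cp X (sF i j) (smooth_atN hc (sG i j))).
by congr (d _ c p X); apply/funext => q; rewrite !mxE.
Qed.

Lemma smooth_rscale (F : M -> Hvec R) (l : M -> quat R) :
  smooth_mx_at F -> smooth_at c p l -> smooth_mx_at (fun q => rscale (F q) (l q)).
Proof.
move=> sF sl i j; rewrite (ord1 j).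
apply: (smooth_at_eq hc openT I _ (smooth_atM hc (sF i 0) sl)) => q _ _.
by rewrite rscaleE.
Qed.

Lemma dmx_rscale (F : M -> Hvec R) (l : M -> quat R) X :
  smooth_mx_at F -> smooth_at c p l ->
  dmx (fun q => rscale (F q) (l q)) c p X
  = rscale (dmx F c p X) (l p) + rscale (F p) (d l c p X).
Proof.
move=> sF sl; apply/colP => i; rewrite cvD !rscaleE !mxE.
rewrite -(dM hc cp X (sF i 0) sl).
by congr (d _ c p X); apply/funext => q; rewrite rscaleE.
Qed.

End MatrixCalculus.

(** * Affine coordinates on a curve in the projective line *)

Lemma affine_Hdf_alg (A : pzRingType) (N V H x x' v v' : A) :
  V * V = -1 -> H * N = V * H -> x' = N * x ->
  - (V * (H * x - v)) = H * x' - v' -> H * x + H * x = v - V * v'.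
Proof.
move=> VV HN xl E; apply: subr0_eq.
have VV0 : V * V + 1 = 0 by rewrite VV addNr.
have HN0 : H * N - V * H = 0 by rewrite HN subrr.
have xl0 : x' - N * x = 0 by rewrite xl subrr.
have E0 : - (V * (H * x - v)) - (H * x' - v') = 0 by rewrite E subrr.
have -> : H * x + H * x - (v - V * v') =
  V * (- (V * (H * x - v)) - (H * x' - v')) + V * H * (x' - N * x)
  + V * (H * N - V * H) * x + (V * V + 1) * (H * x + H * x)
  - (V * V + 1) * v by ncring.
by rewrite VV0 HN0 xl0 E0; ncring.
Qed.

Section LineSubbundle.
Variables (R : realType) (M : riemannSurface R) (L : M -> set (Hvec R)).
Hypothesis Lsub : line_subbundle L.
Implicit Types (c : chart R M) (p q : M) (X Y : R * R).

Lemma fibre_span p : exists2 w, w != 0 & L p = Hline w.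
Proof.
by have [U [psi [_ Up _ /(_ p Up)[psi0 LE]]]] := Lsub p; exists (psi p).
Qed.

Lemma fibre0 p : L p 0.
Proof. by have [w _ ->] := fibre_span p; exists 0 => //; exact: rscale0. Qed.

Lemma fibreD p v w : L p v -> L p w -> L p (v + w).
Proof.
have [x _ ->] := fibre_span p => -[l _ <-] [m _ <-].
by exists (l + m) => //; rewrite rscaleD.
Qed.

Lemma fibreN p v : L p v -> L p (- v).
Proof.
have [x _ ->] := fibre_span p => -[l _ <-].
by exists (- l) => //; rewrite rscaleN.
Qed.

Lemma fibre_rscale p v l : L p v -> L p (rscale v l).
Proof.
have [x _ ->] := fibre_span p => -[m _ <-].
by exists (m * l) => //; rewrite rscaleA.
Qed.

Lemma proj_sub p v w : Defs.proj L p v = Defs.proj L p w -> L p (v - w).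
Proof.
move=> E; have : Defs.proj L p v v by exists 0; [exact: fibre0|exact: addr0].
by rewrite E => -[l Ll <-]; rewrite addrAC subrr add0r.
Qed.

Lemma sub_proj p v w : L p (v - w) -> Defs.proj L p v = Defs.proj L p w.
Proof.
suff sub a b : L p (a - b) -> Defs.proj L p a `<=` Defs.proj L p b.
  move=> h; apply/seteqP; split; apply: sub => //.
  by rewrite -opprB; exact: fibreN.
move=> h _ [l Ll <-]; exists (l + (a - b)); first exact: fibreD.
by rewrite addrCA subrKC addrC.
Qed.

Variable b : Hform R.
Hypothesis bL : forall p v, L p v -> v != 0 -> pairing b v != 0.

Lemma exists_unit_section : exists psi : M -> Hvec R,
  forall p, L p (psi p) /\ pairing b (psi p) = 1.
Proof.
suff /choice[psi psiP] : forall p, exists w, L p w /\ pairing b w = 1.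
  by exists psi.
move=> p; have [w wn0 LE] := fibre_span p.
have Lw : L p w by rewrite LE; exists 1 => //; exact: rscale1.
exists (rscale w (qinv (pairing b w))); split; first exact: fibre_rscale.
by rewrite pairing_rscale qmulV//; exact: bL Lw wn0.
Qed.

Variable psi : M -> Hvec R.
Hypothesis psiP : forall p, L p (psi p) /\ pairing b (psi p) = 1.

Lemma fibre_unique p v : L p v -> v = rscale (psi p) (pairing b v).
Proof.
have [w wn0 LE] := fibre_span p; have [] := psiP p; rewrite LE.
move=> [l _ <-]; rewrite pairing_rscale => bl [m _ <-].
have bw : pairing b w != 0.
  by apply/eqP => E; move: bl; rewrite E mul0r => /esym/eqP; rewrite oner_eq0.
rewrite rscaleA pairing_rscale; congr (rscale _ _).
have -> : l * (pairing b w * m) = (l * pairing b w) * m by rewrite mulrA.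
rewrite (_ : l * pairing b w = 1) ?mul1r//.
by apply: (qmulI bw); rewrite mulrA bl mul1r mulr1.
Qed.

Lemma smooth_unit_section i : smooth_fun (fun p => psi p i 0).
Proof.
move=> c p hc cp.
have [U [chi [oU Up schi LE]]] := Lsub p.
have schi_at q j : U q -> cdom c q -> smooth_at c q (fun q => chi q j 0).
  by move=> Uq cq; exact: smooth_on_at oU Uq hc (schi j 0).
have bchi q : U q -> pairing b (chi q) != 0.
  move=> Uq; have [chi0 LqE] := LE q Uq.
  have Lchi : L q (chi q) by rewrite LqE; exists 1 => //; exact: rscale1.
  exact: bL Lchi chi0.
have sp : smooth_at c p (fun q => pairing b (chi q)).
  by apply: smooth_pairing => // j k; rewrite (ord1 k); exact: schi_at.
apply: (smooth_at_eq hc oU Up (F := fun q => chi q i 0 * qinv (pairing b (chi q)))).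
  move=> q Uq cq; have [chi0 LqE] := LE q Uq.
  have Lchi : L q (chi q) by rewrite LqE; exists 1 => //; exact: rscale1.
  have /(congr1 (fun v : Hvec R => v i 0)) := fibre_unique Lchi.
  by rewrite rscaleE => {1}->; rewrite -mulrA qmulV ?mulr1//; exact: bchi.
apply: smooth_atM => //; first exact: schi_at.
by apply: smooth_at_qinv => //; exact: bchi.
Qed.

End LineSubbundle.

Section AffineChart.
Variables (R : realType) (M : riemannSurface R).
Variables (L : M -> set (Hvec R)) (S : M -> 'M[quat R]_2).
Hypotheses (Lsub : line_subbundle L) (Limm : immersed L).
Hypothesis mcs : mean_curvature_sphere L S.
Variables (b e : Hform R) (a b0 : Hvec R).
Hypotheses (ba : pairing b a = 0) (ea : pairing e a = 1).
Hypotheses (bb0 : pairing b b0 = 1) (eb0 : pairing e b0 = 0).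
Hypothesis frame : forall v, v = rscale a (pairing e v) + rscale b0 (pairing b v).
Hypothesis bL : forall p v, L p v -> v != 0 -> pairing b v != 0.
Variable psi : M -> Hvec R.
Hypothesis psiP : forall p, L p (psi p) /\ pairing b (psi p) = 1.
Implicit Types (c : chart R M) (p q : M) (X Y : R * R) (v w : Hvec R).

(** The affine coordinate of HP^1 with a as the point at infinity: psi = a f + b0 is
    the section of L with <b, psi> = 1.  The functions N, V, H are the
    coefficients of S in the moving frame a, psi:
    S a = a N - psi H and S psi = - psi V. *)
Definition affine_f p := pairing e (psi p).
Definition affine_H p := - pairing b (S p *m a).
Definition affine_V p := - pairing b (S p *m psi p).
Definition affine_N p := pairing e (S p *m a) + affine_f p * affine_H p.

Local Notation f := affine_f.
Local Notation H := affine_H.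
Local Notation V := affine_V.
Local Notation N := affine_N.

Let vec_ext v w : pairing e v = pairing e w -> pairing b v = pairing b w -> v = w.
Proof. by move=> E1 E2; rewrite (frame v) (frame w) E1 E2. Qed.

Let psi1 p : pairing b (psi p) = 1. Proof. by have [] := psiP p. Qed.

(* The fibre L_p does not contain a, so an equation modulo L_p may be read off
   from the coefficients of a. *)
Let a_mem p y z : L p (rscale a y + rscale (psi p) z) -> y = 0.
Proof.
move=> h; have := fibre_unique Lsub psiP h.
rewrite pairingD !pairing_rscale ba psi1 mul0r mul1r add0r.
move=> /(congr1 (pairing e)); rewrite pairingD !pairing_rscale ea mul1r => E.
by apply: (@addIr _ (pairing e (psi p) * z)); rewrite E add0r.
Qed.

Lemma psi_frame p : psi p = rscale a (f p) + b0.
Proof. by rewrite {1}(frame (psi p)) psi1 rscale1. Qed.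

Lemma sphere_a p : S p *m a = rscale a (N p) - rscale (psi p) (H p).
Proof.
apply: vec_ext; rewrite pairingB !pairing_rscale.
  by rewrite ea mul1r /affine_N /affine_f addrK.
by rewrite ba mul0r psi1 mul1r sub0r opprK.
Qed.

Let S_L p v : L p v -> L p (S p *m v).
Proof.
by move=> Lv; have [_ _ SL _] := mcs; rewrite -SL; exists v.
Qed.

Lemma sphere_psi p : S p *m psi p = - rscale (psi p) (V p).
Proof.
have Lp : L p (psi p) by have [] := psiP p.
rewrite {1}(fibre_unique Lsub psiP (S_L Lp)) -rscaleN; congr rscale.
by rewrite /affine_V opprK.
Qed.

Let SS p v : S p *m (S p *m v) = - v.
Proof. by have [_ h _ _] := mcs; rewrite mulmxA h mulNmx mul1mx. Qed.

Lemma affine_VV p : V p * V p = -1.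
Proof.
have := SS p (psi p); rewrite sphere_psi mulmxN mulmx_rscale sphere_psi.
rewrite rscaleNl opprK rscaleA => /(congr1 (pairing b)).
by rewrite pairing_rscale pairingN psi1 mul1r.
Qed.

Let S2a p : - a = rscale a (N p * N p)
  + rscale (psi p) (V p * H p - H p * N p).
Proof.
rewrite -(SS p a) sphere_a mulmxDr mulmxN !mulmx_rscale sphere_psi.
rewrite rscaleNl opprK sphere_a rscaleDl rscaleNl !rscaleA.
by rewrite rscaleD rscaleN addrAC addrA.
Qed.

Lemma affine_HN p : H p * N p = V p * H p.
Proof.
have /(congr1 (pairing b)) := S2a p.
rewrite pairingN ba oppr0 pairingD !pairing_rscale ba mul0r add0r psi1 mul1r.
by move=> /esym/eqP; rewrite subr_eq0 => /eqP.
Qed.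

Lemma affine_NN p : N p * N p = -1.
Proof.
have := S2a p; rewrite affine_HN subrr rscale0 addr0 => /(congr1 (pairing e)).
by rewrite pairingN ea pairing_rscale ea mul1r.
Qed.

Section Smoothness.
Variables (c : chart R M) (p : M).
Hypotheses (hc : atlas M c) (cp : cdom c p).

Let sS : smooth_mx_at c p S.
Proof.
by move=> i j; have [sm _ _ _] := mcs; apply: smooth_on_at openT I hc (sm i j).
Qed.

Let spsi : smooth_mx_at c p psi.
Proof.
by move=> i j; rewrite (ord1 j); exact (smooth_unit_section Lsub bL psiP i hc cp).
Qed.

Let sSa : smooth_mx_at c p (fun q => S q *m a).
Proof. exact (smooth_mulmx hc sS (smooth_mx_cst c p a)). Qed.

Lemma smooth_affine_f : smooth_at c p f.
Proof. exact: smooth_pairing. Qed.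

Lemma smooth_affine_H : smooth_at c p H.
Proof.
by apply: smooth_atN => //; exact (smooth_pairing hc b sSa).
Qed.

Lemma smooth_affine_V : smooth_at c p V.
Proof.
apply: smooth_atN => //; apply: smooth_pairing => //.
exact (smooth_mulmx hc sS spsi).
Qed.

Lemma smooth_affine_N : smooth_at c p N.
Proof.
apply: smooth_atD => //; first exact (smooth_pairing hc e sSa).
by apply: smooth_atM => //; [exact: smooth_affine_f|exact: smooth_affine_H].
Qed.

Lemma dpsi X : dmx psi c p X = rscale a (d f c p X).
Proof.
have sf := smooth_affine_f.
apply/colP => i; rewrite rscaleE mxE.
have E q : psi q i 0 = a i 0 * f q + b0 i 0 by rewrite {1}psi_frame cvD rscaleE.
have sa := smooth_at_cst c p (a i 0).
have -> : (fun q => psi q i 0) = (fun q => a i 0 * f q + b0 i 0) by exact/funext.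
rewrite (dD hc cp X (smooth_atM hc sa sf) (smooth_at_cst c p (b0 i 0))).
by rewrite (dM hc cp X sa sf) !d_cst mul0r add0r addr0.
Qed.

Lemma dS_a X : dmx S c p X *m a =
  rscale a (d N c p X - d f c p X * H p) - rscale (psi p) (d H c p X).
Proof.
have sN := smooth_affine_N; have sH := smooth_affine_H.
rewrite -(dmx_mul_cst hc cp a X sS).
have -> : (fun q => S q *m a) = (fun q => rscale a (N q) - rscale (psi q) (H q)).
  by apply/funext => q; exact: sphere_a.
have sa := smooth_mx_cst c p a.
rewrite (dmxB hc cp X (smooth_rscale hc sa sN) (smooth_rscale hc spsi sH)).
rewrite (dmx_rscale hc cp X sa sN) (dmx_rscale hc cp X spsi sH) dpsi dmx_cst.
by rewrite rscale0l add0r rscaleA rscaleD rscaleN opprD addrA.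
Qed.

Lemma S_dpsi X : S p *m dmx psi c p X =
  rscale a (N p * d f c p X) - rscale (psi p) (H p * d f c p X).
Proof.
by rewrite dpsi mulmx_rscale sphere_a rscaleDl rscaleNl !rscaleA.
Qed.

Lemma d_Spsi X : dmx (fun q => S q *m psi q) c p X =
  - rscale a (d f c p X * V p) - rscale (psi p) (d V c p X).
Proof.
have sV := smooth_affine_V.
have -> : (fun q => S q *m psi q) = (fun q => - rscale (psi q) (V q)).
  by apply/funext => q; exact: sphere_psi.
rewrite (dmxN hc cp X (smooth_rscale hc spsi sV)) (dmx_rscale hc cp X spsi sV).
by rewrite dpsi opprD rscaleA.
Qed.

Let psi_section : Defs.section L setT psi.
Proof.
split=> [i j|q _]; last by have [] := psiP q.
rewrite (ord1 j); apply/smooth_onT.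
exact (smooth_unit_section Lsub bL psiP i).
Qed.

Lemma affine_right X : d f c p (Jplane X) = - (d f c p X * V p).
Proof.
have [_ _ _ /(_ c p hc cp X)[_ _ h]] := mcs.
have [/proj_sub E _] := h setT psi openT I psi_section.
have {E} := E Lsub; rewrite dpsi d_Spsi => E.
apply/eqP; rewrite -addr_eq0; apply/eqP.
apply: (@a_mem p _ (d V c p X)).
by move: E; rewrite opprD !opprK addrA -rscaleD.
Qed.

Lemma affine_left X : d f c p (Jplane X) = N p * d f c p X.
Proof.
have [_ _ _ /(_ c p hc cp X)[_ _ h]] := mcs.
have [_ E] := h setT psi openT I psi_section.
have : star (Defs.delta L psi) c p X (S p *m dmx psi c p X).
  rewrite E; exists (dmx psi c p X) => //.
  by exists 0; [exact: fibre0|exact: addr0].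
move=> [l Ll]; rewrite S_dpsi dpsi => El.
apply/esym/eqP; rewrite -subr_eq0; apply/eqP.
apply: (@a_mem p _ (- (H p * d f c p X))).
suff <- : l = rscale a (N p * d f c p X - d f c p (Jplane X))
    + rscale (psi p) (- (H p * d f c p X)) by [].
rewrite rscaleD !rscaleN addrAC -El addrAC subrr add0r //.
Qed.

Lemma dS_psi X : dmx S c p X *m psi p
  = rscale (psi p) (H p * d f c p X - d V c p X).
Proof.
have := d_Spsi X; rewrite (dmx_mulmx hc cp X sS spsi) S_dpsi.
rewrite rscaleD rscaleN.
have -> : N p * d f c p X = - (d f c p X * V p).
  by rewrite -affine_left affine_right.
rewrite rscaleN; set A := rscale a _; set B := rscale _ (d V c p X).
set C := rscale _ (H p * _) => E.
apply: (@addIr _ (- A - C)); rewrite E.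
by rewrite [- A - C]addrC addrACA subrr add0r addrC.
Qed.

(** This is Q psi = 0. *)
Lemma affine_Hdf X : H p * d f c p X + H p * d f c p X
  = d V c p X - V p * d V c p (Jplane X).
Proof.
have [_ _ _ /(_ c p hc cp X)[_ h _]] := mcs.
have [Lp _] := psiP p; have := h _ Lp.
rewrite /hopfQ -scalemxAl => /quarter_scale_eq0.
rewrite mulmxBl -mulmxA dS_psi mulmx_rscale sphere_psi rscaleNl rscaleA.
have dJ : star (dmx S) c p X *m psi p
  = rscale (psi p) (H p * d f c p (Jplane X) - d V c p (Jplane X)).
  exact: dS_psi.
rewrite dJ => /(congr1 (pairing b)); rewrite pairing0 pairingB pairingN.
rewrite !pairing_rscale psi1 !mul1r => /eqP; rewrite subr_eq0 => /eqP E.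
exact (affine_Hdf_alg (affine_VV p) (affine_HN p) (affine_left X) E).
Qed.

Lemma affine_injective : injective (d f c p).
Proof.
move=> X Y E; apply: (Limm hc cp) => U chi oU Up [schi Lchi].
apply: (sub_proj Lsub).
have schi_at : smooth_mx_at c p chi.
  by move=> i j; exact: smooth_on_at oU Up hc (schi i j).
have sb := smooth_pairing hc b schi_at.
have dchi Z : dmx chi c p Z = rscale (rscale a (d f c p Z)) (pairing b (chi p))
    + rscale (psi p) (d (fun q => pairing b (chi q)) c p Z).
  rewrite -dpsi -(dmx_rscale hc cp Z spsi sb); apply/matrixP => i j.
  rewrite !mxE; apply: (d_eq hc cp Z oU Up) => q Uq _.
  by rewrite {1}(fibre_unique Lsub psiP (Lchi q Uq)).
rewrite !dchi E opprD addrACA subrr add0r -rscaleN -rscaleD.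
by apply: (fibre_rscale Lsub); have [] := psiP p.
Qed.

End Smoothness.

(** The mean curvature sphere yields the equation for H df directly; the one for
    df H follows from it by [conformal_symmetry]. *)
Lemma affine_data : conformal_data f N V H.
Proof.
have sf : smooth_fun f by move=> c p hc cp; exact: smooth_affine_f.
have sN : smooth_fun N by move=> c p hc cp; exact: smooth_affine_N.
have sV : smooth_fun V by move=> c p hc cp; exact: smooth_affine_V.
have sH : smooth_fun H by move=> c p hc cp; exact: smooth_affine_H.
have dl c p X : atlas M c -> cdom c p -> d f c p (Jplane X) = N p * d f c p X.
  by move=> hc cp; exact: affine_left.
have dr c p X : atlas M c -> cdom c p ->
    d f c p (Jplane X) = - (d f c p X * V p).
  by move=> hc cp; exact: affine_right.
have Hdf c p X : atlas M c -> cdom c p ->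
    H p * d f c p X + H p * d f c p X
    = d V c p X - V p * d V c p (Jplane X).
  by move=> hc cp; exact: affine_Hdf.
have dfH c p X : atlas M c -> cdom c p ->
    d f c p X * H p + d f c p X * H p
    = d N c p X - N p * d N c p (Jplane X).
  move=> hc cp.
  have [->|X0] := eqVneq X 0.
    by rewrite Jplane0 (d_zero c p f) (d_zero c p N) mul0r mulr0 subrr addr0.
  have x0 := injective_d_neq0 (sf _ _ hc cp) hc cp (affine_injective hc cp) X0.
  apply: (qImul x0).
  rewrite (conformal_symmetry sf sN sV affine_NN affine_VV dl dr X hc cp).
  by rewrite -(Hdf c p X hc cp) mulrDl mulrDr -!mulrA.
split; [exact: sf|exact: sN|exact: sV|exact: sH|exact: affine_NN
  |exact: affine_VV|exact: affine_HN| |exact: dl|exact: dr|exact: dfH|exact: Hdf].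
by move=> c p hc cp; exact: affine_injective.
Qed.

End AffineChart.

(** * Hopf fields in affine coordinates *)

Section HopfForms.
Variables (R : realType) (M : riemannSurface R).
Implicit Types (c : chart R M) (p q : M) (X Y : R * R).

Definition smooth_mx_form m n (w : Defs.form M 'M[quat R]_(m, n)) :=
  forall i j, smooth_form (fun c p X => w c p X i j).

Lemma closed_form_pairing (w : Defs.form M 'M[quat R]_2) b a :
  smooth_mx_form w -> closed_mx_form w -> closed_form (form_pairing b w a).
Proof.
move=> sw clw.
have sr i j : smooth_form (fun c p X => w c p X i j * a j 0).
  by move=> c p Y hc cp; apply: smooth_atM => //;
    [exact: sw|exact: smooth_at_cst].
have cr i j := closed_form_cstr (a j 0) (sw i j) (clw i j).
have srow i : smooth_form
    (fun c p X => w c p X i 0 * a 0 0 + w c p X i 1 * a 1 0).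
  by move=> c p Y hc cp; apply: smooth_atD => //; [exact: sr|exact: sr].
have crow i := closed_formD (sr i 0) (sr i 1) (cr i 0) (cr i 1).
have sl i : smooth_form
    (fun c p X => b 0 i * (w c p X i 0 * a 0 0 + w c p X i 1 * a 1 0)).
  by move=> c p Y hc cp; apply: smooth_atM => //;
    [exact: smooth_at_cst|exact: srow].
have cl i := closed_form_cstl (b 0 i) (srow i) (crow i).
apply: closed_form_eq (closed_formD (sl 0) (sl 1) (cl 0) (cl 1)) => c p hc cp X.
by rewrite /form_pairing pairingE !mulmx2E.
Qed.

Variable S : M -> 'M[quat R]_2.
Hypothesis sS : smooth_mx_on setT S.

Let sSf i j : smooth_fun (fun p => S p i j).
Proof. by apply/smooth_onT; exact: sS. Qed.

Lemma dmxJJ c p X : atlas M c -> cdom c p ->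
  dmx S c p (Jplane (Jplane X)) = - dmx S c p X.
Proof.
move=> hc cp; apply/matrixP => i j; rewrite /dmx !mxE.
exact (dJJ X hc cp (sSf i j hc cp)).
Qed.

Lemma star_hopfAE c p X : atlas M c -> cdom c p -> star (hopfA S) c p X
  = quarter R *: (S p *m dmx S c p (Jplane X) - dmx S c p X).
Proof. by move=> hc cp; rewrite /star /hopfA /star dmxJJ. Qed.

Lemma star_hopfQE c p X : atlas M c -> cdom c p -> star (hopfQ S) c p X
  = quarter R *: (S p *m dmx S c p (Jplane X) + dmx S c p X).
Proof. by move=> hc cp; rewrite /star /hopfQ /star dmxJJ// opprK. Qed.

Lemma smooth_star_hopfA : smooth_mx_form (star (hopfA S)).
Proof.
move=> i j; pose F : Defs.form M (quat R) := fun c p X => quarter R *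
  ((S p i 0 * d (fun q => S q 0 j) c p (Jplane X)
  + S p i 1 * d (fun q => S q 1 j) c p (Jplane X)) - d (fun q => S q i j) c p X).
have FE : form_eq F (fun c p X => star (hopfA S) c p X i j).
  move=> c p hc cp X; rewrite star_hopfAE// mxE; congr (_ * _).
  by rewrite [RHS]mxE mulmx2E /dmx !mxE.
apply: (smooth_form_eq FE) => c p Y hc cp.
have sd i' j' Z := smooth_at_d hc Z (sSf i' j' hc cp).
apply: smooth_atM => //; first exact: smooth_at_cst.
apply: smooth_atD => //; last by apply: smooth_atN => //; exact: (sd i j Y).
by apply: smooth_atD => //; apply: smooth_atM => //;
  exact: sSf.
Qed.

Lemma star_hopfQ_entry i j : form_eq
  (fun c p X => star (hopfA S) c p X i j + quarter R *
     (d (fun q => S q i j) c p X + d (fun q => S q i j) c p X))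
  (fun c p X => star (hopfQ S) c p X i j).
Proof.
move=> c p hc cp X; rewrite star_hopfAE// star_hopfQE// ![in RHS]mxE ![in LHS]mxE.
rewrite -mulrDr; congr (_ * _).
move: (d _ c p X) (\sum__ _) => x y; ncring.
Qed.

Let smooth_quarter_dS i j : smooth_form (fun c p X => quarter R *
     (d (fun q => S q i j) c p X + d (fun q => S q i j) c p X)).
Proof.
move=> c p Y hc cp; have sd := smooth_at_d hc Y (sSf i j hc cp).
apply: smooth_atM => //; first exact: smooth_at_cst.
exact: smooth_atD.
Qed.

Lemma smooth_star_hopfQ : smooth_mx_form (star (hopfQ S)).
Proof.
move=> i j; apply: (smooth_form_eq (star_hopfQ_entry i j)) => c p Y hc cp.
apply: smooth_atD => //; first exact: smooth_star_hopfA.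
exact: smooth_quarter_dS.
Qed.

(** The difference of star Q and star A is dS / 2. *)
Lemma closed_star_hopfQ : closed_mx_form (star (hopfA S)) ->
  closed_mx_form (star (hopfQ S)).
Proof.
move=> clA i j; apply: (closed_form_eq (star_hopfQ_entry i j)).
have sd := smooth_form_d (sSf i j); have cd := closed_form_d (sSf i j).
have s2 : smooth_form
    (fun c p X => d (fun q => S q i j) c p X + d (fun q => S q i j) c p X).
  by move=> c p Y hc cp; apply: smooth_atD => //; exact: sd.
have c2 := closed_formD sd sd cd cd.
exact (closed_formD (smooth_star_hopfA i j) (@smooth_quarter_dS i j)
  (clA i j) (closed_form_cstl (quarter R) s2 c2)).
Qed.

Variables (b : Hform R) (a : Hvec R).

Lemma pairing_quarter v : pairing b (quarter R *: v) = quarter R * pairing b v.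
Proof.
rewrite !pairingE !mxE !quarterE (qscaler _ (b 0 0)) (qscaler _ (b 0 1)).
by rewrite -(scalerDr (4^-1)).
Qed.

Lemma pairing_hopfA c p X : atlas M c -> cdom c p ->
  form_pairing b (star (hopfA S)) a c p X
  = quarter R * (pairing b (S p *m (dmx S c p (Jplane X) *m a))
                 - pairing b (dmx S c p X *m a)).
Proof.
move=> hc cp; rewrite /form_pairing star_hopfAE//.
by rewrite -pairingB mulmxA -mulmxBl -scalemxAl; exact: pairing_quarter.
Qed.

Lemma pairing_hopfQ c p X : atlas M c -> cdom c p ->
  form_pairing b (star (hopfQ S)) a c p X
  = quarter R * (pairing b (S p *m (dmx S c p (Jplane X) *m a))
                 + pairing b (dmx S c p X *m a)).
Proof.
move=> hc cp; rewrite /form_pairing star_hopfQE//.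
by rewrite -pairingD mulmxA -mulmxDl -scalemxAl; exact: pairing_quarter.
Qed.

Variable L : M -> set (Hvec R).
Hypothesis Lsub : line_subbundle L.
Hypothesis mcs : mean_curvature_sphere L S.

(** As Q a = 0 and dS a lies in L, both <b, star Q a> and <b, dS a> vanish, and
    <b, star A a> differs from the former by half of the latter. *)
Lemma hopf_vanish c p X : atlas M c -> cdom c p -> L p a ->
  (forall v, L p v -> pairing b v = 0) ->
  form_pairing b (star (hopfA S)) a c p X = 0 /\
  form_pairing b (star (hopfQ S)) a c p X = 0.
Proof.
move=> hc cp La bL0.
have [_ _ _ /(_ c p hc cp)m] := mcs.
have [_ Q0 _] := m (Jplane X); have [dSL _ _] := m X.
have Q1 : form_pairing b (star (hopfQ S)) a c p X = 0.
  rewrite /form_pairing (_ : star (hopfQ S) c p X *m a = 0) ?pairing0//.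
  exact: Q0.
split; last exact: Q1.
have dz := bL0 _ (dSL _ La).
apply: etrans (pairing_hopfA X hc cp) _; rewrite dz subr0.
have := etrans (esym (pairing_hopfQ X hc cp)) Q1.
by rewrite dz addr0.
Qed.

(** If b vanishes on a vector of L_p, then L_p is the kernel of b, which is spanned
    by a, and [hopf_vanish] applies. *)
Lemma nonvanishing_on_fibres : b != 0 -> a != 0 -> pairing b a = 0 ->
  (forall p, exists c X, [/\ atlas M c, cdom c p &
     form_pairing b (star (hopfA S)) a c p X != 0 \/
     form_pairing b (star (hopfQ S)) a c p X != 0]) ->
  forall p v, L p v -> v != 0 -> pairing b v != 0.
Proof.
move=> bn0 an0 ba nz p v Lv vn0; apply/eqP => bv.
have [c [X [hc cp]]] := nz p.
have [l lE] := kernel_line bn0 an0 ba bv.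
have ln0 : l != 0 by apply: contra_neq vn0 => l0; rewrite lE l0 rscale0.
have aE : a = rscale v (qinv l) by rewrite lE rscaleA qmulV// rscale1.
have La : L p a by rewrite aE; exact: fibre_rscale.
have [w _ LE] := fibre_span Lsub p.
have bw : pairing b w = 0.
  move: La; rewrite LE => -[m _ am].
  have mn0 : m != 0.
    by apply: contra_neq an0 => m0; rewrite -am m0 rscale0.
  by apply: (qImul mn0); rewrite -pairing_rscale am ba mul0r.
have bL0 x : L p x -> pairing b x = 0.
  by rewrite LE => -[m _ <-]; rewrite pairing_rscale bw mul0r.
by have [-> ->] := hopf_vanish X hc cp La bL0; case; rewrite eqxx.
Qed.

End HopfForms.

Lemma hopfQ_sum (A : pzRingType) (h t s : A) :
  t - s + - h = h + t - s - (h + h).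
Proof. by ncring. Qed.

Section AffineHopf.
Variables (R : realType) (M : riemannSurface R).
Variables (L : M -> set (Hvec R)) (S : M -> 'M[quat R]_2).
Hypotheses (Lsub : line_subbundle L) (Limm : immersed L).
Hypothesis mcs : mean_curvature_sphere L S.
Variables (b : Hform R) (a : Hvec R).
Hypotheses (bn0 : b != 0) (an0 : a != 0) (ba : pairing b a = 0).
Hypothesis bL : forall p v, L p v -> v != 0 -> pairing b v != 0.
Implicit Types (c : chart R M) (p q : M) (X Y : R * R).

Theorem affine_hopf_forms : exists f N V H : M -> quat R,
  [/\ conformal_data f N V H,
    forall c p X, atlas M c -> cdom c p ->
      form_pairing b (star (hopfA S)) a c p X
      = quarter R * hopfA21 f N V H c p X &
    forall c p X, atlas M c -> cdom c p ->
      form_pairing b (star (hopfQ S)) a c p X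
      = quarter R * (hopfA21 f N V H c p X - (d H c p X + d H c p X))].
Proof.
have [e [b0 [ea bb0 eb0 frame]]] := exists_frame bn0 an0 ba.
have [psi psiP] := exists_unit_section Lsub bL.
have [sS _ _ _] := mcs.
exists (affine_f e psi), (affine_N S b e a psi), (affine_V S b psi),
  (affine_H S b a).
have E c p X : atlas M c -> cdom c p ->
    pairing b (S p *m (dmx S c p (Jplane X) *m a))
    = affine_V S b psi p * d (affine_H S b a) c p (Jplane X)
      - affine_H S b a p * (d (affine_N S b e a psi) c p (Jplane X)
          - d (affine_f e psi) c p (Jplane X) * affine_H S b a p)
  /\ pairing b (dmx S c p X *m a) = - d (affine_H S b a) c p X.
  move=> hc cp.
  have dSa := dS_a Lsub mcs ba ea frame bL psiP hc cp.
  have psi1 : pairing b (psi p) = 1 by have [] := psiP p.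
  split.
    rewrite dSa mulmxDr mulmxN !mulmx_rscale pairingB !pairing_rscale.
    have -> : pairing b (S p *m psi p) = - affine_V S b psi p.
      by rewrite /affine_V opprK.
    have -> : pairing b (S p *m a) = - affine_H S b a p.
      by rewrite /affine_H opprK.
    by rewrite !mulNr !opprK; exact: addrC.
  by rewrite dSa pairingB !pairing_rscale ba mul0r sub0r psi1 mul1r.
split.
- exact (affine_data Lsub Limm mcs ba ea frame bL psiP).
- move=> c p X hc cp; have [E1 E2] := E c p X hc cp.
  rewrite (pairing_hopfA sS)// E1 E2; congr (_ * _).
  by rewrite opprK; apply: etrans (addrC _ _) _; exact: addrA.
- move=> c p X hc cp; have [E1 E2] := E c p X hc cp.
  rewrite (pairing_hopfQ sS)// E1 E2; congr (_ * _).
  exact (hopfQ_sum _ _ _).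
Qed.

End AffineHopf.

Section BaecklundWillmore.
Variables (R : realType) (M : riemannSurface R).
Variables (L : M -> set (Hvec R)) (S : M -> 'M[quat R]_2).
Hypothesis HL : willmore_with L S.
Variables (b : Hform R) (a : Hvec R).
Hypotheses (bn0 : b != 0) (ba : pairing b a = 0).

Lemma double_of_quarter (x w : quat R) : x = 2 * (quarter R * w) -> x + x = w.
Proof.
move=> ->; rewrite quarterE qtwoE (qdbl (4^-1 *: w)) qdbl !scalerA.
by rewrite (_ : 2 * 2 * 4^-1 = 1 :> R) ?scale1r//; lra.
Qed.

Lemma willmore_of_empty (g : M -> quat R) :
  ~ (exists p : M, True) -> willmore (graph_line g).
Proof.
move=> noM; have no (p : M) : False by apply: noM; exists p.
apply: (@graph_willmore _ _ g g g g).
  by split; move=> *; exfalso; eauto.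
by move=> c p; have := no p.
Qed.

Lemma form_pairing_a0 (w : Defs.form M 'M[quat R]_2) c p X :
  a = 0 -> form_pairing b w a c p X = 0.
Proof. by move=> a0; rewrite /form_pairing a0 mulmx0 pairing0. Qed.

Lemma conformal_data_of_immersion (g : M -> quat R)
    (w : Defs.form M (quat R)) : immersion g ->
  w = form_pairing b (star (hopfA S)) a \/ w = form_pairing b (star (hopfQ S)) a ->
  form_eq (d g) (fun c p X => 2 * w c p X) -> (exists p : M, True) ->
  exists f N V H : M -> quat R,
  [/\ conformal_data f N V H,
    forall c p X, atlas M c -> cdom c p ->
      form_pairing b (star (hopfA S)) a c p X
      = quarter R * hopfA21 f N V H c p X &
    forall c p X, atlas M c -> cdom c p ->
      form_pairing b (star (hopfQ S)) a c p X
      = quarter R * (hopfA21 f N V H c p X - (d H c p X + d H c p X))].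
Proof.
move=> [/smooth_onT sg inj_g] wE dgE [p0 _].
have [Lsub Limm _ mcs _] := HL.
have wn0 c p : atlas M c -> cdom c p -> w c p (1, 0) != 0.
  move=> hc cp.
  have dg0 := injective_d_neq0 (sg _ _ hc cp) hc cp (inj_g c p hc cp) (e1_neq0 R).
  by apply: contra_neq dg0 => E; rewrite dgE// E mulr0.
have an0 : a != 0.
  apply/eqP => a0; have [c hc cp] := atlas_cover p0.
  have := wn0 c p0 hc cp.
  by case: wE => ->; rewrite form_pairing_a0// eqxx.
apply: (affine_hopf_forms Lsub Limm mcs bn0 an0 ba).
apply: (nonvanishing_on_fibres (S := S) _ Lsub mcs bn0 an0 ba); first by case: mcs.
move=> p; have [c hc cp] := atlas_cover p.
exists c, (1, 0); split=> //; have := wn0 c p hc cp.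
by case: wE => ->; [left|right].
Qed.

Theorem forward_willmore (g : M -> quat R) :
  forward_baecklund S b a g -> willmore (graph_line g).
Proof.
move=> [img dgE].
have [exM|] := pselect (exists p : M, True); last exact: willmore_of_empty.
have [f [N [V [H [cd WA _]]]]] :=
  conformal_data_of_immersion img (or_introl erefl) dgE exM.
have [/smooth_onT sg inj_g] := img.
have dgW c p X : atlas M c -> cdom c p ->
    d g c p X + d g c p X = hopfA21 f N V H c p X.
  by move=> hc cp; apply: double_of_quarter; rewrite dgE// WA.
have [N1 [V1 [H1 [cd1 /doubly_exact_closed cl1]]]] :=
  forward_exists cd sg inj_g dgW.
exact: graph_willmore cd1 cl1.
Qed.

Theorem backward_willmore (h : M -> quat R) :
  backward_baecklund S b a h -> willmore (graph_line h).
Proof.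
move=> [imh dhE].
have [exM|] := pselect (exists p : M, True); last exact: willmore_of_empty.
have [f [N [V [H [cd _ WQ]]]]] :=
  conformal_data_of_immersion imh (or_intror erefl) dhE exM.
have [/smooth_onT sh inj_h] := imh.
have dhW c p X : atlas M c -> cdom c p -> d h c p X + d h c p X
    = hopfA21 f N V H c p X - (d H c p X + d H c p X).
  by move=> hc cp; apply: double_of_quarter; rewrite dhE// WQ.
have [N1 [V1 [H1 [cd1 /doubly_exact_closed cl1]]]] :=
  backward_exists cd sh inj_h dhW.
exact: graph_willmore cd1 cl1.
Qed.

End BaecklundWillmore.

(** * Lines in the dual plane and the four-sphere *)

Section MatrixTopology.
Variables (T : topologicalType) (m n : nat).

Lemma mx_coord_continuous i j : continuous (fun A : 'M[T]_(m, n) => A i j).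
Proof.
move=> A B AB.
exists (fun i' j' => [set x | i' = i -> j' = j -> B x]).
  move=> i' j'; have [->|ni] := pselect (i' = i); last first.
    by apply: filterS filterT => x _ /ni.
  have [->|nj] := pselect (j' = j); last by apply: filterS filterT => x _ _ /nj.
  by apply: filterS AB => x Bx _ _.
by move=> N h; exact: h.
Qed.

Lemma mx_continuous (U : topologicalType) (f : U -> 'M[T]_(m, n)) x :
  (forall i j, {for x, continuous (fun y => f y i j)}) -> {for x, continuous f}.
Proof.
move=> cf A [P nP PA].
have : \forall y \near x, forall ij : 'I_m * 'I_n, P ij.1 ij.2 (f y ij.1 ij.2).
  by apply: filter_forall => -[i j] /=; exact: cf (nP i j).
by apply: filterS => y h; apply: PA => i j; exact: (h (i, j)).
Qed.

End MatrixTopology.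

Section Sphere4.
Variable R : realType.
Implicit Types (b : Hform R) (x y : quat R) (k t : R).

Definition emb5 x t : 'rV[R]_5 :=
  \row_(i < 5) [:: x 0 0; x 0 1; x 0 2; x 0 3; t]`_i.

Lemma sum5 (F : 'I_5 -> R) :
  \sum_i F i = F 0 + F 1 + F 2 + F 3 + F 4.
Proof.
rewrite !big_ord_recl big_ord0 addr0 !addrA.
by congr (_ + _ + _ + _ + _); congr (F _); exact: val_inj.
Qed.

Lemma emb5_sq x t : \sum_i emb5 x t 0 i ^+ 2 = qnorm2 x + t ^+ 2.
Proof. by rewrite sum5 !mxE. Qed.

Definition head4 (s : 'rV[R]_5) : quat R := qmk (s 0 0) (s 0 1) (s 0 2) (s 0 3).

Lemma emb5K (s : 'rV[R]_5) : emb5 (head4 s) (s 0 4) = s.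
Proof.
apply/rowP => -[[|[|[|[|[|//]]]]] hi]; rewrite mxE /= ?qmkE;
  by congr (s _ _); exact: val_inj.
Qed.

Lemma qnorm2Z k x : qnorm2 (k *: x) = k ^+ 2 * qnorm2 x.
Proof. by rewrite /qnorm2 !qscaleE; ring. Qed.

Lemma qnorm2M x y : qnorm2 (x * y) = qnorm2 x * qnorm2 y.
Proof. by rewrite /qnorm2 !qmulE !qmkE; ring. Qed.

Lemma qnorm2_conj x : qnorm2 (qconj x) = qnorm2 x.
Proof. by rewrite /qnorm2 !qmkE; ring. Qed.

Definition form_norm2 b : R := qnorm2 (b 0 0) + qnorm2 (b 0 1).

Lemma form_norm2_gt0 b : b != 0 -> 0 < form_norm2 b.
Proof.
move=> /row2_neq0 b0; rewrite lt_neqAle eq_sym addr_ge0 ?qnorm2_ge0// andbT.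
rewrite paddr_eq0 ?qnorm2_ge0// !qnorm2_eq0 negb_and.
by case: b0 => ->; rewrite ?orbT.
Qed.

(** The quaternionic Hopf map, normalised so as to be constant on lines: left
    multiplication of b by a unit quaternion cancels in qconj b0 * b1. *)
Definition hopf_map b : 'rV[R]_5 :=
  emb5 ((2 / form_norm2 b) *: (qconj (b 0 0) * b 0 1))
       ((qnorm2 (b 0 0) - qnorm2 (b 0 1)) / form_norm2 b).

Lemma hopf_map_sphere b : b != 0 -> \sum_i hopf_map b 0 i ^+ 2 = 1.
Proof.
move=> /form_norm2_gt0 n0; rewrite emb5_sq qnorm2Z qnorm2M qnorm2_conj.
move: n0; rewrite /form_norm2; move: (qnorm2 _) (qnorm2 _) => u v n0.
by field; rewrite gt_eqF.
Qed.

(** Representatives of the line over a point s of S^4.  On S^4 each of them vanishes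
    at one pole only.  Being continuous on all of R^5, they show that the Hopf
    map is a quotient map. *)
Definition north (s : 'rV[R]_5) : Hform R :=
  \row_(j < 2) [:: (1 + s 0 4) *: (1 : quat R); head4 s]`_j.
Definition south (s : 'rV[R]_5) : Hform R :=
  \row_(j < 2) [:: qconj (head4 s); (1 - s 0 4) *: (1 : quat R)]`_j.

Lemma qnorm2_real k : qnorm2 (k *: (1 : quat R)) = k ^+ 2.
Proof. by rewrite /qnorm2 !qscaleE !qone !qmkE; ring. Qed.

Lemma qconj_real k : qconj (k *: (1 : quat R)) = k *: (1 : quat R).
Proof. by apply: quatP; rewrite /qconj !qmkE !qscaleE !qone !qmkE; ring. Qed.

Lemma sphere_head (s : 'rV[R]_5) : \sum_i s 0 i ^+ 2 = 1 ->
  qnorm2 (head4 s) = 1 - s 0 4 ^+ 2.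
Proof. by rewrite -{1}(emb5K s) emb5_sq => <-; rewrite addrK. Qed.

Lemma hopf_map_north (s : 'rV[R]_5) : \sum_i s 0 i ^+ 2 = 1 -> 1 + s 0 4 != 0 ->
  hopf_map (north s) = s.
Proof.
move=> /sphere_head E t0; rewrite -[RHS]emb5K /hopf_map /form_norm2 !mxE /=.
rewrite qnorm2_real E qconj_real (qscalel (1 + s 0 4)) mul1r scalerA.
have n0 : (1 + s 0 4) ^+ 2 + (1 - s 0 4 ^+ 2) != 0.
  have -> : (1 + s 0 4) ^+ 2 + (1 - s 0 4 ^+ 2) = 2 * (1 + s 0 4) by ring.
  by rewrite mulf_neq0 ?pnatr_eq0.
congr emb5; last by field.
by rewrite (_ : _ / _ * _ = 1) ?scale1r//; field.
Qed.

Lemma hopf_map_south (s : 'rV[R]_5) : \sum_i s 0 i ^+ 2 = 1 -> 1 - s 0 4 != 0 ->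
  hopf_map (south s) = s.
Proof.
move=> /sphere_head E t0; rewrite -[RHS]emb5K /hopf_map /form_norm2 !mxE /=.
rewrite qnorm2_real qnorm2_conj E qconjK (qscaler (1 - s 0 4)) mulr1 scalerA.
have n0 : (1 - s 0 4 ^+ 2) + (1 - s 0 4) ^+ 2 != 0.
  have -> : (1 - s 0 4 ^+ 2) + (1 - s 0 4) ^+ 2 = 2 * (1 - s 0 4) by ring.
  by rewrite mulf_neq0 ?pnatr_eq0.
congr emb5; last by field.
by rewrite (_ : _ / _ * _ = 1) ?scale1r//; field.
Qed.

Lemma emb5_inj x t y t' : emb5 x t = emb5 y t' -> x = y /\ t = t'.
Proof.
move=> /rowP E; split; last by have := E 4; rewrite !mxE.
apply: quatP; [have := E 0|have := E 1|have := E 2|have := E 3];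
  by rewrite !mxE.
Qed.

Lemma hopf_map_scale b (mu : quat R) : b != 0 -> mu != 0 ->
  hopf_map (mu *: b) = hopf_map b.
Proof.
move=> /form_norm2_gt0 n0; rewrite -qnorm2_eq0 => m0.
rewrite /hopf_map /form_norm2 !mxE !qnorm2M qconjM.
have -> : qconj (b 0 0) * qconj mu * (mu * b 0 1)
    = qnorm2 mu *: (qconj (b 0 0) * b 0 1).
  by rewrite -mulrA (mulrA (qconj mu)) qconj_mul (qscalel (qnorm2 mu)) mul1r
    (qscaler (qnorm2 mu)).
rewrite scalerA; move: n0; rewrite /form_norm2.
move: (qnorm2 (b 0 0)) (qnorm2 (b 0 1)) (qnorm2 mu) m0 => u v m m0 n0.
have uv0 : u + v != 0 by rewrite gt_eqF.
have muv0 : m * u + m * v != 0 by rewrite -mulrDr mulf_neq0.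
by congr (emb5 (_ *: _) _); field; rewrite ?m0 ?uv0 ?muv0.
Qed.

Lemma hopf_map_inj b b' : b != 0 -> b' != 0 -> hopf_map b = hopf_map b' ->
  exists mu : quat R, b' = mu *: b.
Proof.
move=> bn0 bn0' /emb5_inj[].
have := form_norm2_gt0 bn0; have := form_norm2_gt0 bn0'.
rewrite /form_norm2.
set u := qnorm2 (b 0 0); set v := qnorm2 (b 0 1).
set u' := qnorm2 (b' 0 0); set v' := qnorm2 (b' 0 1) => n0' n0 E1 E2.
have nn : u + v != 0 by rewrite gt_eqF.
have nn' : u' + v' != 0 by rewrite gt_eqF.
have E3 : u / (u + v) = u' / (u' + v').
  have -> : u / (u + v) = ((u - v) / (u + v) + 1) / 2 by field.
  by rewrite E2; field.
have E4 : u * (u' + v') = u' * (u + v).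
  have := congr1 (fun t => t * (u + v) * (u' + v')) E3.
  by rewrite divfK// => ->; field.
have [b00|b00] := eqVneq (b 0 0) 0.
  have u0 : u = 0 by apply/eqP; rewrite qnorm2_eq0 b00.
  have u0' : u' = 0.
    have /eqP : u' * (u + v) = 0 by rewrite -E4 u0 mul0r.
    by rewrite mulf_eq0 (negPf nn) orbF => /eqP.
  have b00' : b' 0 0 = 0 by apply/eqP; rewrite -qnorm2_eq0 -/u' u0'.
  have b01 : b 0 1 != 0 by case: (row2_neq0 bn0) => //; rewrite b00 eqxx.
  exists (b' 0 1 * qinv (b 0 1)); apply/rowP; apply: ord2P; rewrite mxE.
    by rewrite b00 b00' mulr0.
  by rewrite -mulrA qVmul// mulr1.
have u0 : u != 0 by rewrite qnorm2_eq0.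
exists (b' 0 0 * qinv (b 0 0)); apply/rowP; apply: ord2P; rewrite mxE.
  by rewrite -mulrA qVmul// mulr1.
rewrite /qinv -/u (qscaler u^-1) (qscalel u^-1) -mulrA.
have -> : qconj (b 0 0) * b 0 1
    = ((u + v) / (u' + v')) *: (qconj (b' 0 0) * b' 0 1).
  have := congr1 (fun w : quat R => ((u + v) / 2) *: w) E1.
  rewrite !scalerA (_ : _ / 2 * (2 / _) = 1) ?scale1r; last by field.
  by move=> ->; congr (_ *: _); field.
rewrite (qscaler _ (b' 0 0)) mulrA qmul_conj -/u' (qscalel u') mul1r !scalerA.
rewrite (_ : _ * u' = 1) ?scale1r//.
have -> : u^-1 * ((u + v) / (u' + v')) * u' = (u' * (u + v)) / (u * (u' + v')).
  by field; rewrite u0 nn'.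
by rewrite E4 divff// -E4 mulf_neq0.
Qed.

End Sphere4.

Arguments hopf_map {R} b.
Arguments head4 {R} s.
Arguments north {R} s.
Arguments south {R} s.

Section HopfContinuity.
Variable R : realType.
Implicit Types b : Hform R.

(** The formula of [hopf_map] on a normed space, where continuity is obtained from
    differentiability. *)
Definition hopf_pair (w : quat R * quat R) : 'rV[R]_5 :=
  emb5 ((2 / (qnorm2 w.1 + qnorm2 w.2)) *: (qconj w.1 * w.2))
       ((qnorm2 w.1 - qnorm2 w.2) / (qnorm2 w.1 + qnorm2 w.2)).

Lemma differentiable_hopf_pair w : qnorm2 w.1 + qnorm2 w.2 != 0 ->
  differentiable hopf_pair w.
Proof.
move=> n0.
have d1 := differentiable_qnorm2 (differentiable_fst w).
have d2 := differentiable_qnorm2 (differentiable_snd w).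
have dI : differentiable (fun y : quat R * quat R =>
    (qnorm2 y.1 + qnorm2 y.2)^-1) w.
  by apply: differentiableV => //; exact: differentiableD d1 d2.
have dq : differentiable (fun y : quat R * quat R => qconj y.1 * y.2) w.
  apply: differentiable_qmul; last exact: differentiable_snd.
  by apply: differentiable_qconj; exact: differentiable_fst.
have dqi i : differentiable (fun y : quat R * quat R => (qconj y.1 * y.2) 0 i) w.
  by move/differentiable_quatP : dq; exact.
have d2I : differentiable (fun y : quat R * quat R =>
    2 / (qnorm2 y.1 + qnorm2 y.2)) w.
  exact: differentiableM (differentiable_cst _ _) dI.
have dhead i : differentiable (fun y : quat R * quat R =>
    2 / (qnorm2 y.1 + qnorm2 y.2) * (qconj y.1 * y.2) 0 i) w.
  exact: differentiableM d2I (dqi i).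
have dlast : differentiable (fun y : quat R * quat R =>
    (qnorm2 y.1 - qnorm2 y.2) / (qnorm2 y.1 + qnorm2 y.2)) w.
  by apply: differentiableM dI; exact: differentiableB d1 d2.
apply: differentiable_rowP => -[[|[|[|[|[|//]]]]] hi].
- rewrite (_ : (fun y => _) = (fun y : quat R * quat R =>
    2 / (qnorm2 y.1 + qnorm2 y.2) * (qconj y.1 * y.2) 0 0)); first exact: dhead.
  by apply/funext => y; rewrite mxE /= qscaleE.
- rewrite (_ : (fun y => _) = (fun y : quat R * quat R =>
    2 / (qnorm2 y.1 + qnorm2 y.2) * (qconj y.1 * y.2) 0 1)); first exact: dhead.
  by apply/funext => y; rewrite mxE /= qscaleE.
- rewrite (_ : (fun y => _) = (fun y : quat R * quat R =>
    2 / (qnorm2 y.1 + qnorm2 y.2) * (qconj y.1 * y.2) 0 2)); first exact: dhead.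
  by apply/funext => y; rewrite mxE /= qscaleE.
- rewrite (_ : (fun y => _) = (fun y : quat R * quat R =>
    2 / (qnorm2 y.1 + qnorm2 y.2) * (qconj y.1 * y.2) 0 3)); first exact: dhead.
  by apply/funext => y; rewrite mxE /= qscaleE.
- rewrite (_ : (fun y => _) = (fun y : quat R * quat R =>
    (qnorm2 y.1 - qnorm2 y.2) / (qnorm2 y.1 + qnorm2 y.2))); first exact: dlast.
  by apply/funext => y; rewrite mxE.
Qed.

Lemma hopf_map_continuous b : b != 0 -> {for b, continuous hopf_map}.
Proof.
move=> bn0.
apply: (@continuous_comp _ _ _ (fun b : Hform R => (b 0 0, b 0 1)) hopf_pair).
  exact: (cvg_pair (@mx_coord_continuous (quat R) 1 2 0 0 b)
    (@mx_coord_continuous (quat R) 1 2 0 1 b)).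
apply: differentiable_continuous; apply: differentiable_hopf_pair => /=.
by rewrite gt_eqF//; exact: form_norm2_gt0.
Qed.

Lemma head4_differentiable (s : 'rV[R]_5) : differentiable head4 s.
Proof.
apply/differentiable_quatP => -[[|[|[|[|//]]]] hi].
- rewrite (_ : (fun y => _) = (fun y : 'rV[R]_5 => y 0 0)).
    exact: differentiable_coord.
  by apply/funext => y; rewrite mxE.
- rewrite (_ : (fun y => _) = (fun y : 'rV[R]_5 => y 0 1)).
    exact: differentiable_coord.
  by apply/funext => y; rewrite mxE.
- rewrite (_ : (fun y => _) = (fun y : 'rV[R]_5 => y 0 2)).
    exact: differentiable_coord.
  by apply/funext => y; rewrite mxE.
- rewrite (_ : (fun y => _) = (fun y : 'rV[R]_5 => y 0 3)).
    exact: differentiable_coord.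
  by apply/funext => y; rewrite mxE.
Qed.

Lemma north_continuous : continuous (@north R).
Proof.
move=> s; apply: mx_continuous => i; apply: ord2P.
  rewrite (_ : (fun y => _)
    = (fun y : 'rV[R]_5 => (1 + y 0 4) *: (1 : quat R))); last first.
    by apply/funext => y; rewrite mxE.
  apply: differentiable_continuous; apply: differentiableZl.
  exact: differentiableD (differentiable_cst _ _) (differentiable_coord _ _ _).
rewrite (_ : (fun y => _) = head4); last by apply/funext => y; rewrite mxE.
by apply: differentiable_continuous; exact: head4_differentiable.
Qed.

Lemma south_continuous : continuous (@south R).
Proof.
move=> s; apply: mx_continuous => i; apply: ord2P.
  rewrite (_ : (fun y => _) = (fun y : 'rV[R]_5 => qconj (head4 y))); last first.
    by apply/funext => y; rewrite mxE.
  apply: differentiable_continuous; apply: differentiable_qconj.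
  exact: head4_differentiable.
rewrite (_ : (fun y => _)
  = (fun y : 'rV[R]_5 => (1 - y 0 4) *: (1 : quat R))); last first.
  by apply/funext => y; rewrite mxE.
apply: differentiable_continuous; apply: differentiableZl.
exact: differentiableB (differentiable_cst _ _) (differentiable_coord _ _ _).
Qed.

Lemma north_neq0 (s : 'rV[R]_5) : 1 + s 0 4 != 0 -> north s != 0.
Proof.
move=> t0; apply/eqP => /rowP/(_ 0); rewrite !mxE /= => /eqP.
by rewrite scaler_eq0 (negPf t0) oner_eq0.
Qed.

Lemma south_neq0 (s : 'rV[R]_5) : 1 - s 0 4 != 0 -> south s != 0.
Proof.
move=> t0; apply/eqP => /rowP/(_ 1); rewrite !mxE /= => /eqP.
by rewrite scaler_eq0 (negPf t0) oner_eq0.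
Qed.

Lemma north_eq0 (s : 'rV[R]_5) : \sum_i s 0 i ^+ 2 = 1 -> north s != 0 ->
  1 + s 0 4 != 0.
Proof.
move=> /sphere_head E; apply: contra_neq => t0.
have h0 : head4 s = 0.
  apply/eqP; rewrite -qnorm2_eq0 E (_ : s 0 4 = -1) ?sqrrN ?expr1n ?subrr//.
  by apply/eqP; rewrite -addr_eq0 addrC t0.
by apply/rowP; apply: ord2P; rewrite !mxE /= ?t0 ?scale0r ?h0.
Qed.

Lemma south_eq0 (s : 'rV[R]_5) : \sum_i s 0 i ^+ 2 = 1 -> south s != 0 ->
  1 - s 0 4 != 0.
Proof.
move=> /sphere_head E; apply: contra_neq => t0.
have s4 : s 0 4 = 1 by apply/esym/eqP; rewrite -subr_eq0 t0.
have h0 : head4 s = 0.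
  by apply/eqP; rewrite -qnorm2_eq0 E s4 expr1n subrr.
apply/rowP; apply: ord2P; rewrite !mxE /= ?t0 ?scale0r ?h0//.
by apply: quatP; rewrite /qconj !qmkE !qzeroE ?oppr0.
Qed.

Theorem hopf_map_homeo : lines_homeo_S4 (@hopf_map R).
Proof.
have two (t : R) : 1 + t != 0 \/ 1 - t != 0.
  have [t0|] := eqVneq (1 + t) 0; last by left.
  by right; apply/eqP => t1; lra.
split.
- apply/seteqP; split=> [_ [b bn0 <-]|s Ss]; first exact: hopf_map_sphere.
  have [t0|t0] := two (s 0 4).
    by exists (north s); [exact: north_neq0|exact: hopf_map_north].
  by exists (south s); [exact: south_neq0|exact: hopf_map_south].
- move=> b b' bn0 bn0'; split; first exact: hopf_map_inj.
  move=> [mu E]; rewrite E hopf_map_scale//.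
  by apply: contra_neq bn0' => mu0; rewrite E mu0 scale0r.
- apply: continuous_in_subspaceT => b; rewrite inE; exact: hopf_map_continuous.
- move=> W WS oW.
  (* The open set is the locus where a representative that does not vanish lies
     over W. *)
  exists (north @^-1` ([set b | b != 0] `&` hopf_map @^-1` W)
       `|` south @^-1` ([set b | b != 0] `&` hopf_map @^-1` W)).
    by apply: openU; apply: open_comp => // s _;
      [exact: north_continuous|exact: south_continuous].
  apply/seteqP; split=> [s Ws|s [Ss [[nz]|[nz]]]].
  + have Ss := WS s Ws; split=> //.
    have [t0|t0] := two (s 0 4); [left|right].
      by split; [exact: north_neq0|rewrite /preimage /= hopf_map_north].
    by split; [exact: south_neq0|rewrite /preimage /= hopf_map_south].
  + by rewrite /preimage /= hopf_map_north//; exact: north_eq0.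
  + by rewrite /preimage /= hopf_map_south//; exact: south_eq0.
Qed.

End HopfContinuity.

(** * Transforms for different parameters *)

Section Primitives.
Variables (R : realType) (M : riemannSurface R).
Implicit Types (c : chart R M) (p q : M) (X Y : R * R).

(** Both g' and mu g l are primitives of w' on a connected surface.  The factors mu
    and l are invertible, so immersions are preserved. *)
Lemma immersed_primitive_transform (w w' : Defs.form M (quat R))
    (mu l : quat R) (g g' : M -> quat R) :
  mu != 0 -> l != 0 ->
  (forall c p X, w' c p X = mu * w c p X * l) ->
  immersion g /\ form_eq (d g) w ->
  immersion g' /\ form_eq (d g') w' <->
  exists k : quat R, forall p, g' p = mu * g p * l + k.
Proof.
move=> mu0 l0 ww' [[/smooth_onT sg inj_g] dgE].
have smg c p : atlas M c -> cdom c p -> smooth_at c p (fun q => mu * g q * l).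
  move=> hc cp; apply: smooth_atM => //; last exact: smooth_at_cst.
  by apply: smooth_atM => //; [exact: smooth_at_cst|exact: sg].
have dmg c p X : atlas M c -> cdom c p ->
    d (fun q => mu * g q * l) c p X = w' c p X.
  move=> hc cp; have sgp := sg _ _ hc cp.
  have sm := smooth_atM hc (smooth_at_cst c p mu) sgp.
  rewrite (dM hc cp X sm (smooth_at_cst c p l)).
  rewrite (dM hc cp X (smooth_at_cst c p mu) sgp) !d_cst mul0r add0r mulr0 addr0.
  by rewrite ww' dgE.
split=> [[[/smooth_onT sg' _] dgE']|[k g'E]].
  have [k kE] : exists k, forall p, g' p - mu * g p * l = k.
    apply: constant_of_d_eq0 => c p; [move=> hc cp|move=> X hc cp].
      apply: smooth_atD => //; first exact: sg'.
      by apply: smooth_atN => //; exact: smg.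
    have s1 := sg' _ _ hc cp; have s2 := smg _ _ hc cp.
    rewrite (dD hc cp X s1 (smooth_atN hc s2)) (dN hc cp X s2).
    by rewrite (dgE' c p hc cp X) (dmg c p X hc cp) subrr.
  by exists k => p; rewrite -(kE p) addrC subrK.
have dE c p X : atlas M c -> cdom c p -> d g' c p X = w' c p X.
  move=> hc cp; have sk := smooth_at_cst c p k.
  have -> : g' = (fun q => mu * g q * l + k) by exact/funext.
  rewrite (dD hc cp X (smg _ _ hc cp) sk) d_cst addr0; exact: dmg.
split; last by move=> c p hc cp X; exact: dE.
split.
  apply/smooth_onT => c p hc cp.
  have -> : g' = (fun q => mu * g q * l + k) by exact/funext.
  by apply: smooth_atD => //; [exact: smg|exact: smooth_at_cst].
move=> c p hc cp X Y; rewrite (dE c p X hc cp) (dE c p Y hc cp) !ww'.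
move=> /(qImul l0)/(qmulI mu0); rewrite -(dgE c p hc cp X) -(dgE c p hc cp Y).
exact: inj_g.
Qed.

Lemma form_pairing_scalel mu b (w : Defs.form M 'M[quat R]_2) a c p X :
  2 * form_pairing (mu *: b) w a c p X = mu * (2 * form_pairing b w a c p X) * 1.
Proof.
by rewrite /form_pairing pairing_scalel mulr1 !qtwoE mulrDr.
Qed.

Lemma form_pairing_rscale l b (w : Defs.form M 'M[quat R]_2) a c p X :
  2 * form_pairing b w (rscale a l) c p X = 1 * (2 * form_pairing b w a c p X) * l.
Proof.
by rewrite /form_pairing mulmx_rscale pairing_rscale mul1r mulrA.
Qed.

End Primitives.

Theorem theorem6 (R : realType) (M : riemannSurface R)
    (L : M -> set 'cV[quat R]_2) (S : M -> 'M[quat R]_2)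
    (HL : willmore_with L S) :
  (* closedness, and Willmore property of the transforms *)
  (forall (b : 'rV[quat R]_2) (a : 'cV[quat R]_2),
     b != 0 -> pairing b a = 0 ->
     [/\ closed_form (form_pairing b (star (hopfA S)) a),
         closed_form (form_pairing b (star (hopfQ S)) a),
         forall g : M -> quat R, forward_baecklund S b a g ->
           willmore (graph_line g) &
         forall h : M -> quat R, backward_baecklund S b a h ->
           willmore (graph_line h)]) /\
  (* the parameter space of the pairs is the S^4 of lines in the dual space *)
  (exists2 sigma : 'rV[quat R]_2 -> 'rV[R]_5, lines_homeo_S4 sigma &
   forall b b' : 'rV[quat R]_2, b != 0 -> b' != 0 -> sigma b = sigma b' ->
   exists mu : quat R, [/\ mu != 0, b' = mu *: b &
     forall a : 'cV[quat R]_2, a != 0 -> pairing b a = 0 ->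
       pairing b' a = 0 /\
       (forall g, forward_baecklund S b a g -> forall g',
          forward_baecklund S b' a g' <->
          exists k : quat R, forall p, g' p = mu * g p + k) /\
       (forall h, backward_baecklund S b a h -> forall h',
          backward_baecklund S b' a h' <->
          exists k : quat R, forall p, h' p = mu * h p + k)]) /\
  (* every line b occurs, and its transforms for different a are related by
     right multiplication by a constant (up to the constant of integration) *)
  (forall b : 'rV[quat R]_2, b != 0 ->
   (exists2 a : 'cV[quat R]_2, a != 0 & pairing b a = 0) /\
   forall a a' : 'cV[quat R]_2, a != 0 -> a' != 0 ->
     pairing b a = 0 -> pairing b a' = 0 ->
   exists l : quat R, [/\ l != 0, a' = rscale a l,
     forall g, forward_baecklund S b a g -> forall g',
       forward_baecklund S b a' g' <->
       exists k : quat R, forall p, g' p = g p * l + k &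
     forall h, backward_baecklund S b a h -> forall h',
       backward_baecklund S b a' h' <->
       exists k : quat R, forall p, h' p = h p * l + k]).
Proof.
have [_ _ _ [sS _ _ _] clA] := HL.
split; [|split].
- move=> b a bn0 ba; split.
  + apply: closed_form_pairing => //; exact: smooth_star_hopfA.
  + apply: closed_form_pairing; first exact: smooth_star_hopfQ.
    exact: closed_star_hopfQ.
  + by move=> g hg; exact (forward_willmore HL bn0 ba hg).
  + by move=> h hh; exact (backward_willmore HL bn0 ba hh).
- exists (@hopf_map R); first exact: hopf_map_homeo.
  move=> b b' bn0 bn0' /(hopf_map_inj bn0 bn0')[mu b'E]; exists mu.
  have mu0 : mu != 0 by apply: contra_neq bn0' => mu0; rewrite b'E mu0 scale0r.
  have prim (w : Defs.form M 'M[quat R]_2) a g g' :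
      immersion g /\ form_eq (d g) (fun c p X => 2 * form_pairing b w a c p X) ->
      immersion g' /\ form_eq (d g') (fun c p X => 2 * form_pairing b' w a c p X)
      <-> exists k : quat R, forall p, g' p = mu * g p + k.
    move=> hg; apply: iff_trans (immersed_primitive_transform g' mu0
      (oner_neq0 _) _ hg) _.
      by move=> c p X; rewrite b'E; exact: form_pairing_scalel.
    by split=> -[k kE]; exists k => p; rewrite kE mulr1.
  split=> // a _ ba; split; first by rewrite b'E pairing_scalel ba mulr0.
  by split=> [g hg g'|h hh h']; [exact: prim hg|exact: prim hh].
- move=> b bn0; split; first exact: exists_kernel_vector.
  move=> a a' an0 an0' ba ba'.
  have [l a'E] := kernel_line bn0 an0 ba ba'; exists l.
  have l0 : l != 0 by apply: contra_neq an0' => l0; rewrite a'E l0 rscale0.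
  have prim (w : Defs.form M 'M[quat R]_2) g g' :
      immersion g /\ form_eq (d g) (fun c p X => 2 * form_pairing b w a c p X) ->
      immersion g' /\ form_eq (d g') (fun c p X => 2 * form_pairing b w a' c p X)
      <-> exists k : quat R, forall p, g' p = g p * l + k.
    move=> hg; apply: iff_trans (immersed_primitive_transform g' (oner_neq0 _)
      l0 _ hg) _.
      by move=> c p X; rewrite a'E; exact: form_pairing_rscale.
    by split=> -[k kE]; exists k => p; rewrite kE mul1r.
  by split=> // [g hg g'|h hh h']; [exact: prim hg|exact: prim hh].
Qed.
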